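(* Let $L$ be a countable signature, let $\mathcal{F}$ be a fragment of continuous $\mathcal{L}_{\omega_1\omega}(L)$, let $T$ be an $\mathcal{F}$-theory and let $\xi \in \mathrm{Mod}(T)$. Let $t_{\mathcal{F}}$ be the topology on $\mathrm{Mod}(T)$ given by the fragment $\mathcal{F}$ and let $[\xi] = \{\eta \in \mathrm{Mod}(T) : M_\eta \cong M_\xi\}$. Then the following are equivalent: (i) $[\xi]$ is $\mathbf{\Pi}^0_2$ (that is, $G_\delta$) in $t_{\mathcal{F}}$; (ii) $[\xi]$ is comeager in its $t_{\mathcal{F}}$-closure $\overline{[\xi]}^{t_{\mathcal{F}}}$ (with the topology induced by $t_{\mathcal F}$); (iii) $[\xi]$ is non-meager in $\overline{[\xi]}^{t_{\mathcal{F}}}$; (iv) the model $M_\xi$ encoded by $\xi$ is $\mathcal{F}$-atomic.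
   Context: Logic. A modulus of continuity is a continuous $\Delta\colon[0,\infty)\to[0,\infty)$ with $\Delta(0)=0$ and $\Delta(r)\le\Delta(r+s)\le\Delta(r)+\Delta(s)$; a map $f$ between metric spaces respects $\Delta$ if $d(f(x),f(x'))\le\Delta(d(x,x'))$. A countable signature $L$ consists of predicate and function symbols (constants are $0$-ary functions), each with an arity and a modulus of continuity, and each predicate symbol also with a compact interval bounding its values; there is a distinguished binary predicate $d$ for the metric. An $L$-structure is a complete metric space $(M,d)$ with interpretations of the symbols respecting arities, moduli and bounds; $M^k$ carries the max metric $d(\bar a,\bar b)=\max_i d(a_i,b_i)$. Continuous $\mathcal{L}_{\omega_1\omega}(L)$-formulas are real-valued, built from atomic formulas and the constant $1$ using $\phi+\psi$, $r\phi$ ($r\in\mathbb{Q}$), $\max$, $\min$, $\sup_x$, $\inf_x$, and countable suprema and infima of families of formulas in the same finite tuple of free variables respecting a common modulus of continuity and bound. A sentence is a formula without free variables; a theory is a set of conditions $\phi=c$ with $\phi$ a sentence and $c\in\mathbb{R}$; $M\models T$ means $\phi^M=c$ for all conditions in $T$. A fragment $\mathcal{F}$ is a countable set of formulas containing all atomic formulas and closed under the finitary connectives, quantifiers, subformulas, and substitution of terms for variables. An $\mathcal{F}$-theory is a theory all of whose sentences are in $\mathcal{F}$. $\mathrm{Th}_{\mathcal F}(M)$ is the set of conditions $\phi=\phi^M$, $\phi\in\mathcal F$ a sentence. Types. For a tuple $\bar a$ in $M$, $\mathrm{tp}_{\mathcal F}(\bar a)$ is the map $\phi\mapsto\phi^M(\bar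 a)$ on $\mathcal F$-formulas. $\mathrm{S}_n(T)$ is the set of all $\mathrm{tp}_{\mathcal F}(\bar a)$, $M\models T$, $\bar a\in M^n$; $\tau$ is the topology on it of pointwise convergence on $\mathcal F$-formulas. The metric $\partial$ (possibly with value $\infty$) on $\mathrm{S}_n(T)$ is: $\partial(p,q)$ is the infimum of those $s$ such that for all $\tau$-open $U\ni p$, $V\ni q$ there are $M\models T$ and $\bar a,\bar b\in M^n$ with $\mathrm{tp}_{\mathcal F}(\bar a)\in U$, $\mathrm{tp}_{\mathcal F}(\bar b)\in V$, $d(\bar a,\bar b)<s$. A type $p\in\mathrm S_n(T)$ is isolated if for every $\delta>0$ it lies in the $\tau$-interior of the open $\partial$-ball of radius $\delta$ around $p$. A structure $M$ is $\mathcal{F}$-atomic if for every $n$ and $\bar a\in M^n$, $\mathrm{tp}_{\mathcal F}(\bar a)$ is isolated in $\mathrm{S}_n(\mathrm{Th}_{\mathcal F}(M))$. Space of models. Let $\bar x=(x_0,x_1,\dots)$. $\mathrm{Mod}(T)$ is the set of types $\xi=\mathrm{tp}_{\mathcal F}(\bar a)$ of sequences $\bar a\in M^{\mathbb N}$ in models $M\models T$ such that $(\inf_y\phi(y,\bar x))^\xi=\inf_j\phi(x_j,\bar x)^\xi$ for all $\phi\in\mathcal F$; equivalently, $\overline{\{a_i:i\in\mathbb N\}}$ is an $\mathcal F$-elementary substructure of $M$. This structure is denoted $M_\xi$; it is a separable model of $T$, well defined up to isomorphism. So $\xi$ codes a separable model of $T$ together with an enumerated dense sequence. The topology $t_{\mathcal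 F}$ is that of pointwise convergence on $\mathcal F$-formulas, with basic open sets $\{\xi:\phi^\xi(u)<r\}$ for $\phi\in\mathcal F$, $u$ a finite tuple of naturals, $r\in\mathbb R$, where $\phi^\xi(u)=\phi^{M_\xi}(a_{u_0},a_{u_1},\dots)$. It is Polish. *)

(* Defs.v *)
From HB Require Import structures.
From mathcomp Require Import all_boot all_order all_algebra.
From mathcomp Require Import all_classical all_reals all_analysis.

Set Implicit Arguments.
Unset Strict Implicit.
Unset Printing Implicit Defensive.

Import Order.TTheory GRing.Theory Num.Theory.
Import numFieldNormedType.Exports.

Local Open Scope classical_set_scope.
Local Open Scope ring_scope.

Definition nowhere_dense (X : topologicalType) (A : set X) : Prop :=
  interior (closure A) = set0.

Definition meager (X : topologicalType) (A : set X) : Prop :=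
  exists2 N : (set X)^nat, (forall i, nowhere_dense (N i)) & A = \bigcup_i N i.

Definition comeager (X : topologicalType) (A : set X) : Prop := meager (~` A).

(* The trace of [A] on the subset [C], as a subset of the space [C] with the
   induced topology. *)
Definition trace (X : topologicalType) (C A : set X) : set C :=
  [set x : C | A (val x)].

Arguments trace {X} C A.

HB.instance Definition _ (R : realType) (X : metricType R) (A : set X) :=
  @PseudoMetric_isMetric.Build R (set_type A)
    (fun x y => mdist (val x) (val y))
    (fun x y => mdist_ge0 (val x) (val y))
    (fun x y xy => val_inj (mdist_positivity _ _ xy))
    (fun x d => congr1 (fun B : set X => val @^-1` B) (ballEmdist (val x) d)).

Definition complete_space (X : uniformType) : Prop :=
  forall F : set_system X, ProperFilter F -> cauchy F -> exists x : X, F --> x.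

(* The maximum metric on [M^n]. *)
Definition tdist (R : realType) (M : metricType R) n (a b : 'I_n -> M) : R :=
  \big[Num.max/0]_(i < n) mdist (a i) (b i).

Lemma closure_mdistP (R : realType) (M : metricType R) (A : set M) (x : M) :
  closure A x <-> forall e : R, 0 < e -> exists2 y, A y & mdist x y < e.
Proof.
split=> [Ax e e0|H B /nbhs_ballP[e /= e0 xB]].
  have [y [Ay]] := Ax _ (nbhsx_ballx x e e0).
  by rewrite ballEmdist /= => xy; exists y.
have [y Ay xy] := H e e0; exists y; split => //; apply: xB.
by rewrite ballEmdist.
Qed.

Lemma tdist_ge0 (R : realType) (M : metricType R) n (a b : 'I_n -> M) :
  0 <= tdist a b.
Proof.
rewrite /tdist; elim/big_ind: _ => // [x y x0 y0|i _].
  by rewrite le_max x0.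
exact: mdist_ge0.
Qed.

Lemma tdist_le (R : realType) (M : metricType R) n (a b : 'I_n -> M) (e : R) :
  0 <= e -> (forall i, mdist (a i) (b i) <= e) -> tdist a b <= e.
Proof.
by move=> e0 H; rewrite /tdist; elim/big_ind: _ => // x y; rewrite ge_max => -> ->.
Qed.

(* Only the values on [0, +oo[ matter. *)
Record modulus (R : realType) := Modulus {
  modulus_fun :> R -> R ;
  modulus_continuous : {within `[0, +oo[%classic, continuous modulus_fun} ;
  modulus0 : modulus_fun 0 = 0 ;
  modulus_homo : forall r s, 0 <= r -> 0 <= s ->
    modulus_fun r <= modulus_fun (r + s) ;
  modulus_subadditive : forall r s, 0 <= r -> 0 <= s ->
    modulus_fun (r + s) <= modulus_fun r + modulus_fun s }.

Lemma modulus_small (R : realType) (D : modulus R) (e : R) : 0 < e ->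
  exists2 d : R, 0 < d & forall r, 0 <= r -> r <= d -> D r < e.
Proof.
move=> e0.
have Dc := @modulus_continuous _ D.
have /subspace_continuousP /(_ 0) := Dc.
rewrite /= in_itv /= lexx => /(_ isT) /cvgrPdist_lt /(_ e e0).
rewrite /within /= => /nbhs_ballP [d /= d0 H].
exists (d / 2) => [|r r0 rd]; first by rewrite divr_gt0.
have := H r; rewrite /ball /= sub0r normrN ger0_norm // in_itv /= r0 /=.
have rd' : r < d by rewrite (le_lt_trans rd) // ltr_pdivrMr // ltr_pMr // ltr1n.
move=> /(_ rd' isT); rewrite /from_subspace modulus0 sub0r normrN.
exact: le_lt_trans (ler_norm _).
Qed.

Record signature (R : realType) := Signature {
  fun_sym : countType ;
  farity : fun_sym -> nat ;
  fmod : fun_sym -> modulus R ;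
  pred_sym : countType ;
  parity : pred_sym -> nat ;
  pmod : pred_sym -> modulus R ;
  plow : pred_sym -> R ;
  phigh : pred_sym -> R ;
  plow_high : forall P, plow P <= phigh P ;
  dist_sym : pred_sym ;
  parity_dist_sym : parity dist_sym = 2%N }.

Arguments farity {R s}. Arguments fmod {R s}. Arguments parity {R s}.
Arguments pmod {R s}. Arguments plow {R s}. Arguments phigh {R s}.
Arguments dist_sym {R s}. Arguments parity_dist_sym {R} s.

(* The pair [(x, y)], as a tuple of arguments for the symbol [d]. *)
Definition dist_pair (R : realType) (L : signature R) (X : Type) (x y : X) :
    'I_(parity (@dist_sym R L)) -> X :=
  fun i => if val i == 0%N then x else y.

(* Structures are non-empty, so that sup and inf over them are meaningful. *)
Record structure (R : realType) (L : signature R) := Structure {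
  carrier :> metricType R ;
  carrier_neq0 : [set: carrier] !=set0 ;
  carrier_complete : complete_space carrier ;
  finterp : forall f : fun_sym L, ('I_(farity f) -> carrier) -> carrier ;
  finterp_mod : forall f a b,
    mdist (@finterp f a) (@finterp f b) <= fmod f (tdist a b) ;
  pinterp : forall P : pred_sym L, ('I_(parity P) -> carrier) -> R ;
  pinterp_mod : forall P a b,
    `|@pinterp P a - @pinterp P b| <= pmod P (tdist a b) ;
  pinterp_bound : forall P a, plow P <= @pinterp P a <= phigh P ;
  pinterp_dist : forall x y, @pinterp dist_sym (dist_pair x y) = mdist x y }.

Arguments finterp {R L} s f a. Arguments pinterp {R L} s P a.

Definition isomorphic (R : realType) (L : signature R) (M N : structure L) :
    Prop :=
  exists h : M -> N,
    [/\ bijective h,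
        forall (f : fun_sym L) a, h (finterp M f a) = finterp N f (h \o a) &
        forall (P : pred_sym L) a, pinterp N P (h \o a) = pinterp M P a].

(* Well-scoped de Bruijn syntax: [term L n] and [preformula L n] have their
   free variables among [n] variables, indexed by ['I_n]; in the body of a
   quantifier the bound variable has index [0]. *)

Definition scons (X : Type) n (x : X) (a : 'I_n -> X) : 'I_n.+1 -> X :=
  fun i => if unlift ord0 i is Some j then a j else x.

Lemma scons0 (X : Type) n (x : X) (a : 'I_n -> X) : scons x a ord0 = x.
Proof. by rewrite /scons unlift_none. Qed.

Lemma scons_lift (X : Type) n (x : X) (a : 'I_n -> X) i :
  scons x a (lift ord0 i) = a i.
Proof. by rewrite /scons liftK. Qed.

Lemma comp_scons (X Y : Type) n (g : X -> Y) (x : X) (a : 'I_n -> X) :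
  g \o scons x a = scons (g x) (g \o a).
Proof. by apply/funext => i; rewrite /scons /=; case: unlift. Qed.

Inductive term (R : realType) (L : signature R) (n : nat) : Type :=
| tvar of 'I_n
| tapp (f : fun_sym L) of ('I_(farity f) -> term L n).

Arguments tvar {R L n}.

Inductive preformula (R : realType) (L : signature R) : nat -> Type :=
| fatom n (P : pred_sym L) : ('I_(parity P) -> term L n) -> preformula L n
| fone n : preformula L n
| fadd n : preformula L n -> preformula L n -> preformula L n
| fscale n : rat -> preformula L n -> preformula L n
| fmax n : preformula L n -> preformula L n -> preformula L n
| fmin n : preformula L n -> preformula L n -> preformula L n
| fsup n : preformula L n.+1 -> preformula L n
| finf n : preformula L n.+1 -> preformula L n
| fcsup n : (nat -> preformula L n) -> preformula L n
| fcinf n : (nat -> preformula L n) -> preformula L n.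

Arguments fatom {R L n} P t. Arguments fone {R L n}.

Fixpoint tsubst (R : realType) (L : signature R) n m (s : 'I_n -> term L m)
    (t : term L n) : term L m :=
  match t with
  | tvar i => s i
  | tapp f ts => tapp (fun i => tsubst s (ts i))
  end.

Definition slift (R : realType) (L : signature R) n m (s : 'I_n -> term L m) :
    'I_n.+1 -> term L m.+1 :=
  scons (tvar ord0) (fun i => tsubst (fun j => tvar (lift ord0 j)) (s i)).

Fixpoint fsubst (R : realType) (L : signature R) n (phi : preformula L n) :
    forall m, ('I_n -> term L m) -> preformula L m :=
  match phi with
  | fatom _ P ts => fun m s => fatom P (fun i => tsubst s (ts i))
  | fone _ => fun m s => fone
  | fadd _ p q => fun m s => fadd (fsubst p s) (fsubst q s)
  | fscale _ r p => fun m s => fscale r (fsubst p s)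
  | fmax _ p q => fun m s => fmax (fsubst p s) (fsubst q s)
  | fmin _ p q => fun m s => fmin (fsubst p s) (fsubst q s)
  | fsup _ p => fun m s => fsup (fsubst p (slift s))
  | finf _ p => fun m s => finf (fsubst p (slift s))
  | fcsup _ p => fun m s => fcsup (fun i => fsubst (p i) s)
  | fcinf _ p => fun m s => fcinf (fun i => fsubst (p i) s)
  end.

Inductive immediate_subformula (R : realType) (L : signature R) :
    forall m n, preformula L m -> preformula L n -> Prop :=
| sub_addl n (p q : preformula L n) : immediate_subformula p (fadd p q)
| sub_addr n (p q : preformula L n) : immediate_subformula q (fadd p q)
| sub_scale n r (p : preformula L n) : immediate_subformula p (fscale r p)
| sub_maxl n (p q : preformula L n) : immediate_subformula p (fmax p q)
| sub_maxr n (p q : preformula L n) : immediate_subformula q (fmax p q)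
| sub_minl n (p q : preformula L n) : immediate_subformula p (fmin p q)
| sub_minr n (p q : preformula L n) : immediate_subformula q (fmin p q)
| sub_sup n (p : preformula L n.+1) : immediate_subformula p (fsup p)
| sub_inf n (p : preformula L n.+1) : immediate_subformula p (finf p)
| sub_csup n (p : nat -> preformula L n) i : immediate_subformula (p i) (fcsup p)
| sub_cinf n (p : nat -> preformula L n) i : immediate_subformula (p i) (fcinf p).

Fixpoint teval (R : realType) (L : signature R) (M : structure L) n
    (a : 'I_n -> M) (t : term L n) : M :=
  match t with
  | tvar i => a i
  | tapp f ts => finterp M f (fun i => teval a (ts i))
  end.

Fixpoint feval (R : realType) (L : signature R) (M : structure L) n
    (phi : preformula L n) : ('I_n -> M) -> R :=
  match phi in preformula _ n return ('I_n -> M) -> R with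
  | fatom _ P ts => fun a => pinterp M P (fun i => teval a (ts i))
  | fone _ => fun a => 1
  | fadd _ p q => fun a => feval p a + feval q a
  | fscale _ r p => fun a => ratr r * feval p a
  | fmax _ p q => fun a => Num.max (feval p a) (feval q a)
  | fmin _ p q => fun a => Num.min (feval p a) (feval q a)
  | fsup _ p => fun a => sup [set feval p (scons x a) | x in [set: M]]
  | finf _ p => fun a => inf [set feval p (scons x a) | x in [set: M]]
  | fcsup _ p => fun a => sup [set feval (p i) a | i in [set: nat]]
  | fcinf _ p => fun a => inf [set feval (p i) a | i in [set: nat]]
  end.

(* The [p i] respect a common modulus and a common bound, as maps [M^n -> R],
   in every structure [M]. *)
Definition equicontinuous_bounded (R : realType) (L : signature R) n
    (p : nat -> preformula L n) : Prop :=
  exists (D : modulus R) (l h : R), forall (M : structure L) (i : nat),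
    (forall a b : 'I_n -> M,
       `|feval (p i) a - feval (p i) b| <= D (tdist a b)) /\
    (forall a : 'I_n -> M, l <= feval (p i) a <= h).

(* On preformulas that are not formulas, [sup] and [inf] in [feval] may take
   their default value. *)
Fixpoint is_formula (R : realType) (L : signature R) n (phi : preformula L n) :
    Prop :=
  match phi with
  | fatom _ _ _ | fone _ => True
  | fadd _ p q | fmax _ p q | fmin _ p q => is_formula p /\ is_formula q
  | fscale _ _ p => is_formula p
  | fsup _ p | finf _ p => is_formula p
  | fcsup _ p | fcinf _ p =>
      (forall i, is_formula (p i)) /\ equicontinuous_bounded p
  end.

Record fragment (R : realType) (L : signature R) := Fragment {
  frag_mem :> forall n, set (preformula L n) ;
  frag_formula : forall n (phi : preformula L n),
    frag_mem phi -> is_formula phi ;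
  frag_countable : forall n, countable (@frag_mem n) ;
  frag_atom : forall n (P : pred_sym L) (t : 'I_(parity P) -> term L n),
    frag_mem (fatom P t) ;
  frag_one : forall n, frag_mem (@fone R L n) ;
  frag_add : forall n (p q : preformula L n),
    frag_mem p -> frag_mem q -> frag_mem (fadd p q) ;
  frag_scale : forall n r (p : preformula L n),
    frag_mem p -> frag_mem (fscale r p) ;
  frag_max : forall n (p q : preformula L n),
    frag_mem p -> frag_mem q -> frag_mem (fmax p q) ;
  frag_min : forall n (p q : preformula L n),
    frag_mem p -> frag_mem q -> frag_mem (fmin p q) ;
  frag_sup : forall n (p : preformula L n.+1), frag_mem p -> frag_mem (fsup p) ;
  frag_inf : forall n (p : preformula L n.+1), frag_mem p -> frag_mem (finf p) ;
  frag_sub : forall m n (p : preformula L m) (q : preformula L n),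
    immediate_subformula p q -> frag_mem q -> frag_mem p ;
  frag_subst : forall n m (p : preformula L n) (s : 'I_n -> term L m),
    frag_mem p -> frag_mem (fsubst p s) }.

Arguments frag_mem {R L} f n phi : rename.

(* [(phi, c)] stands for the condition [phi = c]. *)
Definition theory (R : realType) (L : signature R) : Type :=
  set (preformula L 0 * R).

Definition fragment_theory (R : realType) (L : signature R) (F : fragment L)
    (T : theory L) : Prop :=
  forall c, T c -> F 0%N c.1.

Definition tnil (X : Type) : 'I_0 -> X :=
  fun i => False_rect X (notF (ltn_ord i)).

Definition models (R : realType) (L : signature R) (M : structure L)
    (T : theory L) : Prop :=
  forall c, T c -> feval c.1 (@tnil M) = c.2.

Definition Th (R : realType) (L : signature R) (F : fragment L)
    (M : structure L) : theory L :=
  [set c | F 0%N c.1 /\ c.2 = feval c.1 (@tnil M)].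

Lemma models_Th (R : realType) (L : signature R) (F : fragment L)
  (M : structure L) : models M (Th F M).
Proof. by move=> c []. Qed.

Arguments models_Th {R L} F M.

Definition formulas (R : realType) (L : signature R) (F : fragment L) n : Type :=
  {phi : preformula L n | F n phi}.

Definition tp (R : realType) (L : signature R) (F : fragment L)
    (M : structure L) n (a : 'I_n -> M) : {ptws formulas F n -> R} :=
  fun phi => feval (sval phi) a.

Arguments tp {R L} F {M n} a.

(* The sets [types F T n] and [Mod F T] are coerced to types, which carry the
   topology induced by that of pointwise convergence. *)
Definition types (R : realType) (L : signature R) (F : fragment L)
    (T : theory L) n : set {ptws formulas F n -> R} :=
  [set p | exists (M : structure L) (a : 'I_n -> M), models M T /\ p = tp F a].

Arguments types {R L} F T n.

Lemma types_tp (R : realType) (L : signature R) (F : fragment L)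
  (T : theory L) n (M : structure L) (MT : models M T) (a : 'I_n -> M) :
  types F T n (tp F a).
Proof. by exists M, a. Qed.

Definition type_of (R : realType) (L : signature R) (F : fragment L)
    (T : theory L) n (M : structure L) (MT : models M T) (a : 'I_n -> M) :
    types F T n :=
  SigSub (mem_set (types_tp F MT a)).

Arguments type_of {R L} F {T n M} MT a.

Definition type_dist (R : realType) (L : signature R) (F : fragment L)
    (T : theory L) n (p q : types F T n) : \bar R :=
  ereal_inf [set s%:E | s in [set s : R |
    forall U V : set (types F T n), open U -> open V -> U p -> V q ->
    exists (M : structure L) (MT : models M T) (a b : 'I_n -> M),
      [/\ U (type_of F MT a), V (type_of F MT b) & tdist a b < s]]].

Definition isolated_type (R : realType) (L : signature R) (F : fragment L)
    (T : theory L) n (p : types F T n) : Prop :=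
  forall delta : R, 0 < delta ->
    interior [set q : types F T n | (type_dist p q < delta%:E)%E] p.

Definition atomic (R : realType) (L : signature R) (F : fragment L)
    (M : structure L) : Prop :=
  forall n (a : 'I_n -> M), isolated_type (type_of F (models_Th F M) a).

(* The [F]-formulas in the variables x_0, x_1, x_2, etc.: the triple
   [(n, phi, u)] stands for phi(x_(u 0), ..., x_(u (n - 1))). *)
Definition seq_formulas (R : realType) (L : signature R) (F : fragment L) :
    Type :=
  {n : nat & (formulas F n * ('I_n -> nat))%type}.

Definition seq_formula (R : realType) (L : signature R) (F : fragment L) n
    (phi : formulas F n) (u : 'I_n -> nat) : seq_formulas F :=
  existT _ n (phi, u).

Definition seq_tp (R : realType) (L : signature R) (F : fragment L)
    (M : structure L) (a : nat -> M) : {ptws seq_formulas F -> R} :=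
  fun phi => feval (sval (projT2 phi).1) (a \o (projT2 phi).2).

Arguments seq_tp {R L} F {M} a.

Definition formulas_inf (R : realType) (L : signature R) (F : fragment L) n
    (phi : formulas F n.+1) : formulas F n :=
  exist _ (finf (sval phi)) (frag_inf (svalP phi)).

Definition Mod (R : realType) (L : signature R) (F : fragment L)
    (T : theory L) : set {ptws seq_formulas F -> R} :=
  [set xi |
    (exists (M : structure L) (a : nat -> M), models M T /\ xi = seq_tp F a) /\
    (forall n (phi : formulas F n.+1) (u : 'I_n -> nat),
       xi (seq_formula (formulas_inf phi) u) =
       inf [set xi (seq_formula phi (scons j u)) | j in [set: nat]])].

Arguments Mod {R L} F T.

Section Substructure.
Context (R : realType) (L : signature R) (M : structure L) (A : set M).
Hypotheses (A0 : A !=set0) (Aclosed : closed A).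
Hypothesis (Afun : forall (f : fun_sym L) (a : 'I_(farity f) -> M),
  (forall i, A (a i)) -> A (finterp M f a)).

Lemma substructure_neq0 : [set: set_type A] !=set0.
Proof. by case: A0 => x Ax; exists (SigSub (mem_set Ax)). Qed.

Lemma substructure_complete : complete_space (set_type A).
Proof.
move=> G GF Gc.
have vG : cauchy ((val : set_type A -> M) @ G).
  move=> E entE; rewrite nbhs_simpl.
  have [[P Q] /= [GP GQ] PQE] :
      filter_prod G G
        ((fun z : set_type A * set_type A => (val z.1, val z.2) : M * M) @^-1` E).
    by apply: Gc; exists E.
  exists (val @` P, val @` Q) => /=.
    split; rewrite nbhs_simpl /=.
      by apply: filterS GP => z Pz; exists z.
    by apply: filterS GQ => z Qz; exists z.
  by move=> [_ _] [[/= z Pz <-] [w Qw <-]]; apply: (PQE (z, w)).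
have [x Gx] := @carrier_complete _ _ M _ _ vG.
have Ax : A x.
  apply: Aclosed => B /Gx; rewrite nbhs_simpl /= => GB.
  have [z Bz] := @filter_ex _ _ GF _ GB.
  by exists (val z); split => //; exact: set_valP.
exists (SigSub (mem_set Ax)) => B [_ [[C oC <-] /= Cx CB]].
apply: (filterS CB); apply: Gx; exact: open_nbhs_nbhs.
Qed.

Definition substructure_fun (f : fun_sym L) (a : 'I_(farity f) -> set_type A) :
    set_type A :=
  SigSub (mem_set (Afun (fun i => set_valP (a i)))).

Definition substructure_pred (P : pred_sym L) (a : 'I_(parity P) -> set_type A) : R :=
  pinterp M P (fun i => val (a i)).

Lemma substructure_dist x y :
  @substructure_pred dist_sym (dist_pair x y) = mdist x y.
Proof.
rewrite -[RHS](pinterp_dist (val x) (val y)) /substructure_pred.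
by congr pinterp; apply/funext => i; rewrite /dist_pair; case: ifP.
Qed.

Definition substructure : structure L :=
  {| carrier := set_type A : metricType R ;
     carrier_neq0 := substructure_neq0 ;
     carrier_complete := substructure_complete ;
     finterp := substructure_fun ;
     finterp_mod := fun f a b =>
       finterp_mod (fun i => val (a i)) (fun i => val (b i)) ;
     pinterp := substructure_pred ;
     pinterp_mod := fun P a b =>
       pinterp_mod (fun i => val (a i)) (fun i => val (b i)) ;
     pinterp_bound := fun P a => pinterp_bound (fun i => val (a i)) ;
     pinterp_dist := substructure_dist |}.

End Substructure.

Section CodedModel.
Context (R : realType) (L : signature R) (F : fragment L) (T : theory L).
Variable xi : Mod F T.

Lemma Mod_realized :
  exists Ma : {M : structure L & nat -> M},
    models (projT1 Ma) T /\ val xi = seq_tp F (projT2 Ma).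
Proof. by have [[M [a aP]] _] := set_valP xi; exists (existT _ M a). Qed.

Definition realization : {M : structure L & nat -> M} := sval (cid Mod_realized).

Definition real_model : structure L := projT1 realization.

Definition real_seq : nat -> real_model := projT2 realization.

Lemma real_seqE : val xi = seq_tp F real_seq.
Proof. by have [] := svalP (cid Mod_realized). Qed.

Definition real_set : set real_model := closure (range real_seq).

Lemma real_set_neq0 : real_set !=set0.
Proof. by exists (real_seq 0); apply: subset_closure; exists 0%N. Qed.

Lemma real_set_closed : closed real_set.
Proof. exact: closed_closure. Qed.

Lemma real_seq_fun (f : fun_sym L) (u : 'I_(farity f) -> nat) (e : R) : 0 < e ->
  exists j, mdist (real_seq j) (finterp real_model f (real_seq \o u)) < e.
Proof.
move=> e0; have [_] := set_valP xi.
pose t : 'I_(parity (@dist_sym _ L)) -> term L (farity f).+1 :=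
  dist_pair (tvar ord0) (tapp (fun i => tvar (lift ord0 i))).
move=> /(_ _ (exist _ _ (frag_atom F t)) u); rewrite real_seqE /seq_tp /=.
have tE (x : real_model) (a : 'I_(farity f) -> real_model) :
    pinterp real_model dist_sym (fun i => teval (scons x a) (t i)) =
    mdist x (finterp real_model f a).
  rewrite -pinterp_dist; congr pinterp; apply/funext => i.
  rewrite /t /dist_pair; case: ifP => _ /=; first by rewrite scons0.
  by congr finterp; apply/funext => k; rewrite scons_lift.
set y := finterp _ _ _; set B := [set _ | j in [set: nat]].
have -> : B = [set mdist (real_seq j) y | j in [set: nat]].
  by apply: eq_imagel => j _; rewrite comp_scons tE.
set A := [set _ | x in [set: real_model]].
have A0 : lbound A 0 by move=> _ [x _ <-]; rewrite tE mdist_ge0.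
have -> : inf A = 0.
  apply/eqP; rewrite eq_le; apply/andP; split.
    by apply: ge_inf; [exists 0|exists y => //; rewrite tE mdistxx].
  by apply: lb_le_inf => //; exists (mdist y y), y => //; rewrite tE.
move=> infE.
have infe : inf [set mdist (real_seq j) y | j in [set: nat]] < e by rewrite -infE.
have [|_ [j _ <-] je] := inf_lt _ infe; last by exists j.
by exists (mdist (real_seq 0) y), 0%N.
Qed.

Lemma real_set_fun (f : fun_sym L) (a : 'I_(farity f) -> real_model) :
  (forall i, real_set (a i)) -> real_set (finterp real_model f a).
Proof.
move=> Aa; apply/closure_mdistP => e e0.
have e20 : 0 < e / 2 by rewrite divr_gt0.
have [d d0 Dd] := modulus_small (fmod f) e20.
have /choice[u ud] i : exists j, mdist (a i) (real_seq j) < d.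
  by have /closure_mdistP/(_ d d0)[_ [j _ <-]] := Aa i; exists j.
have [j jd] := real_seq_fun u e20.
exists (real_seq j); first by exists j.
apply: le_lt_trans (metric_triangle _ (finterp real_model f (real_seq \o u)) _) _.
rewrite [ltRHS]splitr; apply: ltrD; last by rewrite metric_sym.
apply: le_lt_trans (finterp_mod _ _) (Dd _ (tdist_ge0 _ _) _).
by apply: tdist_le (ltW d0) _ => i; exact: ltW.
Qed.

(* The structure M_xi, with the closure of the enumerated sequence as domain. *)
Definition model_of : structure L :=
  substructure real_set_neq0 real_set_closed real_set_fun.

End CodedModel.

Definition iso_class (R : realType) (L : signature R) (F : fragment L)
    (T : theory L) (xi : Mod F T) : set (Mod F T) :=
  [set eta | isomorphic (model_of eta) (model_of xi)].

(* Main.v *)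
(** Write [M] for the model coded by xi and C for the closure of its class. Call
    a tuple [a] of [M] locally isolated if, for every [d > 0], some formula [p]
    with [p(a) < 0] is such that each tuple [b] of [M] with [p(b) < 0] is within
    [d] of every [F]-open neighbourhood of [a] in [M]. Transferring sentences
    between models of Th_F(M) shows that this holds iff the type of [a] is
    isolated.

    (i) => (ii) is general topology. (ii) => (iii): C is a Baire space, since a
    generic limit of points of the class attains all infima and suprema, and is
    then the type of a dense sequence in a model, namely the completion of [nat]
    for the limit distance. (iii) => (iv): given a tuple [a] of [M], the class is
    covered by countably many relatively closed sets "x_u is [r]-close to [a]";
    one of them contains an open set [p(x_0, ..., x_(m-1)) < 0] of the class,
    and as every tuple of [M] begins an enumeration of [M], the projection of
    [p < 0] to the coordinates [u] witnesses that [a] is locally isolated.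
    (iv) => (i): if all tuples of [M] are locally isolated, a back-and-forth
    argument shows that a code eta is in the class iff its model has the same
    [F]-theory as [M] and, for every [d > 0], each finite tuple of the
    enumeration satisfies [p < 0] for some [p] whose realizations in [M] have
    types at distance at most [d]; this is a countable intersection of open
    conditions on eta. *)

Require Import Defs.
From HB Require Import structures.
From mathcomp Require Import all_boot all_order all_algebra.
From mathcomp Require Import all_classical all_reals all_analysis borel_hierarchy.
From mathcomp Require Import lra.

Set Implicit Arguments.
Unset Strict Implicit.
Unset Printing Implicit Defensive.

Import Order.TTheory GRing.Theory Num.Theory.
Import numFieldNormedType.Exports.

Local Open Scope classical_set_scope.
Local Open Scope ring_scope.

(** * Tuples, suprema and infima *)

(** Without compactness there is no guarantee that types at small distance are realised close
    together in some model, so every argument about [type_dist] speaks of neighbourhoods: a tuple is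
    compared with each open neighbourhood of [a], not with realisations of its type. Formulas see
    such statements only through strict inequalities: [inf < r] is exactly an existential statement,
    while the failure of [p < 0] is closed and not open. Each passage to a negation or to another
    model therefore gives up some slack, and rational numbers are inserted to pay for it, the syntax
    having only rational constants.

    Codes need not form a closed subset of the ambient product of real lines. The Baire argument is
    run in that product, with the witnessing conditions added to the dense open sets to be met, and
    the limit must then be turned into a structure. Its function symbols cannot be read off from
    indices, as the enumeration need not be closed under functions; a term is represented by its
    distances to the enumerated points. *)

Lemma ord0_funE (X : Type) (x y : 'I_0 -> X) : x = y.
Proof. by apply/funext => -[]. Qed.

Section TupleDistance.
Context (R : realType) (M : metricType R).
Implicit Types (e : R).

Lemma tdist_ltP n (a b : 'I_n -> M) e : 0 < e ->
  tdist a b < e <-> forall i, mdist (a i) (b i) < e.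
Proof.
move=> e0; split=> [abe i|H].
  by apply: le_lt_trans abe; rewrite /tdist (bigD1 i) //= le_max lexx.
by rewrite /tdist; elim/big_ind: _ => // x y; rewrite gt_max => -> ->.
Qed.

Lemma tdist_sym n (a b : 'I_n -> M) : tdist a b = tdist b a.
Proof. by apply: eq_bigr => i _; exact: metric_sym. Qed.

Lemma le_tdist n (a b : 'I_n -> M) i : mdist (a i) (b i) <= tdist a b.
Proof. by rewrite /tdist (bigD1 i) //= le_max lexx. Qed.

Lemma tdist_triangle n (b a c : 'I_n -> M) :
  tdist a c <= tdist a b + tdist b c.
Proof.
apply: tdist_le => [|i]; first by rewrite addr_ge0 // tdist_ge0.
apply: le_trans (metric_triangle _ (b i) _) _.
by apply: lerD; exact: le_tdist.
Qed.

Lemma tdistxx n (a : 'I_n -> M) : tdist a a = 0.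
Proof.
apply/eqP; rewrite eq_le tdist_ge0 andbT.
by apply: tdist_le => // i; rewrite mdistxx.
Qed.

Lemma tdist_scons n (x : M) (a b : 'I_n -> M) :
  tdist (scons x a) (scons x b) = tdist a b.
Proof.
apply/eqP; rewrite eq_le; apply/andP; split.
  apply: tdist_le => [|i]; first exact: tdist_ge0.
  by rewrite /scons; case: unlift => [j|]; rewrite ?le_tdist ?mdistxx ?tdist_ge0.
apply: tdist_le => [|i]; first exact: tdist_ge0.
by have := le_tdist (scons x a) (scons x b) (lift ord0 i); rewrite !scons_lift.
Qed.

Lemma modulus_le (D : modulus R) (r s : R) : 0 <= r -> r <= s -> D r <= D s.
Proof.
move=> r0 rs; rewrite -(subrK r s) addrC; apply: modulus_homo => //.
by rewrite subr_ge0.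
Qed.

End TupleDistance.

(** The minimum starts from 1, which covers an empty index type. *)
Lemma finite_radius (R : realType) (I : finType) (P : I -> R -> Prop) :
  (forall i d d', 0 < d' -> d' <= d -> P i d -> P i d') ->
  (forall i, exists2 d : R, 0 < d & P i d) -> exists2 d : R, 0 < d & forall i, P i d.
Proof.
move=> Pd H; have /choice[d dP] i : exists d, 0 < d /\ P i d.
  by have [d] := H i; exists d.
exists (\big[Num.min/1]_i d i).
  by elim/big_ind: _ => [|x y x0 y0|i _]; [|rewrite lt_min x0|case: (dP i)].
move=> i; have [di Pi] := dP i; apply: (Pd i (d i)) => //.
  by elim/big_ind: _ => [|x y x0 y0|j _]; [|rewrite lt_min x0|case: (dP j)].
by rewrite (bigD1 i) //= ge_min lexx.
Qed.

Section SupInf.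
Context (R : realType) (I : Type) (A : set I).
Hypothesis A0 : A !=set0.
Implicit Types f g : I -> R.

Lemma bounded_ubound f (B : R) : (forall i, A i -> `|f i| <= B) ->
  has_ubound [set f i | i in A].
Proof.
move=> fB; exists B => _ [i Ai <-]; exact: le_trans (ler_norm _) (fB _ Ai).
Qed.

Lemma bounded_lbound f (B : R) : (forall i, A i -> `|f i| <= B) ->
  has_lbound [set f i | i in A].
Proof.
move=> fB; exists (- B) => _ [i Ai <-].
by have := fB _ Ai; rewrite ler_norml => /andP[].
Qed.

Lemma sup_le_add f g (e : R) : has_ubound [set g i | i in A] ->
  (forall i, A i -> f i <= g i + e) ->
  sup [set f i | i in A] <= sup [set g i | i in A] + e.
Proof.
move=> gB fg; apply: ge_sup; first by case: A0 => i Ai; exists (f i), i.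
move=> _ [i Ai <-]; apply: le_trans (fg _ Ai) _; rewrite lerD2r.
by apply: ub_le_sup => //; exists i.
Qed.

Lemma inf_le_add f g (e : R) : has_lbound [set f i | i in A] ->
  (forall i, A i -> f i <= g i + e) ->
  inf [set f i | i in A] <= inf [set g i | i in A] + e.
Proof.
move=> fB fg; rewrite -lerBlDr; apply: lb_le_inf.
  by case: A0 => i Ai; exists (g i), i.
move=> _ [i Ai <-]; rewrite lerBlDr; apply: le_trans (fg _ Ai).
by apply: ge_inf => //; exists i.
Qed.

Lemma inf_image_lt f (r : R) : has_lbound [set f i | i in A] ->
  inf [set f i | i in A] < r <-> exists2 i, A i & f i < r.
Proof.
move=> fB; split=> [|[i Ai fr]].
  by move/inf_lt; case=> [|_ [i Ai <-]]; [case: A0 => i Ai; exists (f i), i|exists i].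
by apply: le_lt_trans fr; apply: ge_inf => //; exists i.
Qed.

Lemma dist_sup_le f g (e : R) : has_ubound [set f i | i in A] ->
  has_ubound [set g i | i in A] -> (forall i, A i -> `|f i - g i| <= e) ->
  `|sup [set f i | i in A] - sup [set g i | i in A]| <= e.
Proof.
move=> fB gB fg; rewrite ler_norml.
have H1 : sup [set f i | i in A] <= sup [set g i | i in A] + e.
  apply: sup_le_add => // i Ai; have := fg _ Ai.
  by rewrite ler_norml => /andP[]; lra.
have H2 : sup [set g i | i in A] <= sup [set f i | i in A] + e.
  apply: sup_le_add => // i Ai; have := fg _ Ai.
  by rewrite ler_norml => /andP[]; lra.
by apply/andP; split; lra.
Qed.

Lemma dist_inf_le f g (e : R) : has_lbound [set f i | i in A] ->
  has_lbound [set g i | i in A] -> (forall i, A i -> `|f i - g i| <= e) ->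
  `|inf [set f i | i in A] - inf [set g i | i in A]| <= e.
Proof.
move=> fB gB fg; rewrite ler_norml.
have H1 : inf [set f i | i in A] <= inf [set g i | i in A] + e.
  apply: inf_le_add => // i Ai; have := fg _ Ai.
  by rewrite ler_norml => /andP[]; lra.
have H2 : inf [set g i | i in A] <= inf [set f i | i in A] + e.
  apply: inf_le_add => // i Ai; have := fg _ Ai.
  by rewrite ler_norml => /andP[]; lra.
by apply/andP; split; lra.
Qed.

Lemma norm_sup_le f (B : R) : (forall i, A i -> `|f i| <= B) ->
  `|sup [set f i | i in A]| <= B.
Proof.
move=> fB; have [i Ai] := A0; rewrite ler_norml; apply/andP; split.
  have : f i <= sup [set f i | i in A].
    by apply: ub_le_sup; [exact: bounded_ubound fB|exists i].
  by have := fB _ Ai; rewrite ler_norml => /andP[]; lra.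
apply: ge_sup => [|_ [j Aj <-]]; first by exists (f i), i.
exact: le_trans (ler_norm _) (fB _ Aj).
Qed.

Lemma norm_inf_le f (B : R) : (forall i, A i -> `|f i| <= B) ->
  `|inf [set f i | i in A]| <= B.
Proof.
move=> fB; have [i Ai] := A0; rewrite ler_norml; apply/andP; split.
  apply: lb_le_inf => [|_ [j Aj <-]]; first by exists (f i), i.
  by have := fB _ Aj; rewrite ler_norml => /andP[].
have : inf [set f i | i in A] <= f i.
  by apply: ge_inf; [exact: bounded_lbound fB|exists i].
by have := fB _ Ai; rewrite ler_norml => /andP[]; lra.
Qed.

End SupInf.

(** * Evaluation of formulas *)

Section Evaluation.
Context (R : realType) (L : signature R).

Lemma teval_tsubst (M : structure L) n m (s : 'I_n -> term L m)
    (a : 'I_m -> M) (t : term L n) :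
  teval a (tsubst s t) = teval (fun i => teval a (s i)) t.
Proof.
by elim: t => //= f ts IH; congr finterp; apply/funext => i; rewrite IH.
Qed.

Lemma teval_slift (M : structure L) n m (s : 'I_n -> term L m)
    (a : 'I_m -> M) (x : M) :
  (fun i => teval (scons x a) (slift s i)) =
  scons x (fun i => teval a (s i)).
Proof.
apply/funext => i; rewrite /slift /scons; case: unliftP => [j|] _.
  rewrite teval_tsubst /=; congr teval; apply/funext => k; exact: scons_lift.
by rewrite /= unlift_none.
Qed.

Lemma feval_fsubst (M : structure L) n (phi : preformula L n) m
    (s : 'I_n -> term L m) (a : 'I_m -> M) :
  feval (fsubst phi s) a = feval phi (fun i => teval a (s i)).
Proof.
elim: phi m s a => {n} [n P ts|n|n p IHp q IHq|n r p IH|n p IHp q IHq|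
  n p IHp q IHq|n p IH|n p IH|n p IH|n p IH] m s a //=.
- by congr pinterp; apply/funext => i; rewrite teval_tsubst.
- by rewrite IHp IHq.
- by rewrite IH.
- by rewrite IHp IHq.
- by rewrite IHp IHq.
- by congr sup; apply: eq_imagel => x _; rewrite IH teval_slift.
- by congr inf; apply: eq_imagel => x _; rewrite IH teval_slift.
- by congr sup; apply: eq_imagel => i _; rewrite IH.
- by congr inf; apply: eq_imagel => i _; rewrite IH.
Qed.

(** As [h] is onto, the sets under [sup] and [inf] are equal in both structures, so the equality
    holds for every preformula, default values included. *)
Lemma isomorphic_feval (M N : structure L) : isomorphic M N ->
  exists h : M -> N, bijective h /\
    forall n (phi : preformula L n) (a : 'I_n -> M),
      feval phi (h \o a) = feval phi a.
Proof.
move=> [h [hb hf hP]]; exists h; split => // n phi.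
have ht k (t : term L k) (a : 'I_k -> M) : teval (h \o a) t = h (teval a t).
  elim: t => //= f ts IH; rewrite hf; congr finterp; apply/funext => i.
  by rewrite IH.
have hs (f : N -> R) (g : M -> R) : (forall x, f (h x) = g x) ->
    [set f x | x in [set: N]] = [set g x | x in [set: M]].
  move=> fg; apply/seteqP; split => _ [x _ <-].
    by case: hb => h' _ hK; exists (h' x) => //; rewrite -fg hK.
  by exists (h x).
elim: phi => {n} [n P ts|n|n p IHp q IHq|n r p IH|n p IHp q IHq|
  n p IHp q IHq|n p IH|n p IH|n p IH|n p IH] a //=.
- by rewrite -hP; congr pinterp; apply/funext => i; rewrite ht.
- by rewrite IHp IHq.
- by rewrite IH.
- by rewrite IHp IHq.
- by rewrite IHp IHq.
- by congr sup; apply: hs => x; rewrite -IH comp_scons.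
- by congr inf; apply: hs => x; rewrite -IH comp_scons.
- by congr sup; apply: eq_imagel => i _; rewrite IH.
- by congr inf; apply: eq_imagel => i _; rewrite IH.
Qed.

Lemma isomorphic_sym (M N : structure L) : isomorphic M N -> isomorphic N M.
Proof.
move=> [h [[h' hK h'K] hf hP]]; exists h'; split.
- by exists h.
- move=> f a; rewrite -[RHS]hK hf; congr (h' (finterp N f _)).
  by apply/funext => i /=; rewrite h'K.
- move=> P a; rewrite -hP; congr pinterp.
  by apply/funext => i /=; rewrite h'K.
Qed.

Variable M : structure L.

Lemma teval_continuous n (t : term L n) (e : R) : 0 < e ->
  exists2 d : R, 0 < d & forall a b : 'I_n -> M, tdist a b < d ->
    mdist (teval a t) (teval b t) < e.
Proof.
elim: t e => [i|f ts IH] e e0 /=.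
  by exists e => // a b; apply: le_lt_trans; exact: le_tdist.
have [d d0 Dd] := modulus_small (fmod f) e0.
have [i c c' c'0 c'c H a b ab|i|c c0 H] := @finite_radius _ _
    (fun i c => forall a b : 'I_n -> M, tdist a b < c ->
      mdist (teval a (ts i)) (teval b (ts i)) < d).
- by apply: H; exact: lt_le_trans c'c.
- exact: IH.
exists c => // a b ab; apply: le_lt_trans (finterp_mod _ _) (Dd _ _ _).
  exact: tdist_ge0.
by apply: ltW; apply/tdist_ltP => // i; exact: H.
Qed.

Lemma equicontinuous_bounded_norm n (p : nat -> preformula L n) :
  equicontinuous_bounded p ->
  exists B : R, forall (a : 'I_n -> M) i, [set: nat] i -> `|feval (p i) a| <= B.
Proof.
move=> [D [l [h H]]]; exists (`|l| + `|h|) => a i _.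
have [_ /(_ a)/andP[? ?]] := H M i.
have := ler_norm h; have := ler_norm (- l).
have := normr_ge0 h; have := normr_ge0 l.
by rewrite normrN ler_norml => *; apply/andP; split; lra.
Qed.

(** Boundedness and uniform continuity are carried together: only a bounded body gives [sup] and
    [inf] their meaning, and the radius must be uniform in the quantified variable. For countable
    families both come from [equicontinuous_bounded]. *)
Lemma feval_continuous_bounded n (phi : preformula L n) : is_formula phi ->
  (forall e : R, 0 < e -> exists2 d : R, 0 < d & forall a b : 'I_n -> M,
    tdist a b < d -> `|feval phi a - feval phi b| < e) /\
  exists B : R, forall a : 'I_n -> M, `|feval phi a| <= B.
Proof.
elim: phi => {n} [n P ts|n|n p IHp q IHq|n r p IH|n p IHp q IHq|
  n p IHp q IHq|n p IH|n p IH|n p IH|n p IH] /=.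
- move=> _; split=> [e e0|].
    have [d d0 Dd] := modulus_small (pmod P) e0.
    have [i c c' c'0 c'c H a b ab|i|c c0 H] := @finite_radius _ _
        (fun i c => forall a b : 'I_n -> M, tdist a b < c ->
          mdist (teval a (ts i)) (teval b (ts i)) < d).
    + by apply: H; exact: lt_le_trans c'c.
    + exact: teval_continuous.
    exists c => // a b ab; apply: le_lt_trans (pinterp_mod _ _) (Dd _ _ _).
      exact: tdist_ge0.
    by apply: ltW; apply/tdist_ltP => // i; exact: H.
  exists (`|plow P| + `|phigh P|) => a.
  have /andP[Pl Ph] := pinterp_bound (s := M) (fun i => teval a (ts i)).
  have := ler_norm (phigh P); have := ler_norm (- plow P).
  have := normr_ge0 (phigh P); have := normr_ge0 (plow P).
  by rewrite normrN ler_norml => *; apply/andP; split; lra.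
- move=> _; split=> [e e0|]; first by exists 1 => // a b _; rewrite subrr normr0.
  by exists 1 => a; rewrite normr1.
- move=> [/IHp[cp [Bp hp]] /IHq[cq [Bq hq]]]; split=> [e e0|].
    have e20 : 0 < e / 2 by lra.
    have [d d0 dp] := cp _ e20; have [d' d'0 dq] := cq _ e20.
    exists (Num.min d d') => [|a b]; first by rewrite lt_min d0.
    rewrite lt_min => /andP[/dp P1 /dq P2].
    by rewrite opprD addrACA (le_lt_trans (ler_normD _ _)) // [ltRHS]splitr ltrD.
  by exists (Bp + Bq) => a; rewrite (le_trans (ler_normD _ _)) // lerD.
- move: (ratr r : R) => q /IH[c [B h]]; split=> [e e0|].
    have r0 : 0 < `|q| + 1 by rewrite ltr_pwDr.
    have [d d0 dp] := c _ (divr_gt0 e0 r0).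
    exists d => // a b /dp; rewrite ltr_pdivlMr // -mulrBr normrM => H.
    apply: le_lt_trans H; rewrite [leRHS]mulrC.
     by apply: ler_wpM2r; rewrite ?lerDl.
  by exists (`|q| * B) => a; rewrite normrM; apply: ler_wpM2l.
- move=> [/IHp[cp [Bp hp]] /IHq[cq [Bq hq]]]; split=> [e e0|].
    have [d d0 dp] := cp _ e0; have [d' d'0 dq] := cq _ e0.
    exists (Num.min d d') => [|a b]; first by rewrite lt_min d0.
    rewrite lt_min => /andP[/dp + /dq].
    rewrite !ltr_norml => /andP[? ?] /andP[? ?].
    by case: (leP (feval p a)) => ?; case: (leP (feval p b)) => ?;
      apply/andP; split; lra.
  exists (Bp + Bq) => a; have := hp a; have := hq a.
  have := normr_ge0 (feval p a); have := normr_ge0 (feval q a).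
  by case: (leP (feval p a)) => ? *; lra.
- move=> [/IHp[cp [Bp hp]] /IHq[cq [Bq hq]]]; split=> [e e0|].
    have [d d0 dp] := cp _ e0; have [d' d'0 dq] := cq _ e0.
    exists (Num.min d d') => [|a b]; first by rewrite lt_min d0.
    rewrite lt_min => /andP[/dp + /dq].
    rewrite !ltr_norml => /andP[? ?] /andP[? ?].
    by case: (leP (feval p a)) => ?; case: (leP (feval p b)) => ?;
      apply/andP; split; lra.
  exists (Bp + Bq) => a; have := hp a; have := hq a.
  have := normr_ge0 (feval p a); have := normr_ge0 (feval q a).
  by case: (leP (feval p a)) => ? *; lra.
- move=> /IH[c [B h]]; split=> [e e0|].
    have e20 : 0 < e / 2 by lra.
    have [d d0 dp] := c _ e20; exists d => // a b ab.
    apply: (@le_lt_trans _ _ (e / 2)); last by lra.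
    apply: dist_sup_le => [|||x _]; first exact: (carrier_neq0 M).
    + by apply: (@bounded_ubound _ _ _ _ B).
    + by apply: (@bounded_ubound _ _ _ _ B).
    + by apply/ltW/dp; rewrite tdist_scons.
  by exists B => a; apply: norm_sup_le => //; exact: carrier_neq0.
- move=> /IH[c [B h]]; split=> [e e0|].
    have e20 : 0 < e / 2 by lra.
    have [d d0 dp] := c _ e20; exists d => // a b ab.
    apply: (@le_lt_trans _ _ (e / 2)); last by lra.
    apply: dist_inf_le => [|||x _]; first exact: (carrier_neq0 M).
    + by apply: (@bounded_lbound _ _ _ _ B).
    + by apply: (@bounded_lbound _ _ _ _ B).
    + by apply/ltW/dp; rewrite tdist_scons.
  by exists B => a; apply: norm_inf_le => //; exact: carrier_neq0.
- move=> [_ /[dup] /equicontinuous_bounded_norm[B pb] [D [l [h pD]]]].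
  split=> [e e0|].
    have e20 : 0 < e / 2 by lra.
    have [d d0 dp] := modulus_small D e20; exists d => // a b ab.
    apply: (@le_lt_trans _ _ (e / 2)); last by lra.
    apply: dist_sup_le => [|||i _]; first by exists 0%N.
    + exact: bounded_ubound (pb a).
    + exact: bounded_ubound (pb b).
    + have [/(_ a b) + _] := pD M i; move/le_trans; apply; apply/ltW/dp.
        exact: tdist_ge0.
      exact: ltW.
  by exists B => a; apply: norm_sup_le (pb a); exists 0%N.
- move=> [_ /[dup] /equicontinuous_bounded_norm[B pb] [D [l [h pD]]]].
  split=> [e e0|].
    have e20 : 0 < e / 2 by lra.
    have [d d0 dp] := modulus_small D e20; exists d => // a b ab.
    apply: (@le_lt_trans _ _ (e / 2)); last by lra.
    apply: dist_inf_le => [|||i _]; first by exists 0%N.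
    + exact: bounded_lbound (pb a).
    + exact: bounded_lbound (pb b).
    + have [/(_ a b) + _] := pD M i; move/le_trans; apply; apply/ltW/dp.
        exact: tdist_ge0.
      exact: ltW.
  by exists B => a; apply: norm_inf_le (pb a); exists 0%N.
Qed.

Lemma feval_continuous n (phi : preformula L n) : is_formula phi ->
  forall e : R, 0 < e -> exists2 d : R, 0 < d & forall a b : 'I_n -> M,
    tdist a b < d -> `|feval phi a - feval phi b| < e.
Proof. by move/feval_continuous_bounded => -[]. Qed.

Lemma feval_bounded n (phi : preformula L n) : is_formula phi ->
  exists B : R, forall a : 'I_n -> M, `|feval phi a| <= B.
Proof. by move/feval_continuous_bounded => -[]. Qed.

Lemma feval_finf_lt n (phi : preformula L n.+1) (a : 'I_n -> M) (r : R) :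
  is_formula phi ->
  feval (finf phi) a < r <-> exists x, feval phi (scons x a) < r.
Proof.
move=> /feval_bounded[B hB]; split.
  move/(inf_image_lt (carrier_neq0 M) _ (bounded_lbound (fun x _ => hB _))).
  by move=> [x _ xr]; exists x.
move=> [x xr].
by apply/(inf_image_lt (carrier_neq0 M) _ (bounded_lbound (fun x _ => hB _))); exists x.
Qed.

End Evaluation.

(** * Dense sequences determine the structure *)

Lemma complete_space_seq (R : realType) (X : metricType R) (s : nat -> X) :
  complete_space X ->
  (forall e : R, 0 < e -> exists K, forall k, (K <= k)%N -> mdist (s K) (s k) < e) ->
  exists l, forall e : R, 0 < e -> exists K, forall k, (K <= k)%N -> mdist (s k) l < e.
Proof.
move=> Xc sc; have [|l sl] := Xc (s @ \oo) _.
  apply/cauchyP => e /= e0; have [K Kc] := sc e e0; exists (s K).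
  by exists K => // k /= /Kc; rewrite ballEmdist.
exists l => e e0; have [|K _ KP] := sl (ball l e); first exact: nbhsx_ballx.
by exists K => k /KP /=; rewrite ballEmdist /= metric_sym.
Qed.

Definition dense_seq (R : realType) (X : metricType R) (s : nat -> X) : Prop :=
  forall (x : X) (e : R), 0 < e -> exists j, mdist x (s j) < e.

Lemma dense_seq_tuple (R : realType) (X : metricType R) (s : nat -> X) n
    (a : 'I_n -> X) (e : R) : dense_seq s -> 0 < e ->
  exists u : 'I_n -> nat, tdist a (s \o u) < e.
Proof.
move=> sd e0; have /choice[u uP] i := sd (a i) e e0.
by exists u; apply/tdist_ltP.
Qed.

Lemma natSinv_lt (R : realType) (e : R) : 0 < e ->
  exists K, forall k, (K <= k)%N -> k.+1%:R^-1 < e.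
Proof.
by move=> e0; have [K _ KP] := @near_infty_natSinv_lt R (PosNum e0); exists K.
Qed.

Section DenseSequences.
Context (R : realType) (L : signature R) (F : fragment L).

(** The graph of the continuous extension of [a j |-> b j]: both points are approximated at the same
    indices. The relation is symmetric, so the inverse map needs no separate treatment. *)
Definition matching (M N : structure L) (a : nat -> M) (b : nat -> N)
    (x : M) (y : N) : Prop :=
  forall e : R, 0 < e -> exists j, mdist x (a j) < e /\ mdist y (b j) < e.

Section Matching.
Variables (M N : structure L) (a : nat -> M) (b : nat -> N).
Hypotheses (ad : dense_seq a) (bd : dense_seq b).
Hypothesis ab : seq_tp F a = seq_tp F b.

Lemma seq_tp_feval n (phi : preformula L n) (u : 'I_n -> nat) : F n phi ->
  feval phi (a \o u) = feval phi (b \o u).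
Proof.
move=> Fphi; exact: (congr1 (fun x => x (seq_formula (exist _ phi Fphi) u)) ab).
Qed.

Lemma seq_tp_mdist i j : mdist (a i) (a j) = mdist (b i) (b j).
Proof.
have := seq_tp_feval (scons i (fun=> j))
  (frag_atom F (dist_pair (tvar (ord0 : 'I_2)) (tvar (lift ord0 ord0)))).
rewrite -!pinterp_dist /= => H; transitivity (pinterp M dist_sym (fun i0 =>
  teval (a \o scons i (fun=> j)) (dist_pair (tvar (ord0 : 'I_2)) (tvar (lift ord0 ord0)) i0))).
  congr pinterp; apply/funext => k; rewrite /dist_pair; case: ifP => _ /=.
    by rewrite scons0.
  by rewrite (scons_lift i).
rewrite H; congr pinterp; apply/funext => k; rewrite /dist_pair; case: ifP => _ /=.
  by rewrite scons0.
by rewrite (scons_lift i).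
Qed.

(** The value of [f] at enumerated points need not be enumerated; it is located by its distances to
    the enumerated points, which atomic formulas express. *)
Lemma seq_tp_mdist_fun (f : fun_sym L) (u : 'I_(farity f) -> nat) j :
  mdist (a j) (finterp M f (a \o u)) = mdist (b j) (finterp N f (b \o u)).
Proof.
pose t : 'I_(parity (@dist_sym _ L)) -> term L (farity f).+1 :=
  dist_pair (tvar ord0) (tapp (fun i => tvar (lift ord0 i))).
have tE (K : structure L) (x : K) (c : 'I_(farity f) -> K) :
    feval (fatom dist_sym t) (scons x c) = mdist x (finterp K f c).
  rewrite -pinterp_dist /=; congr pinterp; apply/funext => i.
  rewrite /t /dist_pair; case: ifP => _ /=; first by rewrite scons0.
  by congr finterp; apply/funext => k; rewrite scons_lift.
by rewrite -!tE -!comp_scons; apply: seq_tp_feval; exact: frag_atom.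
Qed.

(** The images [b (j k)] of a sequence approaching [x] form a Cauchy sequence, since [a] and [b]
    have the same mutual distances. *)
Lemma matching_ex (x : M) : exists y, matching a b x y.
Proof.
have /choice[j jP] k : exists j, mdist x (a j) < k.+1%:R^-1.
  by apply: ad; rewrite invr_gt0.
have [e e0|y yP] := complete_space_seq (s := b \o j) (@carrier_complete _ _ N).
  have [K KP] := natSinv_lt (divr_gt0 e0 (ltr0n R 2)).
  exists K => k Kk; rewrite /= -seq_tp_mdist.
  apply: le_lt_trans (metric_triangle _ x _) _.
  rewrite [ltRHS]splitr; apply: ltrD; last exact: lt_trans (jP _) (KP _ Kk).
  by rewrite metric_sym; exact: lt_trans (jP _) (KP _ (leqnn _)).
exists y => e e0; have [K KP] := natSinv_lt e0; have [K' K'P] := yP _ e0.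
exists (j (maxn K K')); split.
  exact: lt_trans (jP _) (KP _ (leq_maxl _ _)).
by rewrite metric_sym; exact: K'P _ (leq_maxr _ _).
Qed.

Lemma matching_tuple n (x : 'I_n -> M) (y : 'I_n -> N) (e : R) : 0 < e ->
  (forall i, matching a b (x i) (y i)) ->
  exists u : 'I_n -> nat, tdist x (a \o u) < e /\ tdist y (b \o u) < e.
Proof.
move=> e0 xy; have /choice[u uP] i := xy i e e0.
by exists u; split; apply/tdist_ltP => // i; case: (uP i).
Qed.

Lemma matching_inj (x : M) (y y' : N) :
  matching a b x y -> matching a b x y' -> y = y'.
Proof.
move=> xy xy'; apply: mdist_positivity; apply/eqP; rewrite eq_le mdist_ge0 andbT.
apply/ler_addgt0Pl => e e0; rewrite addr0; apply: ltW.
have e40 : 0 < e / 4 by lra.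
have [j [xj yj]] := xy _ e40; have [k [xk yk]] := xy' _ e40.
have := metric_triangle y (b j) y'; have := metric_triangle (b j) (b k) y'.
have := metric_triangle (a j) x (a k); rewrite -seq_tp_mdist.
by rewrite (metric_sym (a j) x) (metric_sym (b k) y'); lra.
Qed.

(** An index [j] with [a j] close to the value of [f] at [a \o u] has [b j] equally close to the
    value at [b \o u]; the modulus of [f] absorbs the passage from [x], [y] to these tuples. *)
Lemma matching_fun (f : fun_sym L) x y : (forall i, matching a b (x i) (y i)) ->
  matching a b (finterp M f x) (finterp N f y).
Proof.
move=> xy e e0; have e20 : 0 < e / 2 by lra.
have [d d0 Dd] := modulus_small (fmod f) e20.
have [u [xu yu]] := matching_tuple d0 xy.
have [j jP] := ad (finterp M f (a \o u)) e20.
exists j; split.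
  apply: le_lt_trans (metric_triangle _ (finterp M f (a \o u)) _) _.
  rewrite [ltRHS]splitr; apply: ltrD jP.
  by apply: le_lt_trans (finterp_mod _ _) (Dd _ (tdist_ge0 _ _) (ltW _)).
apply: le_lt_trans (metric_triangle _ (finterp N f (b \o u)) _) _.
rewrite [ltRHS]splitr; apply: ltrD; last first.
  by rewrite metric_sym -seq_tp_mdist_fun metric_sym.
by apply: le_lt_trans (finterp_mod _ _) (Dd _ (tdist_ge0 _ _) (ltW _)).
Qed.

Lemma matching_pred (P : pred_sym L) x y : (forall i, matching a b (x i) (y i)) ->
  pinterp N P y = pinterp M P x.
Proof.
move=> xy; apply/eqP; rewrite -subr_eq0 -normr_le0.
apply/ler_addgt0Pl => e e0; rewrite addr0; apply: ltW.
have e20 : 0 < e / 2 by lra.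
have [d d0 Dd] := modulus_small (pmod P) e20.
have [u [xu yu]] := matching_tuple d0 xy.
have E : pinterp M P (a \o u) = pinterp N P (b \o u).
  have := @seq_tp_feval _ (fatom P tvar) u (frag_atom F _); exact.
rewrite -[X in X - _](subrK (pinterp N P (b \o u))) -addrA -{2}E.
apply: le_lt_trans (ler_normD _ _) _; rewrite [ltRHS]splitr; apply: ltrD.
  by apply: le_lt_trans (pinterp_mod _ _) (Dd _ (tdist_ge0 _ _) (ltW _)).
rewrite distrC.
by apply: le_lt_trans (pinterp_mod _ _) (Dd _ (tdist_ge0 _ _) (ltW _)).
Qed.

End Matching.

Lemma matching_sym (M N : structure L) (a : nat -> M) (b : nat -> N) x y :
  matching a b x y -> matching b a y x.
Proof. by move=> xy e /xy[j [? ?]]; exists j. Qed.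

(** [matching] is functional in both directions, so the chosen maps [h] and [g] are mutually
    inverse. *)
Lemma isomorphic_seq_tp (M N : structure L) (a : nat -> M) (b : nat -> N) :
  dense_seq a -> dense_seq b -> seq_tp F a = seq_tp F b -> isomorphic M N.
Proof.
move=> ad bd ab.
have /choice[h hP] := matching_ex ad ab.
have /choice[g gP] := matching_ex bd (esym ab).
exists h; split.
- exists g => x.
    by apply: (matching_inj (esym ab)) (gP _) _; exact/matching_sym/hP.
  by apply: (matching_inj ab) (hP _) _; exact/matching_sym/gP.
- move=> f c; apply: (matching_inj ab) (hP _) _.
  by apply: (matching_fun ad ab) => i; exact: hP.
- by move=> P c; apply: (matching_pred ab) => i; exact: hP.
Qed.

End DenseSequences.

(** * Types of dense sequences *)

Section InfDense.
Context (R : realType) (L : signature R) (N : structure L) (b : nat -> N).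
Hypothesis bd : dense_seq b.
Variables (n : nat) (p : preformula L n.+1) (a : 'I_n -> N).
Hypothesis pf : is_formula p.

Lemma feval_dense_approx (x : N) (e : R) : 0 < e ->
  exists j, `|feval p (scons x a) - feval p (scons (b j) a)| < e.
Proof.
move=> e0; have [d d0 H] := feval_continuous N pf e0.
have [j jP] := bd x d0; exists j; apply: H; apply/tdist_ltP => // i.
by rewrite /scons; case: unlift => [k|//]; rewrite mdistxx.
Qed.

Lemma inf_dense : feval (finf p) a =
  inf [set feval p (scons (b j) a) | j in [set: nat]].
Proof.
have [B hB] := feval_bounded N pf; rewrite /=; apply/eqP; rewrite eq_le; apply/andP; split.
  apply: lb_le_inf => [|_ [j _ <-]]; first by exists (feval p (scons (b 0) a)), 0%N.
  by apply: ge_inf; [exact: (bounded_lbound (fun x _ => hB (scons x a)))|exists (b j)].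
apply: lb_le_inf => [|_ [x _ <-]].
  by exists (feval p (scons (b 0) a)), (b 0).
apply/ler_addgt0Pl => e e0; have [j] := feval_dense_approx x e0.
rewrite ltr_norml => /andP[jP _]; apply: (@le_trans _ _ (feval p (scons (b j) a))).
  by apply: ge_inf; [exact: (bounded_lbound (fun i _ => hB (scons (b i) a)))|exists j].
by lra.
Qed.

Lemma sup_dense : feval (fsup p) a =
  sup [set feval p (scons (b j) a) | j in [set: nat]].
Proof.
have [B hB] := feval_bounded N pf; rewrite /=; apply/eqP; rewrite eq_le; apply/andP; split.
  apply: ge_sup => [|_ [x _ <-]]; first by exists (feval p (scons (b 0) a)), (b 0).
  apply/ler_addgt0Pl => e e0; have [j] := feval_dense_approx x e0.
  rewrite ltr_norml => /andP[_ jP].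
  apply: (@le_trans _ _ (e + feval p (scons (b j) a))); first by lra.
  rewrite lerD2l; apply: ub_le_sup; last by exists j.
  exact: (bounded_ubound (fun i _ => hB (scons (b i) a))).
apply: ge_sup => [|_ [j _ <-]]; first by exists (feval p (scons (b 0) a)), 0%N.
by apply: ub_le_sup; [exact: (bounded_ubound (fun x _ => hB (scons x a)))|exists (b j)].
Qed.

End InfDense.

Section Truth.
Context (R : realType) (L : signature R) (F : fragment L).

Definition value (x : seq_formulas F -> R) n (phi : preformula L n)
    (h : F n phi) (u : 'I_n -> nat) : R :=
  x (seq_formula (exist _ phi h) u).

Arguments value x [n] phi h u.

Lemma value_irrelevance x n (phi : preformula L n) (h h' : F n phi) u :
  value x phi h u = value x phi h' u.
Proof. by rewrite /value (Prop_irrelevance h h'). Qed.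

(* The condition on [sup] is expressed through [inf]: it is then a closed
   condition on [x]. *)
Record coherent (x : seq_formulas F -> R) : Prop := {
  coherent_one : forall n h u, value x (fone : preformula L n) h u = 1 ;
  coherent_add : forall n (p q : preformula L n) hp hq h u,
    value x (fadd p q) h u = value x p hp u + value x q hq u ;
  coherent_scale : forall n r (p : preformula L n) hp h u,
    value x (fscale r p) h u = ratr r * value x p hp u ;
  coherent_max : forall n (p q : preformula L n) hp hq h u,
    value x (fmax p q) h u = Num.max (value x p hp u) (value x q hq u) ;
  coherent_min : forall n (p q : preformula L n) hp hq h u,
    value x (fmin p q) h u = Num.min (value x p hp u) (value x q hq u) ;
  coherent_sup : forall n (p : preformula L n.+1) h' h u,
    value x (fsup p) h u = - value x (finf (fscale (-1) p)) h' u }.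

(** These are the clauses of a truth assignment that a pointwise limit may lose, as they involve
    infinitely many coordinates; [coherent] collects those that survive. *)
Record witnessed (x : seq_formulas F -> R) : Prop := {
  witnessed_inf : forall n (p : preformula L n.+1) hp h u,
    value x (finf p) h u =
    inf [set value x p hp (scons j u) | j in [set: nat]] ;
  witnessed_csup : forall n (p : nat -> preformula L n) hp h u,
    value x (fcsup p) h u = sup [set value x (p i) (hp i) u | i in [set: nat]] ;
  witnessed_cinf : forall n (p : nat -> preformula L n) hp h u,
    value x (fcinf p) h u = inf [set value x (p i) (hp i) u | i in [set: nat]] }.

Lemma frag_opp n (p : preformula L n) : F n p -> F n (fscale (-1) p).
Proof. exact: frag_scale. Qed.

Lemma inf_imageN (I : Type) (A : set I) (f : I -> R) :
  inf [set - f i | i in A] = - sup [set f i | i in A].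
Proof.
rewrite /inf; congr (- sup _); apply/seteqP; split => [_ [_ [i Ai <-] <-]|_ [i Ai <-]].
  by rewrite opprK; exists i.
by exists (- f i); [exists i|rewrite opprK].
Qed.

(** A truth lemma by induction on [phi]: the quantifiers of [N] may be restricted to the dense
    sequence [b], which turns them into the infima over indices that [witnessed] describes. The
    quantifier [fsup] passes through the opposite formula. *)
Lemma feval_value (x : seq_formulas F -> R) (N : structure L) (b : nat -> N) :
  coherent x -> witnessed x -> dense_seq b ->
  (forall n (P : pred_sym L) (t : 'I_(parity P) -> term L n) h u,
    feval (fatom P t) (b \o u) = value x (fatom P t) h u) ->
  forall n (phi : preformula L n) h u, feval phi (b \o u) = value x phi h u.
Proof.
move=> xc xw bd xa n phi.
elim: phi => {n} [n P ts|n|n p IHp q IHq|n r p IH|n p IHp q IHq|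
  n p IHp q IHq|n p IH|n p IH|n p IH|n p IH] h u.
- exact: xa.
- by rewrite (coherent_one xc).
- have hp := frag_sub (sub_addl p q) h; have hq := frag_sub (sub_addr p q) h.
  by rewrite (coherent_add xc hp hq) -IHp -IHq.
- have hp := frag_sub (sub_scale r p) h.
  by rewrite (coherent_scale xc hp) -IH.
- have hp := frag_sub (sub_maxl p q) h; have hq := frag_sub (sub_maxr p q) h.
  by rewrite (coherent_max xc hp hq) -IHp -IHq.
- have hp := frag_sub (sub_minl p q) h; have hq := frag_sub (sub_minr p q) h.
  by rewrite (coherent_min xc hp hq) -IHp -IHq.
- have hp := frag_sub (sub_sup p) h; have hN := frag_opp hp.
  rewrite (coherent_sup xc (frag_inf hN)) (witnessed_inf xw hN).
  rewrite (sup_dense bd _ (frag_formula hp)) -[LHS]opprK -inf_imageN.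
  congr (- inf _); apply: eq_imagel => j _.
  by rewrite -comp_scons IH (coherent_scale xc hp) rmorphN1 mulN1r.
- have hp := frag_sub (sub_inf p) h.
  rewrite (witnessed_inf xw hp) (inf_dense bd _ (frag_formula hp)).
  by congr inf; apply: eq_imagel => j _; rewrite -comp_scons IH.
- have hp i := frag_sub (sub_csup p i) h.
  rewrite (witnessed_csup xw hp) /=.
  by congr sup; apply: eq_imagel => i _; rewrite IH.
- have hp i := frag_sub (sub_cinf p i) h.
  rewrite (witnessed_cinf xw hp) /=.
  by congr inf; apply: eq_imagel => i _; rewrite IH.
Qed.

Lemma coherent_seq_tp (M : structure L) (a : nat -> M) : coherent (seq_tp F a).
Proof.
split=> //= n p h' h u.
rewrite /value /seq_tp /= -[LHS]opprK -inf_imageN; congr (- inf _).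
by apply: eq_imagel => x _; rewrite rmorphN1 mulN1r.
Qed.

Lemma seq_tp_witnessed (M : structure L) (a : nat -> M) :
  (forall n (phi : formulas F n.+1) (u : 'I_n -> nat),
    seq_tp F a (seq_formula (formulas_inf phi) u) =
    inf [set seq_tp F a (seq_formula phi (scons j u)) | j in [set: nat]]) ->
  witnessed (seq_tp F a).
Proof.
move=> ainf; split=> // n p hp h u.
rewrite -(ainf n (exist _ p hp) u); exact: value_irrelevance.
Qed.

Lemma dense_seq_tp_inf (M : structure L) (a : nat -> M) : dense_seq a ->
  forall n (phi : formulas F n.+1) (u : 'I_n -> nat),
    seq_tp F a (seq_formula (formulas_inf phi) u) =
    inf [set seq_tp F a (seq_formula phi (scons j u)) | j in [set: nat]].
Proof.
move=> ad n [phi h] u; apply: etrans (inf_dense ad (a \o u) (frag_formula h)) _.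
by congr inf; apply: eq_imagel => j _; rewrite /seq_tp /= comp_scons.
Qed.

Variable T : theory L.

Lemma seq_tp_Mod (M : structure L) (a : nat -> M) : models M T -> dense_seq a ->
  Mod F T (seq_tp F a).
Proof. by move=> MT ad; split; [exists M, a|exact: dense_seq_tp_inf]. Qed.

Definition encode (M : structure L) (a : nat -> M) (MT : models M T)
    (ad : dense_seq a) : Mod F T := SigSub (mem_set (seq_tp_Mod MT ad)).

Section ModelOf.
Variable xi : Mod F T.

Lemma real_set_seq j : @real_set _ _ _ _ xi (real_seq xi j).
Proof. by apply: (@subset_closure _ (range (real_seq xi))); exists j. Qed.

Definition model_seq (j : nat) : model_of xi :=
  SigSub (mem_set (@real_set_seq j)) : set_type (@real_set _ _ _ _ xi).

Lemma model_seq_dense : dense_seq model_seq.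
Proof.
move=> x e e0; have /closure_mdistP/(_ _ e0)[_ [j _ <-] xj] := set_valP x.
by exists j.
Qed.

Lemma val_teval n (t : term L n) (a : 'I_n -> model_of xi) :
  val (teval a t : set_type (@real_set _ _ _ _ xi)) =
  teval (fun i => val (a i : set_type (@real_set _ _ _ _ xi))) t.
Proof.
by elim: t => //= f ts IH; congr finterp; apply/funext => i; rewrite -IH.
Qed.

(** The Tarski-Vaught test: [xi] satisfies the witness property and its atomic values are those of
    the closed substructure, so the truth lemma shows that passing from the realisation to this
    substructure changes no value. *)
Lemma val_seq_tp : val xi = seq_tp F model_seq.
Proof.
apply/funext => -[n [[phi h] u]]; rewrite [RHS]/seq_tp /=.
have [_ xi_inf] := set_valP xi.
rewrite -/(seq_formula (exist _ phi h) u) -/(value (val xi) phi h u).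
symmetry; apply: feval_value.
- by rewrite real_seqE; exact: coherent_seq_tp.
- by rewrite real_seqE; apply: seq_tp_witnessed; rewrite -real_seqE.
- exact: model_seq_dense.
- move=> k P t hP v; rewrite real_seqE /value /seq_tp /= /substructure_pred.
  by congr pinterp; apply/funext => i; rewrite val_teval.
Qed.

Lemma val_model_seq n (phi : formulas F n) (u : 'I_n -> nat) :
  val xi (seq_formula phi u) = feval (sval phi) (model_seq \o u).
Proof. by rewrite val_seq_tp. Qed.

Lemma model_of_models : fragment_theory F T -> models (model_of xi) T.
Proof.
move=> hT c Tc; have [[M [a [MT xiE]]] _] := set_valP xi.
have := val_model_seq (exist _ _ (hT _ Tc)) (@tnil nat).
rewrite xiE /seq_tp /= => E; rewrite -(MT _ Tc).
by rewrite (ord0_funE (@tnil (model_of xi)) (model_seq \o @tnil nat)) -E; congr (feval _ _); exact: ord0_funE.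
Qed.

End ModelOf.

Lemma model_of_encode (M : structure L) (a : nat -> M) (MT : models M T)
    (ad : dense_seq a) : isomorphic (model_of (encode MT ad)) M.
Proof.
apply: (@isomorphic_seq_tp _ _ F _ _ _ _ (@model_seq_dense (encode MT ad)) ad).
by rewrite -val_seq_tp.
Qed.

End Truth.

Arguments value {R L F} x [n] phi h u.

(** * Definable open conditions *)

Section Definable.
Context (R : realType) (L : signature R) (F : fragment L).

Definition ev (M : structure L) n (phi : formulas F n) (a : 'I_n -> M) : R :=
  feval (sval phi) a.

Definition form_add n (p q : formulas F n) : formulas F n :=
  exist _ _ (frag_add (svalP p) (svalP q)).
Definition form_scale n (r : rat) (p : formulas F n) : formulas F n :=
  exist _ _ (frag_scale r (svalP p)).
Definition form_max n (p q : formulas F n) : formulas F n :=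
  exist _ _ (frag_max (svalP p) (svalP q)).
Definition form_subst n m (s : 'I_n -> term L m) (p : formulas F n) :
    formulas F m :=
  exist _ _ (frag_subst s (svalP p)).
Definition form_rename n m (s : 'I_n -> 'I_m) (p : formulas F n) :
    formulas F m :=
  form_subst (fun i => tvar (s i)) p.
Definition form_cst n (r : rat) : formulas F n :=
  exist _ _ (frag_scale r (frag_one F n)).
Definition form_atom n (P : pred_sym L) (t : 'I_(parity P) -> term L n) :
    formulas F n :=
  exist _ _ (frag_atom F t).
Definition form_opp n : formulas F n -> formulas F n := form_scale (-1).
Definition form_shift n (p : formulas F n) (r : rat) : formulas F n :=
  form_add p (form_cst n r).

Section Eval.
Variable M : structure L.

Lemma evN n (p : formulas F n) (a : 'I_n -> M) : ev (form_opp p) a = - ev p a.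
Proof. by rewrite /ev /= rmorphN1 mulN1r. Qed.

Lemma ev_shift n (p : formulas F n) r (a : 'I_n -> M) :
  ev (form_shift p r) a = ev p a + ratr r.
Proof. by rewrite /ev /= mulr1. Qed.

Lemma ev_max n (p q : formulas F n) (a : 'I_n -> M) :
  ev (form_max p q) a = Num.max (ev p a) (ev q a).
Proof. by []. Qed.

Lemma ev_rename n m (s : 'I_n -> 'I_m) (p : formulas F n) (a : 'I_m -> M) :
  ev (form_rename s p) a = ev p (a \o s).
Proof. by rewrite /ev /= feval_fsubst. Qed.

(** A strict bound on an infimum is an existential quantifier with no approximation; for this reason
    definable conditions are written as strict upper bounds throughout. *)
Lemma ev_inf_lt n (p : formulas F n.+1) (a : 'I_n -> M) (r : R) :
  ev (formulas_inf p) a < r <-> exists x, ev p (scons x a) < r.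
Proof. exact: feval_finf_lt (frag_formula (svalP p)). Qed.

Lemma ev_continuous n (p : formulas F n) (e : R) : 0 < e ->
  exists2 d : R, 0 < d & forall a b : 'I_n -> M,
    tdist a b < d -> `|ev p a - ev p b| < e.
Proof. exact: feval_continuous (frag_formula (svalP p)) _. Qed.

Lemma ev_lt_nbhs n (p : formulas F n) (a : 'I_n -> M) (r : R) : ev p a < r ->
  exists2 d : R, 0 < d & forall b, tdist a b < d -> ev p b < r.
Proof.
rewrite -subr_gt0 => /(ev_continuous p)[d d0 H]; exists d => // b /H.
by rewrite ltr_norml => /andP[]; lra.
Qed.

End Eval.

Lemma form_bigmax n m (p : 'I_m -> formulas F n) (r : rat) :
  exists q : formulas F n, forall (M : structure L) (a : 'I_n -> M),
    ev q a = \big[Num.max/ratr r]_(i < m) ev (p i) a.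
Proof.
exists (\big[@form_max n/form_cst n r]_(i < m) p i) => M a.
apply: (big_morph (fun q => ev q a)) => //.
by rewrite /ev /= mulr1.
Qed.

(** A conjunction of strict conditions is a condition on the maximum. The base value -1 is negative,
    so that the empty conjunction holds. *)
Lemma form_conj n m (p : 'I_m -> formulas F n) :
  exists q : formulas F n, forall (M : structure L) (a : 'I_n -> M),
    ev q a < 0 <-> forall i, ev (p i) a < 0.
Proof.
have [q qE] := form_bigmax p (-1); exists q => M a; rewrite qE; split=> [H i|H].
  by apply: le_lt_trans H; rewrite (bigD1 i) //= le_max lexx.
elim/big_ind: _ => // [|x y]; first by rewrite rmorphN1 ltrN10.
by rewrite gt_max => -> ->.
Qed.

Definition tcat (X : Type) m n (c : 'I_m -> X) (a : 'I_n -> X) :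
    'I_(m + n) -> X :=
  fun i => match fintype.split i with inl j => c j | inr j => a j end.

Lemma tcat_lshift (X : Type) m n (c : 'I_m -> X) (a : 'I_n -> X) j :
  tcat c a (lshift n j) = c j.
Proof. by rewrite /tcat; have := unsplitK (inl j : 'I_m + 'I_n); move=> /= ->. Qed.

Lemma tcat_rshift (X : Type) m n (c : 'I_m -> X) (a : 'I_n -> X) j :
  tcat c a (rshift m j) = a j.
Proof. by rewrite /tcat; have := unsplitK (inr j : 'I_m + 'I_n); move=> /= ->. Qed.

Lemma tcat_scons (X : Type) m n x (c : 'I_m -> X) (a : 'I_n -> X) :
  tcat (scons x c) a = scons x (tcat c a).
Proof.
apply/funext => i; case: (@split_ordP m.+1 n i) => j ->.
  rewrite tcat_lshift; case: (unliftP ord0 j) => [k|] ->.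
    rewrite scons_lift (_ : lshift n (lift ord0 k) = lift ord0 (lshift n k)).
      by rewrite scons_lift tcat_lshift.
    exact: val_inj.
  by rewrite scons0 (_ : lshift n ord0 = ord0) ?scons0 //; exact: val_inj.
rewrite tcat_rshift (_ : rshift m.+1 j = lift ord0 (rshift m j)).
  by rewrite scons_lift tcat_rshift.
exact: val_inj.
Qed.

Lemma tcat0 (X : Type) n (c : 'I_0 -> X) (a : 'I_n -> X) : tcat c a = a.
Proof.
apply/funext => i; have E : @rshift 0 n i = i by apply: ord_inj.
by have := tcat_rshift c a i; rewrite E.
Qed.

Fixpoint form_infs m n : formulas F (m + n) -> formulas F n :=
  match m return formulas F (m + n) -> formulas F n with
  | 0 => id
  | m'.+1 => fun p => form_infs (formulas_inf p)
  end.

Lemma ev_infs_lt (M : structure L) m n (p : formulas F (m + n)) (a : 'I_n -> M)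
    (r : R) :
  ev (form_infs p) a < r <-> exists c : 'I_m -> M, ev p (tcat c a) < r.
Proof.
elim: m p => [|m IH] p /=.
  split=> [pa|[c]]; last by rewrite tcat0.
  by exists (@tnil M); rewrite tcat0.
rewrite IH; split=> [[c /ev_inf_lt[x]]|[c]].
  by rewrite -tcat_scons => ?; exists (scons x c).
have {1}-> : c = scons (c ord0) (c \o lift ord0).
  apply/funext => i; case: (unliftP ord0 i) => [j|] ->; rewrite ?scons0 //.
  by rewrite scons_lift.
by rewrite tcat_scons => H; exists (c \o lift ord0); apply/ev_inf_lt; exists (c ord0).
Qed.

Definition form_dist n (i j : 'I_n) : formulas F n :=
  form_atom (P := dist_sym) (dist_pair (tvar i) (tvar j)).

Lemma ev_dist (M : structure L) n (i j : 'I_n) (a : 'I_n -> M) :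
  ev (form_dist i j) a = mdist (a i) (a j).
Proof.
rewrite -pinterp_dist /ev /=; congr pinterp; apply/funext => k.
by rewrite /dist_pair; case: ifP.
Qed.

(* Defines the open [q]-neighbourhood of the projection to the coordinates [u]
   of the set [{b | ev p b < 0}]. *)
Lemma form_near m n (p : formulas F m) (u : 'I_n -> 'I_m) (q : rat) :
  exists chi : formulas F n, forall (M : structure L) (a : 'I_n -> M) (r : R),
    ev chi a < r <->
    exists2 b : 'I_m -> M, ev p b < r & tdist (b \o u) a < r + ratr q.
Proof.
have [t tE] := form_bigmax (fun i => form_dist (lshift n (u i)) (rshift m i)) 0.
(* Subtracting [q] from the distance gives both requirements the same threshold [r], so a single
   infimum of a maximum expresses them for all [r] at once. *)
pose p' := form_max (form_rename (@lshift m n) p) (form_shift t (- q)).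
have p'E (M : structure L) (b : 'I_m -> M) (a : 'I_n -> M) (r : R) :
    ev p' (tcat b a) < r <-> ev p b < r /\ tdist (b \o u) a < r + ratr q.
  rewrite ev_max ev_shift ev_rename tE rmorph0 gt_max rmorphN ltrBlDr.
  have -> : tcat b a \o @lshift m n = b.
    by apply/funext => i; rewrite /= tcat_lshift.
  have -> : \big[Num.max/0]_(i < n)
      ev (form_dist (lshift n (u i)) (rshift m i)) (tcat b a) = tdist (b \o u) a.
    by apply: eq_bigr => i _; rewrite ev_dist tcat_lshift tcat_rshift.
  by split=> [/andP[]|[-> ->]].
exists (form_infs p') => M a r; rewrite ev_infs_lt; split=> [[b /p'E[]]|[b pb ba]].
  by exists b.
by exists b; apply/p'E.
Qed.

Definition elementarily_equivalent (M N : structure L) : Prop :=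
  forall s : formulas F 0, ev s (@tnil M) = ev s (@tnil N).

Lemma elementarily_equivalent_sym M N :
  elementarily_equivalent M N -> elementarily_equivalent N M.
Proof. by move=> MN s; rewrite MN. Qed.

Lemma elementarily_equivalent_ex (M N : structure L) n (p : formulas F n) (r : R) :
  elementarily_equivalent M N ->
  (exists a : 'I_n -> M, ev p a < r) -> exists a : 'I_n -> N, ev p a < r.
Proof.
move=> MN [a pa].
have tE (K : structure L) (c : 'I_n -> K) :
    ev (form_rename (@lshift n 0) p) (tcat c (@tnil K)) = ev p c.
  by rewrite ev_rename; congr ev; apply/funext => i; rewrite /= tcat_lshift.
have : ev (form_infs (form_rename (@lshift n 0) p)) (@tnil M) < r.
  by apply/ev_infs_lt; exists a; rewrite tE.
by rewrite MN => /ev_infs_lt[c]; rewrite tE; exists c.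
Qed.

Lemma models_ThP (M N : structure L) :
  models N (Th F M) <-> elementarily_equivalent M N.
Proof.
split=> [NM s|MN [s c] [/= Fs ->]]; last exact: esym (MN (exist _ s Fs)).
by apply/esym/(NM (sval s, feval (sval s) (@tnil M))); split => //; exact: svalP.
Qed.

Lemma isomorphic_equivalent (M N : structure L) :
  isomorphic M N -> elementarily_equivalent M N.
Proof.
move=> /isomorphic_feval[h [_ hE]] s; rewrite /ev -hE.
by congr (feval _ _); apply/funext => -[].
Qed.

End Definable.

Lemma rat_between (R : realType) (x y : R) : x < y ->
  exists q : rat, x < ratr q < y.
Proof. by move=> /rat_in_itvoo[q]; rewrite in_itv; exists q. Qed.


(** * Isolated types *)

Section PointwiseTopology.
Context (R : realType) (I : Type).
Implicit Types (x y : {ptws I -> R}).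

Lemma ptws_nbhs_coord x i (e : R) : 0 < e ->
  nbhs x [set y : {ptws I -> R} | `|x i - y i| < e].
Proof.
move=> e0; have /cvg_sup/(_ i) h : nbhs x --> x by exact: cvg_id.
apply: h; have /= := @initial_continuous {ptws I -> R} R (proj i) x.
move=> /(_ (ball (x i) e)); apply; exact: nbhsx_ballx.
Qed.

(** The sets that contain such a box form a filter converging to [x] in every coordinate, hence in
    the supremum of the coordinate topologies. *)
Lemma ptws_nbhs_finite x (O : set {ptws I -> R}) : nbhs x O ->
  exists k (f : 'I_k -> I) (e : R), 0 < e /\
    forall y, (forall i, `|x (f i) - y (f i)| < e) -> O y.
Proof.
pose G : set_system {ptws I -> R} := [set A | exists k (f : 'I_k -> I) (e : R),
  0 < e /\ forall y, (forall i, `|x (f i) - y (f i)| < e) -> A y].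
have GF : Filter G.
  split.
  - by exists 0%N, (@tnil I), 1.
  - move=> A B [k [f [e [e0 fA]]]] [k' [f' [e' [e'0 fB]]]].
    exists (k + k')%N, (tcat f f'), (Num.min e e'); split.
      by rewrite lt_min e0.
    move=> y H; split.
      by apply: fA => i; have := H (lshift k' i); rewrite tcat_lshift lt_min => /andP[].
    by apply: fB => i; have := H (rshift k i); rewrite tcat_rshift lt_min => /andP[].
  - move=> A B AB [k [f [e [e0 fA]]]]; exists k, f, e; split => // y /fA; exact: AB.
have : G --> x.
  apply/cvg_sup => i A [_ [[V oV <-] /= Vx VA]].
  have /nbhs_ballP[e /= e0 eV] : nbhs (x i) V by exact: open_nbhs_nbhs.
  exists 1%N, (fun=> i), e; split => // y /(_ ord0) xy.
  exact/VA/eV.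
by move=> Gx /Gx.
Qed.

End PointwiseTopology.

Lemma set_type_nbhsP (X : topologicalType) (A : set X) (p : A) (B : set A) :
  nbhs p B <-> exists O : set X, [/\ open O, O (val p) &
    forall q : A, O (val q) -> B q].
Proof.
split=> [[_ [[V oV <-] /= Vp VB]]|[V [oV Vp VB]]]; first by exists V.
by exists (val @^-1` V); split => //; exists V.
Qed.

Lemma set_type_openP (X : topologicalType) (A : set X) (B : set A) :
  open B <-> exists2 O : set X, open O & forall q : A, B q <-> O (val q).
Proof.
split=> [[V oV <-]|[V oV VB]]; first by exists V.
by exists V => //; apply/seteqP; split => q /VB.
Qed.

Section BasicOpen.
Context (R : realType) (L : signature R) (F : fragment L).

Lemma form_near_value n (p : formulas F n) (x e : R) : 0 < e ->
  exists q : formulas F n, forall (M : structure L) (a : 'I_n -> M),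
    (ev p a = x -> ev q a < 0) /\ (ev q a < 0 -> `|x - ev p a| < e).
Proof.
move=> e0.
have [q /andP[q1 q2]] : exists q : rat, x - e < ratr q < x by apply: rat_between; lra.
have [r /andP[r1 r2]] : exists r : rat, x < ratr r < x + e by apply: rat_between; lra.
exists (form_max (form_shift p (- r)) (form_shift (form_opp p) q)) => M a.
rewrite ev_max !ev_shift evN rmorphN gt_max; split=> [->|/andP[? ?]].
  by apply/andP; split; lra.
by rewrite ltr_norml; apply/andP; split; lra.
Qed.

Lemma ptws_open_coord (I : Type) (i : I) (r : R) :
  open [set y : {ptws I -> R} | y i < r].
Proof.
rewrite openE => y /= yr; have e0 : 0 < r - y i by lra.
apply: filterS (ptws_nbhs_coord y i e0) => z /=.
by rewrite ltr_norml => /andP[]; lra.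
Qed.

Lemma tp_open_basic (M : structure L) n (a : 'I_n -> M)
    (O : set {ptws formulas F n -> R}) : open O -> O (tp F a) ->
  exists2 p : formulas F n, ev p a < 0 &
    forall (N : structure L) (b : 'I_n -> N), ev p b < 0 -> O (tp F b).
Proof.
move=> oO Oa; have : nbhs (tp F a) O by exact: open_nbhs_nbhs.
move=> /ptws_nbhs_finite[k [f [e [e0 H]]]].
have /choice[q qP] i := form_near_value (f i) (ev (f i) a) e0.
have [p pP] := form_conj q.
exists p => [|N b /pP pb]; first by apply/pP => i; apply: (proj1 (qP i _ _)).
by apply: H => i; apply: (proj2 (qP i _ _)).
Qed.

(** Finitely many coordinates mention finitely many variables, so all formulas can be renamed into
    one initial segment of the variables. The bound [n] lets that segment cover indices fixed
    beforehand. *)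
Lemma seq_tp_open_basic (M : structure L) (a : nat -> M) (n : nat)
    (O : set {ptws seq_formulas F -> R}) : open O -> O (seq_tp F a) ->
  exists m, (n <= m)%N /\ exists2 p : formulas F m, ev p (a \o val) < 0 &
    forall (N : structure L) (b : nat -> N), ev p (b \o val) < 0 -> O (seq_tp F b).
Proof.
move=> oO Oa; have : nbhs (seq_tp F a) O by exact: open_nbhs_nbhs.
move=> /ptws_nbhs_finite[k [f [e [e0 H]]]].
pose m := maxn n (\max_(i < k) \max_(j < projT1 (f i)) ((projT2 (f i)).2 j).+1).
have um i j : ((projT2 (f i)).2 j < m)%N.
  rewrite leq_max; apply/orP; right.
  apply: leq_trans (leq_bigmax i); exact: (leq_bigmax j).
have /choice[q qP] i := form_near_value
  (form_rename (fun j => Ordinal (um i j)) (projT2 (f i)).1)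
  (seq_tp F a (f i)) e0.
have fE (N : structure L) (b : nat -> N) i : ev (form_rename
    (fun j => Ordinal (um i j)) (projT2 (f i)).1) (b \o val) = seq_tp F b (f i).
  by rewrite ev_rename.
have [p pP] := form_conj q.
exists m; split; first exact: leq_maxl.
exists p => [|N b /pP pb].
  by apply/pP => i; apply: (proj1 (qP i _ _)); rewrite fE.
by apply: H => i; rewrite -(fE N b i); apply: (proj2 (qP i _ _)).
Qed.

End BasicOpen.

Section Isolated.
Context (R : realType) (L : signature R) (F : fragment L) (M : structure L).

(* The type of [a] is isolated, expressed inside [M]. *)
Definition locally_isolated n (a : 'I_n -> M) : Prop :=
  forall d : R, 0 < d -> exists2 p : formulas F n, ev p a < 0 &
    forall b : 'I_n -> M, ev p b < 0 -> forall w : formulas F n, ev w a < 0 ->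
    exists2 c : 'I_n -> M, ev w c < 0 & tdist b c < d.

(** A type near that of [a] may be realised only in another model [N], but each of its basic
    neighbourhoods is realised in [M] by elementary equivalence. The witnesses for [type_dist] can
    thus all be taken in [M]. *)
Lemma locally_isolated_isolated n (a : 'I_n -> M) :
  locally_isolated a -> isolated_type (type_of F (models_Th F M) a).
Proof.
move=> ai d d0; have d20 : 0 < d / 2 by lra.
have [p pa H] := ai _ d20; apply/set_type_nbhsP.
exists [set y : {ptws formulas F n -> R} | y p < 0]; split => //.
  exact: ptws_open_coord.
move=> q qp; apply: (@le_lt_trans _ _ (d / 2)%:E); last by rewrite lte_fin; lra.
apply: ereal_inf_lbound; exists (d / 2) => //= U V.
move=> /set_type_openP[U' oU' UU'] /set_type_openP[V' oV' VV'].
move=> /UU' Ua /VV' Vq.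
have [w wa wU] := tp_open_basic oU' Ua.
have [N [b [NM qb]]] := set_valP q.
have pb : ev p b < 0 by have := qp; rewrite /= qb.
rewrite qb in Vq; have [v vb vV] := tp_open_basic oV' Vq.
have [b' ] : exists b' : 'I_n -> M, ev (form_max p v) b' < 0.
  apply: (@elementarily_equivalent_ex _ _ F N).
    exact/elementarily_equivalent_sym/models_ThP.
  by exists b; rewrite ev_max gt_max pb vb.
rewrite ev_max gt_max => /andP[pb' vb'].
have [c wc bc] := H _ pb' _ wa.
exists M, (models_Th F M), c, b'; split; last by rewrite tdist_sym.
  by apply/UU' => /=; exact: wU.
by apply/VV' => /=; exact: vV.
Qed.

(** If no realisation of [w] is close to [b], then [chi] is non-negative at [b]. For any [t < 0] the
    condition [chi > t] is then an open neighbourhood of the type of [b], and for a suitable [t] it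
    contradicts the small distance to the type of [a]. *)
Lemma isolated_locally_isolated n (a : 'I_n -> M) :
  isolated_type (type_of F (models_Th F M) a) -> locally_isolated a.
Proof.
move=> ai d d0; have d20 : 0 < d / 2 by lra.
have [V [oV Va VH]] := proj1 (set_type_nbhsP _ _) (ai _ d20).
have [p pa pO] := tp_open_basic oV Va; exists p => // b pb w wa.
have := VH (type_of F (models_Th F M) b) (pO _ _ pb).
rewrite /= => /ereal_inf_lt[_ [s sP <-]]; rewrite lte_fin => sd.
have [q /andP[q1 q2]] := rat_between wa.
have [r /andP[r1 r2]] : exists r : rat, d / 2 < ratr r < d by apply: rat_between; lra.
have [chi chiP] := form_near w id r.
have [/chiP[c wc]|H] := ltP (ev chi b) 0.
  by rewrite tdist_sym add0r => bc; exists c => //; lra.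
(* Since [s < d / 2 < ratr r], this is negative. It is large enough that [w < ratr q] at [a'] and a
   distance less than [s] force [chi < t] at [b']. *)
pose t := Num.max (ratr q) (s - ratr r : R).
have t0 : t < 0 by rewrite gt_max q2; lra.
have [||||N [NM [a' [b' [/= Ua Vb ab]]]]] := sP
  [set y | val y w < ratr q] [set y | val y (form_opp chi) < - t].
- by apply/set_type_openP; eexists; first exact: (ptws_open_coord w (ratr q)).
- by apply/set_type_openP; eexists; first exact: (ptws_open_coord (form_opp chi) (- t)).
- exact: q1.
- by rewrite /= -[X in X < _]/(ev (form_opp chi) b) evN; lra.
have : ev chi b' < t.
  apply/chiP; exists a'; first by apply: lt_le_trans Ua _; rewrite le_max lexx.
  by apply: lt_le_trans ab _; rewrite -lerBlDr le_max lexx orbT.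
by move: Vb; rewrite -[X in X < _]/(ev (form_opp chi) b') evN; lra.
Qed.

Lemma atomicP : atomic F M <-> forall n (a : 'I_n -> M), locally_isolated a.
Proof.
split=> H n a; first exact: isolated_locally_isolated.
exact: locally_isolated_isolated.
Qed.

End Isolated.

(** * Non-meager classes *)

Lemma nowhere_dense0 (X : topologicalType) : nowhere_dense (set0 : set X).
Proof.
rewrite /nowhere_dense closure0; apply/seteqP; split => // x.
exact: interior_subset.
Qed.

Lemma meager_bigcup (X : topologicalType) (I : countType) (N : I -> set X) :
  (forall i, nowhere_dense (N i)) -> meager (\bigcup_i N i).
Proof.
move=> Nn; exists (fun k => if unpickle k is Some i then N i else set0).
  by move=> k; case: unpickle => // ; exact: nowhere_dense0.
apply/seteqP; split => [x [i _ Nx]|x [k _]].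
  by exists (pickle i) => //; rewrite pickleK.
by case: unpickle => // i Nx; exists i.
Qed.

Section Prepend.
Context (X : Type) (m : nat) (b : 'I_m -> X) (s : nat -> X).

Definition prepend (i : nat) : X :=
  if @idP (i < m)%N is ReflectT im then b (Ordinal im) else s (i - m).

Lemma prepend_ord (i : 'I_m) : prepend i = b i.
Proof.
rewrite /prepend; case: {-}_ / idP => [im|]; last by case; exact: ltn_ord.
by congr b; exact: val_inj.
Qed.

Lemma prepend_addn i : prepend (m + i) = s i.
Proof.
rewrite /prepend; case: {-}_ / idP => [im|_]; last by rewrite addKn.
by exfalso; move: im; rewrite ltnNge leq_addr.
Qed.

End Prepend.

Lemma dense_prepend (R : realType) (X : metricType R) m (b : 'I_m -> X) s :
  dense_seq s -> dense_seq (prepend b s).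
Proof. by move=> sd x e /(sd x)[j xj]; exists (m + j)%N; rewrite prepend_addn. Qed.

Section NonmeagerClass.
Context (R : realType) (L : signature R) (F : fragment L) (T : theory L).
Hypothesis hT : fragment_theory F T.
Variable xi : Mod F T.

Local Notation M := (model_of xi).
Local Notation C := (closure (iso_class xi)).

Lemma iso_class_refl : iso_class xi xi.
Proof. by exists id; split => //; exists id. Qed.

Lemma Mod_open_lt n (p : formulas F n) (u : 'I_n -> nat) (r : R) :
  open [set eta : Mod F T | ev p (model_seq eta \o u) < r].
Proof.
apply/set_type_openP; exists [set y | y (seq_formula p u) < r].
  exact: ptws_open_coord.
by move=> eta /=; rewrite val_seq_tp.
Qed.

Lemma prepend_iso_class m (b : 'I_m -> M) :
  exists eta : Mod F T, iso_class xi eta /\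
    val eta = seq_tp F (prepend b (model_seq xi)).
Proof.
have bd := dense_prepend b (@model_seq_dense _ _ _ _ xi).
exists (encode F (model_of_models xi hT) bd); split => //.
exact: model_of_encode.
Qed.

Lemma nonmeager_locally_isolated :
  ~ meager (trace C (iso_class xi)) ->
  forall n (a : 'I_n -> M), locally_isolated F a.
Proof.
move=> nm n a d d0.
(* The final distance is below [5 * r]: [3 * r] from the neighbourhood defined by [theta], and
   [2 * r] from [chi] used at a threshold of at most [r]. *)
have [r /andP[r0 rd]] := rat_between (divr_gt0 d0 (ltr0n R 6)).
have /choice[chi chiP] (w : formulas F n) := form_near w id r.
(* The bound is [<= 0] and not [< 0], hence closed, so that it passes from [N u] to its closure.
   Finite functions make the index type countable. *)
pose N (u : {ffun 'I_n -> nat}) : set (Mod F T) := [set eta | iso_class xi eta /\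
  forall w : formulas F n, ev w a < 0 -> ev (chi w) (model_seq eta \o u) <= 0].
have NE : trace C (iso_class xi) = \bigcup_u trace C (N u).
  apply/seteqP; split => [eta xieta|eta [u _ []]//].
  have [h [_ hE]] := isomorphic_feval (isomorphic_sym xieta).
  have [u uP] := dense_seq_tuple (h \o a) (@model_seq_dense _ _ _ _ (val eta)) r0.
  exists (finfun u) => //; split => // w wa; apply: ltW; apply/chiP.
  exists (h \o a); first by rewrite /ev hE.
  have -> : model_seq (val eta) \o finfun u = model_seq (val eta) \o u.
    by apply/funext => i /=; rewrite ffunE.
  by rewrite add0r.
have [u Nu] : exists u, ~ nowhere_dense (trace C (N u)).
  by apply/existsNP => H; apply: nm; rewrite NE; exact: meager_bigcup.
have [eta0 /set_type_nbhsP[W [oW Weta0 WH]]] :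
    interior (closure (trace C (N u))) !=set0 by apply/set0P/eqP.
(* A point of [C] need not code a copy of [M]; a point of the class inside [W] does, and the formula
   [p] obtained from it is realised in [M]. *)
have [eta1 [xieta1 Weta1]] := set_valP eta0 _ (open_nbhs_nbhs (conj oW Weta0)).
have /set_type_openP[W' oW' WW'] := oW.
have := Weta1; rewrite WW' val_seq_tp.
move=> /(seq_tp_open_basic (\max_(i < n) (u i).+1) oW')[m [um [p p1 pW]]].
have {}um i : (u i < m)%N by apply: leq_trans um; exact: (leq_bigmax i).
pose v i : 'I_m := Ordinal (um i).
(* The enumeration of [M] that begins with [b] lies in [W], hence in the closure of [N u]; if
   [chi w] were positive at its coordinates [u], this would define a neighbourhood that misses
   [N u]. *)
have claim (b : 'I_m -> M) : ev p b < 0 -> forall w : formulas F n,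
    ev w a < 0 -> ev (chi w) (b \o v) <= 0.
  move=> pb w wa; rewrite leNgt; apply/negP => wb.
  have [eta [xieta etaE]] := prepend_iso_class b.
  have Ceta : C eta by exact: subset_closure.
  have bE : prepend b (model_seq xi) \o val = b.
    by apply/funext => i /=; rewrite prepend_ord.
  have Weta : W eta by rewrite WW' etaE; apply: pW; rewrite bE.
  have := WH (SigSub (mem_set Ceta)) Weta.
  move=> /(_ [set q | ev (form_opp (chi w)) (model_seq (val q) \o u) < 0])[].
    apply/set_type_nbhsP; eexists; split; first exact: (Mod_open_lt (form_opp (chi w)) u 0).
      change (ev (form_opp (chi w)) (model_seq eta \o u) < 0).
      have -> : ev (form_opp (chi w)) (model_seq eta \o u) =
          seq_tp F (prepend b (model_seq xi)) (seq_formula (form_opp (chi w)) u).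
        by rewrite -etaE val_seq_tp.
      rewrite -[X in X < _]/(ev (form_opp (chi w)) (prepend b (model_seq xi) \o u)).
      rewrite evN oppr_lt0; congr (0 < ev _ _): wb.
      by apply/funext => i; rewrite /= -(prepend_ord b (model_seq xi)).
    by [].
  by move=> q [[_ /(_ w wa)]] /=; rewrite evN; lra.
have [h [_ hE]] := isomorphic_feval xieta1.
pose b0 := h \o (model_seq eta1 \o val) : 'I_m -> M.
have pb0 : ev p b0 < 0 by rewrite /ev hE.
have [theta thetaP] := form_near p v (3 * r).
have r3 : ratr (3 * r) = 3 * ratr r :> R by rewrite rmorphM rmorph_nat.
exists theta.
  (* Otherwise [theta > - e] is a neighbourhood of [a], and the claim gives a point [c] at distance
     less than [r + e] from [b0 \o v] with [theta > - 2 e]. But [p] is below [- 2 e] at [b0] and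
     [r + e < 3 r - 2 e], so [theta < - 2 e] at [c]. *)
  rewrite ltNge; apply/negP => theta0.
  have e_gt0 : 0 < Num.min (- ev p b0 / 2) (ratr r / 2).
    by rewrite lt_min; apply/andP; split; lra.
  have [e /andP[e0 e1]] := rat_between e_gt0.
  move: e1; rewrite lt_min => /andP[e1 e2].
  have wa : ev (form_shift (form_opp theta) (- e)) a < 0.
    by rewrite ev_shift evN rmorphN; lra.
  have : ev (chi (form_shift (form_opp theta) (- e))) (b0 \o v) < ratr e.
    by apply: le_lt_trans e0; exact: claim.
  move=> /chiP[c]; rewrite ev_shift evN rmorphN => wc cb0.
  have : ev theta c < - 2 * ratr e.
    apply/thetaP; exists b0; first by lra.
    by rewrite tdist_sym r3; apply: lt_le_trans cb0 _; lra.
  by lra.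
move=> b /thetaP[b']; rewrite add0r r3 => pb' bb' w wa.
have [q /andP[q1 q2]] := rat_between wa.
(* [form_near] turns only a strict bound on [chi] into a witness, and the claim yields [<= 0].
   Lowering the target to [w < q] with [q < 0] leaves room for a positive threshold of at most
   [- q]. *)
have wa' : ev (form_shift w (- q)) a < 0 by rewrite ev_shift rmorphN; lra.
have : ev (chi (form_shift w (- q))) (b' \o v) < Num.min (ratr r) (- ratr q : R).
  apply: le_lt_trans (claim _ pb' _ wa') _.
  by rewrite lt_min r0; lra.
move=> /chiP[c]; rewrite ev_shift rmorphN => wc cb'.
exists c.
  have : Num.min (ratr r) (- ratr q : R) <= - ratr q by rewrite ge_min lexx orbT.
  by lra.
have : Num.min (ratr r) (- ratr q : R) <= ratr r by rewrite ge_min lexx.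
have := tdist_triangle (b' \o v) b c.
by rewrite (tdist_sym b (b' \o v)) (tdist_sym (b' \o v) c); lra.
Qed.

End NonmeagerClass.

(** * Back and forth *)

Section Tight.
Context (R : realType) (L : signature R) (F : fragment L).

(* A formula [p] is [d]-tight in [M] if the types realized in the open set
   defined by [p] are pairwise at distance at most [d]. *)
Definition tight (M : structure L) n (p : formulas F n) (d : R) : Prop :=
  forall b b' : 'I_n -> M, ev p b < 0 -> ev p b' < 0 ->
  forall w : formulas F n, ev w b < 0 ->
  exists2 c : 'I_n -> M, ev w c < 0 & tdist b' c < d.

(** A triangle inequality through [a]. The tuple [a] satisfies [chi], which defines the
    [r]-neighbourhood of [w], for otherwise a neighbourhood of [a] would stay away from [b]. Hence
    [b'] is within [d / 4] of a tuple satisfying [chi], and within [d / 4 + r < d] of one satisfying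
    [w]. *)
Lemma locally_isolated_tight (M : structure L) n (a : 'I_n -> M) (d : R) :
  locally_isolated F a -> 0 < d -> exists2 p, ev p a < 0 & tight M p d.
Proof.
move=> ai d0; have d40 : 0 < d / 4 by lra.
have [p pa H] := ai _ d40; exists p => // b b' pb pb' w wb.
have d42 : d / 4 < d / 2 by lra.
have [r /andP[r1 r2]] := rat_between d42.
have [chi chiP] := form_near w id r.
have chia : ev chi a < 0.
  rewrite ltNge; apply/negP => chia0.
  have e0 : 0 < Num.min (- ev w b) (ratr r - d / 4).
    by rewrite lt_min; apply/andP; split; lra.
  have [e /andP[e1]] := rat_between e0; rewrite lt_min => /andP[e2 e3].
  have wa : ev (form_shift (form_opp chi) (- e)) a < 0.
    by rewrite ev_shift evN rmorphN; lra.
  have [c] := H _ pb _ wa; rewrite ev_shift evN rmorphN => wc bc.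
  have : ev chi c < - ratr e by apply/chiP; exists b; lra.
  by lra.
have [c' /chiP[c wc]] := H _ pb' _ chia; rewrite add0r => cc' b'c'.
exists c => //; have := tdist_triangle c' b' c.
by rewrite (tdist_sym c' c); move: cc'; rewrite -[c \o id]/c; lra.
Qed.

Lemma tight_equivalent (M N : structure L) n (p : formulas F n) (d d' : R) :
  elementarily_equivalent F M N -> tight M p d -> d < d' -> tight N p d'.
Proof.
move=> MN tp_ dd' b b' pb pb' w wb.
have [r /andP[r1 r2]] := rat_between dd'.
have [q /andP[q1 q2]] := rat_between wb.
have wqE (K : structure L) (c : 'I_n -> K) :
  ev (form_shift w (- q)) c = ev w c - ratr q by rewrite ev_shift rmorphN.
have [chi chiP] := form_near (form_shift w (- q)) id r.
(* The threshold is positive: below it, [chi] still gives a realisation of [w] within [d']; at or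
   above it, [0 < chi] at [b'] is an open condition, which transfers to [M] and contradicts
   tightness there. This costs the increase from [d] to [d']. *)
have [/chiP[c]|H] := ltP (ev chi b') (Num.min (- ratr q) (d' - ratr r)).
  have : Num.min (- ratr q) (d' - ratr r) <= - ratr q by rewrite ge_min lexx.
  have : Num.min (- ratr q) (d' - ratr r) <= d' - ratr r by rewrite ge_min lexx orbT.
  rewrite wqE tdist_sym -[c \o id]/c; exists c; lra.
have chi0 : 0 < ev chi b'.
  by apply: lt_le_trans H; rewrite lt_min; apply/andP; split; lra.
have NM := elementarily_equivalent_sym MN.
have [b1] : exists b1 : 'I_n -> M, ev (form_max p (form_shift w (- q))) b1 < 0.
  apply: elementarily_equivalent_ex NM _; exists b.
  by rewrite ev_max wqE gt_max pb; lra.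
rewrite ev_max gt_max => /andP[pb1 wb1].
have [b2] : exists b2 : 'I_n -> M, ev (form_max p (form_opp chi)) b2 < 0.
  apply: elementarily_equivalent_ex NM _; exists b'.
  by rewrite ev_max evN gt_max pb' oppr_lt0.
rewrite ev_max gt_max evN oppr_lt0 => /andP[pb2 chib2].
have [c wc b2c] := tp_ _ _ pb1 pb2 _ wb1.
have : ev chi b2 < 0.
  by apply/chiP; exists c; rewrite // add0r tdist_sym; exact: lt_trans b2c r1.
by lra.
Qed.

Lemma tight_transfer (M N : structure L) n (p w : formulas F n) (d : R)
    (b : 'I_n -> M) (b' : 'I_n -> N) :
  elementarily_equivalent F M N -> tight N p d ->
  ev p b < 0 -> ev p b' < 0 -> ev w b < 0 ->
  exists2 c : 'I_n -> N, ev w c < 0 & tdist b' c < d.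
Proof.
move=> MN tp_ pb pb' wb.
have [b''] : exists b'' : 'I_n -> N, ev (form_max p w) b'' < 0.
  by apply: elementarily_equivalent_ex MN _; exists b; rewrite ev_max gt_max pb.
by rewrite ev_max gt_max => /andP[pb'' wb'']; exact: tp_ pb'' pb' _ wb''.
Qed.

(** Only tuples of the enumeration are considered: about these a code can speak by countably many
    open conditions, and with density they suffice for back and forth. *)
Definition tightly_enumerated (M : structure L) (a : nat -> M) : Prop :=
  forall n (u : 'I_n -> nat) (d : R), 0 < d ->
    exists2 p : formulas F n, ev p (a \o u) < 0 & tight M p d.

(** The forth step. The projection of a tight condition on the longer [a]-tuple is enlarged by [r]
    and transferred to [N]. The entries of [b] move by less than [3 * d]: [d] by tightness of [p],
    [r < d] by the enlargement, and [d] in returning to the enumeration [b]. *)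
Lemma tight_extend (M N : structure L) (a : nat -> M) (b : nat -> N) k
    (p : formulas F k) (u v : nat -> nat) (d d' : R) (j : nat) :
  elementarily_equivalent F M N -> tightly_enumerated a -> dense_seq b ->
  0 < d -> 0 < d' -> tight N p d ->
  ev p (a \o u \o val) < 0 -> ev p (b \o v \o val) < 0 ->
  exists p' : formulas F k.+1, exists u' v' : nat -> nat,
    [/\ tight M p' d' /\ tight N p' d',
        ev p' (a \o u' \o val) < 0, ev p' (b \o v' \o val) < 0,
        forall i, (i < k)%N -> u' i = u i /\ mdist (b (v i)) (b (v' i)) < 3 * d &
        u' k = j].
Proof.
move=> MN ta bd d0 d'0 tN pa pb.
pose u' i := if (i < k)%N then u i else j.
have d'20 : 0 < d' / 2 by lra.
(* Tightness worsens slightly when it is moved to [N], hence the half. *)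
have [p' pa' tM'] := ta k.+1 (u' \o val) _ d'20.
have tN' : tight N p' d' by apply: tight_equivalent MN tM' _; lra.
have [r /andP[r1 r2]] := rat_between d0.
pose s := widen_ord (leqnSn k) : 'I_k -> 'I_k.+1.
have [w wP] := form_near p' s r.
have [] := tight_transfer (w := w) MN tN pa pb.
  apply/wP; exists (a \o (u' \o val)) => //; rewrite add0r.
  rewrite (_ : _ \o s = a \o u \o val) ?tdistxx //.
  by apply/funext => i; rewrite /= /u' ltn_ord.
move=> c /wP[b' pb']; rewrite add0r => b'c bc.
have [e e0 eP] := ev_lt_nbhs pb'.
have ed0 : 0 < Num.min e d by rewrite lt_min e0.
have [v' b'v'] := dense_seq_tuple b' bd ed0.
exists p', u', (prepend v' (fun=> 0%N)); split => //.
- by split => //; apply: tight_equivalent tM' _ => //; lra.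
- rewrite (_ : b \o _ \o val = b \o v').
    by apply: eP; apply: lt_le_trans b'v' _; rewrite ge_min lexx.
  by apply/funext => i; rewrite /= prepend_ord.
- move=> i ik; split; first by rewrite /u' ik.
  have -> : prepend v' (fun=> 0%N) i = v' (s (Ordinal ik)).
    by rewrite -(prepend_ord v' (fun=> 0%N)).
  have b'd : tdist b' (b \o v') < d.
    by apply: lt_le_trans b'v' _; rewrite ge_min lexx orbT.
  have := le_tdist b' (b \o v') (s (Ordinal ik)).
  have := le_tdist (b' \o s) c (Ordinal ik).
  have := le_tdist (b \o v \o val) c (Ordinal ik) => /=.
  have := metric_triangle (b (v i)) (c (Ordinal ik)) (b (v' (s (Ordinal ik)))).
  have := metric_triangle (c (Ordinal ik)) (b' (s (Ordinal ik)))
    (b (v' (s (Ordinal ik)))).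
  by rewrite (metric_sym (c (Ordinal ik)) (b' _)); lra.
- by rewrite /u' ltnn.
Qed.

End Tight.

Section GeometricSequences.
Context (R : realType).

Definition halves (k : nat) : R := 2^-1 ^+ k.

Lemma halves_gt0 k : 0 < halves k.
Proof. by rewrite exprn_gt0 // invr_gt0. Qed.

Lemma halvesS k : halves k.+1 = halves k / 2.
Proof. by rewrite /halves exprSr. Qed.

Lemma halves_lt (e : R) : 0 < e -> exists K, forall k, (K <= k)%N -> halves k < e.
Proof.
move=> e0; have [K KP] := natSinv_lt e0; exists K => k /KP; apply: le_lt_trans.
rewrite /halves exprVn lef_pV2 ?posrE ?exprn_gt0 ?ltr0n //.
by rewrite -natrX ler_nat; exact: ltn_expl.
Qed.

(** [6 * halves k] is the sum of the tail of [3 * halves i] over [i >= k]; the differences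
    telescope. *)
Lemma geometric_limit (X : metricType R) (s : nat -> X) (K : nat) :
  complete_space X ->
  (forall k, (K <= k)%N -> mdist (s k) (s k.+1) < 3 * halves k) ->
  exists l, forall k, (K <= k)%N -> mdist (s k) l <= 6 * halves k.
Proof.
move=> Xc sK.
have sj k j : (K <= k)%N -> mdist (s k) (s (k + j)%N) <= 6 * halves k - 6 * halves (k + j).
  move=> Kk; elim: j => [|j IH]; first by rewrite addn0 mdistxx subrr.
  have := sK (k + j)%N (leq_trans Kk (leq_addr _ _)).
  rewrite addnS halvesS.
  have := metric_triangle (s k) (s (k + j)%N) (s (k + j).+1); lra.
have [e e0|l lP] := complete_space_seq (s := s) Xc.
  have e60 : 0 < e / 6 by lra.
  have [K' K'P] := halves_lt e60; exists (maxn K K') => k Kk.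
  have := sj _ (k - maxn K K')%N (leq_maxl K K').
  rewrite subnKC //; have := K'P _ (leq_maxr K K').
  by have := halves_gt0 k; lra.
exists l => k Kk; apply/ler_addgt0Pl => e e0; have [K' K'P] := lP e e0.
have := sj _ (maxn k K' - k)%N Kk; rewrite subnKC ?leq_maxl //.
have := K'P _ (leq_maxr k K').
have := metric_triangle (s k) (s (maxn k K')) l.
by have := halves_gt0 (maxn k K'); lra.
Qed.

End GeometricSequences.

(** Stage [k] treats the index [logn 3 k], on the side given by the parity of [k]. Each task must
    recur arbitrarily late, when entries hardly move any more. *)
Lemma schedule (b : bool) (j K : nat) :
  exists k, [/\ (K <= k)%N, odd k = b & logn 3 k = j].
Proof.
exists (3 ^ j * (if b then 5 else 2) ^ K.+1)%N; split.
- apply: leq_trans (_ : K <= (if b then 5 else 2) ^ K.+1)%N _.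
    by apply: ltnW; apply: ltn_trans (ltnSn K) _; case: b; exact: ltn_expl.
  by rewrite leq_pmull // expn_gt0.
- by rewrite oddM !oddX /=; case: b => /=; rewrite orbT.
- rewrite lognM ?expn_gt0 //; last by case: b.
  by rewrite !lognX logn_prime // eqxx muln1; case: b; rewrite muln0 addn0.
Qed.

Section BackAndForth.
Context (R : realType) (L : signature R) (F : fragment L).
Variables (M N : structure L) (a : nat -> M) (b : nat -> N).
Hypotheses (MN : elementarily_equivalent F M N).
Hypotheses (ta : tightly_enumerated F a) (tb : tightly_enumerated F b).
Hypotheses (ad : dense_seq a) (bd : dense_seq b).

Local Notation delta := (halves R).

(* [a (u i)] and [b (v i)], for [i < k], are the tuples matched at stage [k]. *)
Definition matched (k : nat) (uv : (nat -> nat) * (nat -> nat)) : Prop :=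
  exists p : formulas F k,
    [/\ tight M p (delta k), tight N p (delta k),
        ev p (a \o uv.1 \o val) < 0 & ev p (b \o uv.2 \o val) < 0].

Definition matched_step (k : nat) (uv uv' : (nat -> nat) * (nat -> nat)) : Prop :=
  [/\ matched k.+1 uv',
      forall i, (i < k)%N -> mdist (a (uv.1 i)) (a (uv'.1 i)) < 3 * delta k,
      forall i, (i < k)%N -> mdist (b (uv.2 i)) (b (uv'.2 i)) < 3 * delta k &
      (if odd k then uv'.2 k else uv'.1 k) = logn 3 k].

Lemma matched_step_ex k uv : matched k uv -> exists uv', matched_step k uv uv'.
Proof.
case: uv => u v [p [/= tM tN pa pb]].
have d0 := halves_gt0 R k; have d'0 := halves_gt0 R k.+1.
case kodd : (odd k).
  have [p' [v' [u' [[tN' tM'] pb' pa' near v'k]]]] :=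
    tight_extend (logn 3 k) (elementarily_equivalent_sym MN) tb ad d0 d'0 tM pb pa.
  exists (u', v'); rewrite /matched_step kodd; split => //=.
  - by exists p'.
  - by move=> i /near[].
  - by move=> i /near[-> _]; rewrite mdistxx mulr_gt0.
have [p' [u' [v' [[tM' tN'] pa' pb' near u'k]]]] :=
  tight_extend (logn 3 k) MN ta bd d0 d'0 tN pa pb.
exists (u', v'); rewrite /matched_step kodd; split => //=.
- by exists p'.
- by move=> i /near[-> _]; rewrite mdistxx mulr_gt0.
- by move=> i /near[].
Qed.

Lemma matched0 : exists uv, matched 0 uv.
Proof.
have d20 : 0 < delta 0 / 2 by have := halves_gt0 R 0; lra.
have [p pa tM] := ta (@tnil nat) d20.
exists (id, id), p; split.
- by move=> c c' pc pc' w /(tM _ _ pc pc')[c'' ? ?]; exists c'' => //; lra.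
- by apply: tight_equivalent MN tM _; lra.
- by rewrite [X in ev p X](ord0_funE _ (a \o @tnil nat)).
- by rewrite [X in ev p X](ord0_funE _ (@tnil N)) -MN (ord0_funE (@tnil M) (a \o @tnil nat)).
Qed.

Lemma matched_seq : exists S : nat -> (nat -> nat) * (nat -> nat),
  forall k, matched k (S k) /\ matched_step k (S k) (S k.+1).
Proof.
have [uv0 m0] := matched0.
have /choice[f fP] (q : nat * ((nat -> nat) * (nat -> nat))) :
    exists uv', matched q.1 q.2 -> matched_step q.1 q.2 uv'.
  have [/matched_step_ex[uv']|] := pselect (matched q.1 q.2).
    by exists uv'.
  by exists uv0.
pose S := fix S k := if k is k'.+1 then f (k', S k') else uv0.
have Sm k : matched k (S k) by elim: k => //= k /(fP (k, S k))[].
by exists S => k; split; [exact: Sm|exact: (fP (k, S k)) (Sm k)].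
Qed.

Section Limit.
Variable S : nat -> (nat -> nat) * (nat -> nat).
Hypothesis SP : forall k, matched k (S k) /\ matched_step k (S k) (S k.+1).
Variables (A : nat -> M) (B : nat -> N).
Hypothesis AP : forall i k, (i < k)%N -> mdist (a ((S k).1 i)) (A i) <= 6 * delta k.
Hypothesis BP : forall i k, (i < k)%N -> mdist (b ((S k).2 i)) (B i) <= 6 * delta k.

(** A stage [k] scheduled for [j] puts the point of index [j] in position [k], and from stage [k.+1]
    to the limit it moves by at most [6 * delta k.+1]. Late occurrences of [j] make this arbitrarily
    small. *)
Lemma limit_dense : dense_seq A /\ dense_seq B.
Proof.
split=> x e e0; have e20 : 0 < e / 2 by lra.
  have [j xj] := ad x e20.
  have e60 : 0 < e / 12 by lra.
  have [K KP] := halves_lt e60; have [k [Kk kodd kj]] := schedule false j K.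
  exists k; have [_ [_ _ _]] := SP k; rewrite kodd kj => Skj.
  have := AP (ltnSn k); rewrite Skj.
  have := KP k.+1 (leq_trans Kk (leqnSn k)).
  by have := metric_triangle x (a j) (A k); lra.
have [j xj] := bd x e20.
have e60 : 0 < e / 12 by lra.
have [K KP] := halves_lt e60; have [k [Kk kodd kj]] := schedule true j K.
exists k; have [_ [_ _ _]] := SP k; rewrite kodd kj => Skj.
have := BP (ltnSn k); rewrite Skj.
have := KP k.+1 (leq_trans Kk (leqnSn k)).
by have := metric_triangle x (b j) (B k); lra.
Qed.

(** If [phi] were larger on the side of [A], a late stage would carry the strict bound from [b] back
    to [M] by tightness, at a tuple too close to [A \o w]. The converse inequality is the same
    statement for the opposite formula. *)
Lemma limit_le n (phi : formulas F n) (w : 'I_n -> nat) :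
  ev phi (A \o w) <= ev phi (B \o w).
Proof.
rewrite leNgt; apply/negP => BA.
have [q /andP[Bq qA]] := rat_between BA.
have [d d0 dP] := ev_lt_nbhs Bq.
have qA' : ev (form_opp phi) (A \o w) < - ratr q by rewrite evN ltrN2.
have [d' d'0 d'P] := ev_lt_nbhs qA'.
(* Seven is one [delta k] from tightness plus six from the distance to the limit. *)
have e0 : 0 < Num.min d d' / 7 by rewrite divr_gt0 // lt_min d0.
have [K KP] := halves_lt e0.
have [k Kk wk] : exists2 k, (K <= k)%N & forall i, (w i < k)%N.
  exists (maxn K (\max_(i < n) (w i).+1)) => [|i]; first exact: leq_maxl.
  by rewrite leq_max (leq_bigmax i) orbT.
have := KP k Kk; rewrite ltr_pdivlMr // lt_min => /andP[kd kd'].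
have dk := halves_gt0 R k.
have [[p [tM tN pa pb]] _] := SP k.
pose W := form_shift (form_rename (fun i => Ordinal (wk i)) phi) (- q).
have WE (K0 : structure L) (c : 'I_k -> K0) :
    ev W c = ev phi (c \o (fun i => Ordinal (wk i))) - ratr q.
  by rewrite ev_shift ev_rename rmorphN.
have Wb : ev W (b \o (S k).2 \o val) < 0.
  rewrite WE subr_lt0; apply: dP; rewrite tdist_sym; apply/tdist_ltP => // i /=.
  by apply: le_lt_trans (BP (wk i)) _; lra.
have [c] := tight_transfer (elementarily_equivalent_sym MN) tM pb pa Wb.
rewrite WE => Wc ac.
have : ev (form_opp phi) (c \o (fun i => Ordinal (wk i))) < - ratr q.
  apply: d'P; rewrite tdist_sym; apply/tdist_ltP => // i /=.
  have := le_tdist (a \o (S k).1 \o val) c (Ordinal (wk i)) => /=.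
  have := AP (wk i).
  have := metric_triangle (c (Ordinal (wk i))) (a ((S k).1 (w i))) (A (w i)).
  by rewrite (metric_sym (c _) (a _)); lra.
by rewrite evN; lra.
Qed.

End Limit.

Lemma back_and_forth : isomorphic M N.
Proof.
have [S SP] := matched_seq.
have /choice[A AP] i : exists l, forall k, (i < k)%N ->
    mdist (a ((S k).1 i)) l <= 6 * delta k.
  apply: (geometric_limit (s := fun k => a ((S k).1 i))) => [|k ik].
    exact: carrier_complete.
  by have [_ [_ + _ _]] := SP k; apply.
have /choice[B BP] i : exists l, forall k, (i < k)%N ->
    mdist (b ((S k).2 i)) l <= 6 * delta k.
  apply: (geometric_limit (s := fun k => b ((S k).2 i))) => [|k ik].
    exact: carrier_complete.
  by have [_ [_ _ + _]] := SP k; apply.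
have [Ad Bd] := limit_dense SP AP BP.
apply: (isomorphic_seq_tp (F := F) Ad Bd); apply/funext => -[n [phi w]].
rewrite /seq_tp /= -/(ev phi (A \o w)) -/(ev phi (B \o w)).
apply/eqP; rewrite eq_le (limit_le SP AP BP) /=.
by have := limit_le SP AP BP (form_opp phi) w; rewrite !evN lerN2.
Qed.

End BackAndForth.

(** * The class of an atomic model as a countable intersection of open sets *)

Lemma seq_formulas_code (R : realType) (L : signature R) (F : fragment L) :
  exists f : seq_formulas F -> nat, injective f.
Proof.
have H n : exists g : formulas F n -> nat, injective g.
  have /countable_injP[g gi] := @frag_countable _ _ F n.
  exists (fun p => g (sval p)) => -[p hp] [q hq] /= pq.
  have E : p = q by apply: gi => //; exact: mem_set.
  by subst q; congr exist; exact: Prop_irrelevance.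
pose g n := sval (cid (H n)).
have gP n : injective (g n) := svalP (cid (H n)).
exists (fun z => pickle (projT1 z, g _ (projT2 z).1, codom (projT2 z).2)).
move=> [n [p u]] [m [q v]] /= /(pcan_inj pickleK)[nm]; subst m.
move=> /gP -> uv; congr existT; congr pair; apply/funext => i.
by move: uv; rewrite /codom /image_mem => /eq_in_map; apply; rewrite mem_enum.
Qed.

Lemma Gdelta_bigcap (X : topologicalType) (I : Type) (f : I -> nat)
    (V : I -> set X) : injective f -> (forall i, open (V i)) ->
  Gdelta (\bigcap_i V i).
Proof.
move=> fi Vo.
exists (fun k => [set x | forall i, f i = k -> V i x]) => [k|].
  have [[i ik]|nk] := pselect (exists i, f i = k).
    rewrite (_ : [set x | _] = V i) //; apply/seteqP; split => [x /(_ i ik)//|x Vx j].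
    by rewrite -ik => /fi ->.
  rewrite (_ : [set x | _] = setT); first exact: openT.
  by apply/seteqP; split => // x _ i ik; case: nk; exists i.
apply/seteqP; split => [x Vx k _ i _|x Vx i _]; first exact: Vx.
exact: (Vx (f i)).
Qed.

Section AtomicClass.
Context (R : realType) (L : signature R) (F : fragment L) (T : theory L).
Variable xi : Mod F T.
Local Notation M := (model_of xi).

Lemma iso_class_tight : (forall n (a : 'I_n -> M), locally_isolated F a) ->
  iso_class xi = [set eta | elementarily_equivalent F M (model_of eta) /\
    forall n (u : 'I_n -> nat) k, exists2 p : formulas F n,
      ev p (model_seq eta \o u) < 0 & tight M p (halves R k)].
Proof.
move=> Mi; apply/seteqP; split => [eta xieta|eta [Meta etaP]].
  split; first exact/elementarily_equivalent_sym/isomorphic_equivalent.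
  move=> n u k; have [h [_ hE]] := isomorphic_feval xieta.
  have [p pu tp_] := locally_isolated_tight (Mi _ (h \o (model_seq eta \o u)))
    (halves_gt0 R k).
  by exists p => //; move: pu; rewrite /ev hE.
apply/isomorphic_sym/(back_and_forth (a := model_seq xi) (b := model_seq eta) Meta).
- by move=> n u d; exact: locally_isolated_tight.
- move=> n u d d0; have [K /(_ K (leqnn K)) Kd] := halves_lt d0.
  have [p pu tp_] := etaP n u K; exists p => //.
  exact: tight_equivalent Meta tp_ Kd.
- exact: model_seq_dense.
- exact: model_seq_dense.
Qed.

Lemma iso_class_Gdelta : (forall n (a : 'I_n -> M), locally_isolated F a) ->
  Gdelta (iso_class xi).
Proof.
move=> /iso_class_tight ->.
have [f fi] := seq_formulas_code F.
(* One countable index serves both requirements: codes without variables carry the bounds on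
   sentences, and the tuples of all codes carry tightness. Upper bounds are enough, as lower bounds
   are upper bounds for opposite formulas. *)
pose V (z : seq_formulas F * nat) : set (Mod F T) :=
  [set eta | projT1 z.1 = 0%N -> val eta z.1 < val xi z.1 + z.2.+1%:R^-1] `&`
  \bigcup_(p in [set p : formulas F (projT1 z.1) | tight M p (halves R z.2)])
    [set eta | ev p (model_seq eta \o (projT2 z.1).2) < 0].
have Vo z : open (V z).
  apply: openI.
    have [z0|z0] := pselect (projT1 z.1 = 0%N); last first.
      rewrite (_ : [set eta | _] = setT); first exact: openT.
      by apply/seteqP; split => // eta _ /z0.
    have ov := ptws_open_coord z.1 (val xi z.1 + z.2.+1%:R^-1).
    apply/set_type_openP; exists [set y | y z.1 < val xi z.1 + z.2.+1%:R^-1] => //.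
    by move=> eta; split=> [/(_ z0)|? _]; [|assumption].
  by apply: bigcup_open => p _; exact: Mod_open_lt.
rewrite (_ : [set eta | _] = \bigcap_z V z).
  apply: (Gdelta_bigcap (f := fun z => pickle (f z.1, z.2))) Vo.
  by move=> [z k] [z' k'] /(pcan_inj pickleK)[/fi -> ->].
apply/seteqP; split => [eta [Meta etaP] z _|eta Veta].
  split.
    case: z => -[n [p u]] k /= n0; subst n.
    rewrite -/(seq_formula p u) !val_model_seq -!/(ev p _).
    rewrite (ord0_funE (_ \o u) (@tnil M)) (ord0_funE (_ \o u) (@tnil (model_of eta))).
    by rewrite Meta ltrDl invr_gt0.
  by have [p pu tp_] := etaP _ (projT2 z.1).2 z.2; exists p.
have le (s : formulas F 0) : ev s (@tnil (model_of eta)) <= ev s (@tnil M).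
  apply/ler_addgt0Pr => e e0; have [k /(_ k (leqnn k)) ke] := natSinv_lt e0.
  have vE (zeta : Mod F T) :
      val zeta (seq_formula s (@tnil nat)) = ev s (@tnil (model_of zeta)).
    by rewrite val_model_seq /ev; congr (feval _ _); exact: ord0_funE.
  have [/(_ erefl) H _] := Veta (seq_formula s (@tnil nat), k) I.
  have : val eta (seq_formula s (@tnil nat)) <
      val xi (seq_formula s (@tnil nat)) + k.+1%:R^-1 by exact: H.
  by rewrite !vE => /ltW/le_trans; apply; rewrite lerD2l ltW.
split=> [s|n u k].
  apply/eqP; rewrite eq_le le andbT.
  by have := le (form_opp s); rewrite !evN lerN2.
(* The tightness half of [V] reads only the arity and the tuple of the code, so a constant formula
   serves as a placeholder. *)
have [_ [p tp_ pu]] := Veta (seq_formula (form_cst F n 0) u, k) I.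
by exists p.
Qed.

End AtomicClass.

(** * Baire category *)

(** In its closure, [S] is dense and contained in each [V i]; the complement of [V i] is therefore
    closed with empty interior. *)
Lemma Gdelta_comeager (X : topologicalType) (S : set X) :
  Gdelta S -> comeager (trace (closure S) S).
Proof.
move=> [V Vo SV]; exists (fun i => trace (closure S) (~` V i)).
  move=> i; apply/seteqP; split => // x.
  have cV : closed (trace (closure S) (~` V i)).
    rewrite -openC; exists (V i); first exact: Vo.
    by apply/seteqP; split => y /=; [move=> Vy; apply|apply: contrapT].
  rewrite -((closure_id _).1 cV).
  move=> /set_type_nbhsP[W [oW Wx Wi]].
  have [y [Sy Wy]] := set_valP x _ (open_nbhs_nbhs (conj oW Wx)).
  have Cy : closure S y by exact: subset_closure.
  have Vy : V i y by have := Sy; rewrite {1}SV; exact.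
  exact: (Wi (SigSub (mem_set Cy)) Wy).
have SE y : S y <-> forall i, V i y.
  by rewrite {1}SV; split => [Vy i|Vy i _]; [exact: Vy|exact: Vy].
apply/seteqP; split => [x /= xS|x [i _ /= Vx] /SE /(_ i)//].
apply: contrapT => H; apply: xS => /=; apply/SE => i.
by apply: contrapT => Vi; apply: H; exists i.
Qed.

Lemma real_cauchy_limit (R : realType) (s : nat -> R) (c : nat) :
  (forall k l, (c <= k)%N -> (k <= l)%N -> `|s k - s l| <= halves R k) ->
  exists x, forall k, (c <= k)%N -> `|s k - x| <= halves R k.
Proof.
move=> H; have /cauchy_cvgP/cvg_ex[x sx] : cauchy (s @ \oo).
  apply/cauchyP => e /= e0; have [K KP] := halves_lt e0.
  exists (s (maxn c K)); exists (maxn c K) => // k /= ck.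
  apply: le_lt_trans (H _ _ (leq_maxl c K) ck) (KP _ (leq_maxr c K)).
exists x => k ck; apply/ler_addgt0Pr => e e0.
have /cvgrPdist_lt/(_ e e0)[K _ KP] := sx.
have := KP (maxn k K) (leq_maxr k K) => /= xs.
have := H k (maxn k K) ck (leq_maxl k K).
have := ler_distD (s (maxn k K)) (s k) x; rewrite (distrC (s (maxn k K)) x).
by lra.
Qed.

Section GenericPoint.
Context (R : realType) (I J : Type) (ci : I -> nat) (cj : J -> nat).
Hypotheses (ci_inj : injective ci) (cj_inj : injective cj).
Variables (S : set {ptws I -> R}) (W : J -> set {ptws I -> R}).
Hypotheses (Wo : forall j, open (W j))
  (Wd : forall j (V : set {ptws I -> R}), open V -> V `&` S !=set0 ->
    V `&` W j `&` S !=set0).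

Definition generic_state (q : {ptws I -> R} * set {ptws I -> R}) : Prop :=
  S q.1 /\ nbhs q.1 q.2.

Definition generic_step (k : nat) (q q' : {ptws I -> R} * set {ptws I -> R}) :
    Prop :=
  [/\ generic_state q', q'.2 `<=` q.2,
      forall j, cj j = k -> closure q'.2 `<=` W j &
      forall z i, q'.2 z -> (ci i <= k)%N -> `|q'.1 i - z i| <= halves R k].

(** Halving the radius of a basic box puts its closure inside the given neighbourhood. Only finitely
    many coordinates have a code up to [k], so all of them can be controlled at once. *)
Lemma generic_shrink k (y : {ptws I -> R}) (V : set {ptws I -> R}) : nbhs y V ->
  exists2 V', nbhs y V' & [/\ V' `<=` V, closure V' `<=` V &
    forall z i, V' z -> (ci i <= k)%N -> `|y i - z i| <= halves R k].
Proof.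
move=> /ptws_nbhs_finite[n [f [e [e0 fV]]]].
have e20 : 0 < e / 2 by lra.
pose A := [set z : {ptws I -> R} | forall j : 'I_n, `|y (f j) - z (f j)| < e / 2].
pose B := [set z : {ptws I -> R} | forall m : 'I_k.+1, forall i, ci i = m ->
  `|y i - z i| < halves R k].
exists (A `&` B).
  apply: filterI.
    exact: (@filter_forall _ _ _ (nbhs y) _
      (fun j => ptws_nbhs_coord y (f j) e20)).
  apply: (@filter_forall _ _ (fun (m : 'I_k.+1) (z : {ptws I -> R}) =>
    forall i, ci i = m -> `|y i - z i| < halves R k) (nbhs y) _) => m.
  have [[i im]|nm] := pselect (exists i, ci i = m).
    have := ptws_nbhs_coord y i (halves_gt0 R k); apply: filterS => z zi i'.
    by rewrite -im => /ci_inj ->.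
  by apply: nearW => z i im; case: nm; exists i.
split=> [z [zA _]|z zAB|z i [_ zB] ik].
- by apply: fV => j; apply: lt_trans (zA j) _; lra.
- apply: fV => j; have [z' [[/(_ j) yz' _]]] := zAB _ (ptws_nbhs_coord z (f j) e20).
  rewrite /= distrC => zz'.
  by have := ler_distD (z' (f j)) (y (f j)) (z (f j)); lra.
- exact/ltW/(zB (Ordinal (ik : (ci i < k.+1)%N))).
Qed.

Lemma generic_step_ex k q : generic_state q -> exists q', generic_step k q q'.
Proof.
move=> [Sq nq].
have [V' [oV' V'S V'W V'q]] : exists V' : set {ptws I -> R},
    [/\ open V', V' `&` S !=set0, forall j, cj j = k -> V' `<=` W j & V' `<=` q.2].
  have oq : open (interior q.2) by exact: open_interior.
  have qS : interior q.2 `&` S !=set0 by exists q.1.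
  have [[j jk]|nk] := pselect (exists j, cj j = k).
    exists (interior q.2 `&` W j); split.
    - exact: openI.
    - exact: Wd.
    - by move=> j'; rewrite -jk => /cj_inj -> z [].
    - by move=> z [/interior_subset].
  exists (interior q.2); split => //; last exact: interior_subset.
  by move=> j jk; case: nk; exists j.
have [y [V'y Sy]] := V'S.
have [V yV [VV' cV Vk]] := generic_shrink k (open_nbhs_nbhs (conj oV' V'y)).
exists (y, V); split => //=.
- exact: subset_trans VV' V'q.
- by move=> j jk; exact: subset_trans cV (V'W j jk).
Qed.

(** The centres converge in each coordinate, because later centres stay in earlier neighbourhoods
    and coordinate [i] is controlled from stage [ci i] on. The limit lies in the closure of every
    neighbourhood, hence in every [W j]; it is found in the closure of [S] and need not belong to
    [S]. *)
Lemma generic_point : S !=set0 -> exists2 x, closure S x & forall j, W j x.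
Proof.
move=> [y0 Sy0].
have /choice[g gP] (q : nat * ({ptws I -> R} * set {ptws I -> R})) :
    exists q', generic_state q.2 -> generic_step q.1 q.2 q'.
  have [/(generic_step_ex q.1)[q']|] := pselect (generic_state q.2).
    by exists q'.
  by exists q.2.
pose Q := fix Q k := if k is k'.+1 then g (k', Q k') else (y0, setT).
have Qs k : generic_state (Q k).
  elim: k => [|k /(gP (k, Q k))[]//]; split => //; exact: filterT.
have QS k : generic_step k (Q k) (Q k.+1) by exact: (gP (k, Q k)) (Qs k).
have Qle k l : (k <= l)%N -> (Q l).2 `<=` (Q k).2.
  move=> /subnK <-; elim: (l - k)%N => // m IH z; rewrite addSn.
  by have [_ + _ _] := QS (m + k)%N; move=> /[apply]/IH.
have Qin k l : (k <= l)%N -> (Q k).2 (Q l).1.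
  by move=> /Qle; apply; have [_ /nbhs_singleton] := Qs l.
have /choice[x xP] i : exists x, forall k, (ci i <= k)%N ->
    `|(Q k.+1).1 i - x| <= halves R k.
  apply: (@real_cauchy_limit R (fun k => (Q k.+1).1 i)) => k l ik kl.
  by have [_ _ _ H] := QS k; apply: H => //; exact: Qin.
have Qx (V : set {ptws I -> R}) K : nbhs (x : {ptws I -> R}) V ->
    exists2 k, (K <= k)%N & V (Q k).1.
  move=> /ptws_nbhs_finite[n [f [e [e0 fV]]]].
  have [K' K'P] := halves_lt e0.
  have [k [kK kK' kf]] : exists k, [/\ (K <= k)%N, (K' <= k)%N &
      forall j, (ci (f j) <= k)%N].
    exists (maxn (maxn K K') (\max_(j < n) ci (f j))); split.
    - by rewrite !leq_max leqnn.
    - by rewrite !leq_max leqnn orbT.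
    - by move=> j; rewrite leq_max (leq_bigmax j) orbT.
  exists k.+1; first exact: leq_trans kK (leqnSn k).
  apply: fV => j; rewrite distrC; apply: le_lt_trans (xP _ _ (kf j)) _.
  exact: K'P.
exists x => [V /(Qx V 0%N)[k _ Vk]|j].
  by exists (Q k).1; split => //; case: (Qs k).
have [_ _ /(_ j erefl) + _] := QS (cj j); apply.
move=> V /(Qx V (cj j).+1)[k jk Vk]; exists (Q k).1; split => //.
exact: Qin.
Qed.

End GenericPoint.

(** * Completion of a distance on the natural numbers *)

Record pseudodist (R : realType) := Pseudodist {
  pdist :> nat -> nat -> R ;
  pdistxx : forall i, pdist i i = 0 ;
  pdist_sym : forall i j, pdist i j = pdist j i ;
  pdist_triangle : forall j i k, pdist i k <= pdist i j + pdist j k }.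

(* Kuratowski's embedding represents [j] by its distance function; the points
   of the completion are the uniform limits of these functions. *)
Definition completion (R : realType) (p : pseudodist R) : Type :=
  {g : nat -> R | forall e : R, 0 < e -> exists j, forall k, `|g k - p k j| <= e}.

HB.instance Definition _ (R : realType) (p : pseudodist R) :=
  gen_eqMixin (completion p).
HB.instance Definition _ (R : realType) (p : pseudodist R) :=
  gen_choiceMixin (completion p).

Section Completion.
Context (R : realType) (p : pseudodist R).
Implicit Types g h : completion p.

Lemma pdist_ge0 i j : 0 <= p i j.
Proof.
by have := pdist_triangle p j i i; rewrite pdistxx (pdist_sym p j i); lra.
Qed.

Lemma pdist_dist i j k : `|p k i - p k j| <= p i j.
Proof.
have := pdist_triangle p j k i; have := pdist_triangle p i k j.
by rewrite (pdist_sym p j i) ler_norml => ? ?; apply/andP; split; lra.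
Qed.

Definition cdist g h : R := sup [set `|sval g k - sval h k| | k in [set: nat]].

Lemma cdist_ubound g h : has_ubound [set `|sval g k - sval h k| | k in [set: nat]].
Proof.
have [i gi] := svalP g _ ltr01; have [j hj] := svalP h _ ltr01.
exists (1 + p i j + 1) => _ [k _ <-].
have := gi k; have := hj k; have := pdist_dist i j k.
have := ler_distD (p k i) (sval g k) (sval h k).
have := ler_distD (p k j) (p k i) (sval h k).
by rewrite (distrC (p k j)); lra.
Qed.

Lemma le_cdist g h k : `|sval g k - sval h k| <= cdist g h.
Proof. by apply: ub_le_sup; [exact: cdist_ubound|exists k]. Qed.

Lemma cdist_le g h (e : R) : (forall k, `|sval g k - sval h k| <= e) -> cdist g h <= e.
Proof.
by move=> H; apply: ge_sup => [|_ [k _ <-]]; [exists `|sval g 0 - sval h 0|, 0%N|].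
Qed.

Lemma cdistxx g : cdist g g = 0.
Proof.
apply/eqP; rewrite eq_le; apply/andP; split.
  by apply: cdist_le => k; rewrite subrr normr0.
by apply: le_trans (le_cdist g g 0); rewrite normr_ge0.
Qed.

Lemma cdist_positivity g h : cdist g h = 0 -> g = h.
Proof.
move=> gh; have E : sval g = sval h.
  apply/funext => k; apply/eqP; rewrite -subr_eq0 -normr_le0.
  by apply: le_trans (le_cdist g h k) _; rewrite gh.
by case: g h E {gh} => [g gP] [h hP] /= E; subst h; congr exist; exact: Prop_irrelevance.
Qed.

Lemma cdist_sym g h : cdist g h = cdist h g.
Proof. by congr sup; apply: eq_imagel => k _; rewrite distrC. Qed.

Lemma cdist_triangle h g f : cdist g f <= cdist g h + cdist h f.
Proof.
apply: cdist_le => k; apply: le_trans (ler_distD (sval h k) _ _) _.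
by apply: lerD; exact: le_cdist.
Qed.

HB.instance Definition _ := @isMetric.Build R (completion p) cdist cdistxx
  cdist_positivity cdist_sym cdist_triangle.

Lemma mdist_cdist g h : mdist g h = cdist g h. Proof. by []. Qed.

(** The limit is taken coordinatewise; the Cauchy condition makes the convergence uniform, so the
    limit is again approximated by distance functions. *)
Lemma completion_complete : complete_space (completion p).
Proof.
move=> G GF Gc.
have Gex e : 0 < e -> exists g : completion p, G [set h | mdist g h < e].
  by move/cauchyP: Gc => /[apply] -[g]; rewrite ballEmdist; exists g.
have lP k : exists l : R, (fun h : completion p => sval h k) @ G --> l.
  apply/cvg_ex/cauchy_cvgP/cauchyP => e /= e0; have [g Gg] := Gex e e0.
  exists (sval g k); apply: filterS Gg => h /= gh.
  exact: le_lt_trans (le_cdist g h k) gh.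
have /choice[l {}lP] := lP.
have gl g e : 0 < e -> G [set h | mdist g h < e] -> forall k, `|sval g k - l k| <= e.
  move=> e0 Gg k; apply/ler_addgt0Pr => d d0.
  have /cvgrPdist_lt/(_ d d0) := lP k => ld.
  have [h [/= gh lh]] := @filter_ex _ _ GF _ (filterI Gg ld).
  have := le_cdist g h k; rewrite -mdist_cdist.
  have := ler_distD (sval h k) (sval g k) (l k).
  by rewrite (distrC (sval h k)); lra.
have lK e : 0 < e -> exists j, forall k, `|l k - p k j| <= e.
  move=> e0; have e20 : 0 < e / 2 by lra.
  have [g Gg] := Gex _ e20; have [j gj] := svalP g _ e20.
  exists j => k; have := gj k; have := gl g _ e20 Gg k.
  have := ler_distD (sval g k) (l k) (p k j).
  by rewrite (distrC (l k) (sval g k)); lra.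
exists (exist _ l lK : completion p) => B /nbhs_ballP[e /= e0 lB].
have e40 : 0 < e / 4 by lra.
have [g Gg] := Gex _ e40; apply: filterS (Gg) => h /= gh; apply: lB.
rewrite ballEmdist /=.
have := metric_triangle (exist _ l lK : completion p) g h.
have : mdist (exist _ l lK : completion p) g <= e / 4.
  by rewrite metric_sym; apply: cdist_le => k; exact: (gl g _ e40 Gg k).
by lra.
Qed.

Lemma pdist_point j : forall e : R, 0 < e ->
  exists i, forall k, `|(fun k => p k j) k - p k i| <= e.
Proof. by move=> e e0; exists j => k; rewrite subrr normr0 ltW. Qed.

Definition kpoint (j : nat) : completion p := exist _ _ (pdist_point j).

Lemma completion_ge0 g k : 0 <= sval g k.
Proof.
apply/ler_addgt0Pr => e e0; have [j /(_ k)] := svalP g _ e0.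
by rewrite ler_norml => /andP[? _]; have := pdist_ge0 k j; lra.
Qed.

(** As a uniform limit of distance functions, [g] satisfies [|g k - p k j| <= g j] for all [k], and
    [k = j] gives the other bound. A point is thus the list of its distances to the sequence. *)
Lemma mdist_kpoint g j : mdist g (kpoint j) = sval g j.
Proof.
apply/eqP; rewrite eq_le; apply/andP; split; last first.
  by have := le_cdist g (kpoint j) j; rewrite /= pdistxx subr0 ger0_norm ?completion_ge0.
apply: cdist_le => k /=; apply/ler_addgt0Pr => e e0.
have e20 : 0 < e / 2 by lra.
have [i gi] := svalP g _ e20.
have /andP[gj _] : - (e / 2) <= sval g j - p j i <= e / 2 by rewrite -ler_norml.
have := gi k; have := pdist_dist i j k.
have := ler_distD (p k i) (sval g k) (p k j).
by rewrite (pdist_sym p i j); lra.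
Qed.

Lemma kpoint_dense : dense_seq kpoint.
Proof.
move=> g e e0; have e20 : 0 < e / 2 by lra.
have [j gj] := svalP g _ e20; exists j; rewrite mdist_kpoint.
by have := gj j; rewrite pdistxx subr0 ger0_norm ?completion_ge0 //; lra.
Qed.

Lemma mdist_kpoint2 i j : mdist (kpoint i) (kpoint j) = p i j.
Proof. by rewrite mdist_kpoint /= pdist_sym. Qed.

Lemma completion_neq0 : [set: completion p] !=set0.
Proof. by exists (kpoint 0). Qed.

End Completion.

(** * Extension of maps from a dense sequence *)

Section McShane.
Context (R : realType) (X : metricType R) (s : nat -> X) (sd : dense_seq s).
Variables (n : nat) (D : modulus R) (h : ('I_n -> nat) -> R).
Hypothesis hD : forall u v, `|h u - h v| <= D (tdist (s \o u) (s \o v)).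

(** McShane's extension by infimal convolution. It preserves the modulus [D] exactly, as the
    interpretation of a symbol must. The map [h] lives on indices; its bound [hD] makes it depend
    only on the points they name. *)
Definition mcshane (g : 'I_n -> X) : R :=
  inf [set h u + D (tdist g (s \o u)) | u in [set: 'I_n -> nat]].

Lemma modulus_tdist (f g k : 'I_n -> X) :
  D (tdist f k) <= D (tdist f g) + D (tdist g k).
Proof.
apply: le_trans (modulus_le D (tdist_ge0 _ _) (tdist_triangle g f k)) _.
by apply: modulus_subadditive; exact: tdist_ge0.
Qed.

Lemma mcshane_lower g u : lbound
  [set h u + D (tdist g (s \o u)) | u in [set: 'I_n -> nat]]
  (h u - D (tdist g (s \o u))).
Proof.
move=> _ [v _ <-]; have := hD u v; have := modulus_tdist (s \o u) g (s \o v).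
by rewrite (tdist_sym (s \o u) g) ler_norml => ? /andP[? ?]; lra.
Qed.

Lemma mcshane_near g u : `|mcshane g - h u| <= D (tdist g (s \o u)).
Proof.
have : h u - D (tdist g (s \o u)) <= mcshane g.
  apply: lb_le_inf; last exact: mcshane_lower.
  by exists (h u + D (tdist g (s \o u))), u.
have : mcshane g <= h u + D (tdist g (s \o u)).
  by apply: ge_inf; [exists (h u - D (tdist g (s \o u))); exact: mcshane_lower|exists u].
by rewrite ler_norml => ? ?; apply/andP; split; lra.
Qed.

Lemma mcshane_mod g g' : `|mcshane g - mcshane g'| <= D (tdist g g').
Proof.
apply: dist_inf_le => [|||u _].
- by exists (fun=> 0%N).
- by exists (h (fun=> 0%N) - D (tdist g (s \o fun=> 0%N))); exact: mcshane_lower.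
- by exists (h (fun=> 0%N) - D (tdist g' (s \o fun=> 0%N))); exact: mcshane_lower.
- rewrite opprD addrACA subrr add0r ler_norml.
  have := modulus_tdist g g' (s \o u); have := modulus_tdist g' g (s \o u).
  by rewrite (tdist_sym g' g) => ? ?; apply/andP; split; lra.
Qed.

Lemma mcshane_approx (g : 'I_n -> X) (e : R) : 0 < e ->
  exists2 d : R, 0 < d & forall u, tdist g (s \o u) < d -> `|mcshane g - h u| < e.
Proof.
move=> e0; have [d d0 Dd] := modulus_small D e0; exists d => // u gu.
exact: le_lt_trans (mcshane_near g u) (Dd _ (tdist_ge0 _ _) (ltW gu)).
Qed.

End McShane.

(** * Limits of types *)

Section ContinuousOperations.
Context (R : realType) (X : topologicalType) (f g : X -> R).
Hypotheses (fc : continuous f) (gc : continuous g).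

Lemma continuous_add : continuous (fun y => f y + g y).
Proof. by move=> y; apply: cvgD; [exact: fc|exact: gc]. Qed.

Lemma continuous_opp : continuous (fun y => - f y).
Proof. by move=> y; apply: cvgN; exact: fc. Qed.

Lemma continuous_dist : continuous (fun y => `|f y - g y|).
Proof. by move=> y; apply: cvg_norm; apply: cvgB; [exact: fc|exact: gc]. Qed.

Lemma continuous_scale (r : R) : continuous (fun y => r * f y).
Proof. by move=> y; apply: cvgM; [exact: cvg_cst|exact: fc]. Qed.

Lemma continuous_maximum : continuous (fun y => Num.max (f y) (g y)).
Proof. by move=> y; apply: continuous_max; [exact: fc|exact: gc]. Qed.

Lemma continuous_minimum : continuous (fun y => Num.min (f y) (g y)).
Proof. by move=> y; apply: continuous_min; [exact: fc|exact: gc]. Qed.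

End ContinuousOperations.

Section ClosedConditions.
Context (R : realType) (I : Type) (S : set {ptws I -> R}) (x : {ptws I -> R}).
Hypothesis Sx : closure S x.
Implicit Types g h : {ptws I -> R} -> R.

Lemma ptws_coord_continuous i : continuous (fun y : {ptws I -> R} => y i).
Proof.
move=> y; have H := @cvgrPdist_lt R R _ (nbhs y) _ (fun y : {ptws I -> R} => y i) (y i).
by apply/H => e; exact: ptws_nbhs_coord.
Qed.

Lemma closure_le g h : continuous g -> continuous h ->
  (forall y, S y -> g y <= h y) -> g x <= h x.
Proof.
move=> gc hc gh; apply/ler_addgt0Pr => e e0; have e20 : 0 < e / 2 by lra.
have /cvgrPdist_lt/(_ _ e20) gx := gc x; have /cvgrPdist_lt/(_ _ e20) hx := hc x.
have [y [Sy [/= gxy hxy]]] := Sx (filterI gx hx).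
have := gh y Sy; move: gxy hxy; rewrite !ltr_norml => /andP[? ?] /andP[? ?].
by lra.
Qed.

Lemma closure_eq g h : continuous g -> continuous h ->
  (forall y, S y -> g y = h y) -> g x = h x.
Proof.
move=> gc hc gh; apply/eqP; rewrite eq_le.
by apply/andP; split; apply: closure_le => // y /gh ->.
Qed.

Lemma closure_coord i j : (forall y, S y -> y i = y j) -> x i = x j.
Proof. exact: closure_eq (@ptws_coord_continuous i) (@ptws_coord_continuous j). Qed.

Lemma closure_coord_cst i (r : R) : (forall y, S y -> y i = r) -> x i = r.
Proof.
apply: (@closure_eq (fun y => y i) (fun=> r)) => //; first exact: ptws_coord_continuous.
by move=> y; exact: cst_continuous.
Qed.

(** The premise is strict and concerns finitely many coordinates, so it persists at nearby points of
    [S]; the conclusion is closed and returns to [x]. *)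
Lemma closure_conditional k (c : 'I_k -> I) (i j : I) (d K : R) :
  (forall y, S y -> (forall m, y (c m) < d) -> `|y i - y j| <= K) ->
  (forall m, x (c m) < d) -> `|x i - x j| <= K.
Proof.
move=> H cd; apply/ler_addgt0Pr => e e0; have e20 : 0 < e / 2 by lra.
have cn : nbhs x [set y : {ptws I -> R} | forall m, y (c m) < d].
  apply: (@filter_forall _ _ (fun m (y : {ptws I -> R}) => y (c m) < d) (nbhs x) _).
  move=> m; exact: (open_nbhs_nbhs (conj (ptws_open_coord (c m) d) (cd m))).
have [y [Sy [yc [/= yi yj]]]] := Sx (filterI cn
  (filterI (ptws_nbhs_coord x i e20) (ptws_nbhs_coord x j e20))).
have := H y Sy yc; have := ler_distD (y i) (x i) (x j).
by have := ler_distD (y j) (y i) (x j); rewrite (distrC (y j)); lra.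
Qed.

End ClosedConditions.

(** Subadditivity and smallness at 0 make [D] continuous from the right. This converts bounds
    obtained under a strict premise, as in [closure_conditional], into a bound at the distance
    itself. *)
Lemma modulus_right_limit (R : realType) (D : modulus R) (r A : R) : 0 <= r ->
  (forall d, r < d -> A <= D d) -> A <= D r.
Proof.
move=> r0 H; apply/ler_addgt0Pr => e e0; have [d d0 Dd] := modulus_small D e0.
apply: le_trans (H (r + d) _) _; first by rewrite ltrDl.
apply: le_trans (modulus_subadditive D r0 (ltW d0)) _.
by rewrite lerD2l; apply: ltW; apply: Dd => //; exact: ltW.
Qed.

Lemma completion_ext (R : realType) (p : pseudodist R) (g h : completion p) :
  (forall k, sval g k = sval h k) -> g = h.
Proof.
move=> gh; apply: cdist_positivity; apply/eqP; rewrite eq_le; apply/andP; split.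
  by apply: cdist_le => k; rewrite gh subrr normr0.
by apply: le_trans (le_cdist g h 0); rewrite normr_ge0.
Qed.

(** * The structure coded by a limit of types *)

Section LimitModel.
Context (R : realType) (L : signature R) (F : fragment L) (T : theory L).
Variable x : {ptws seq_formulas F -> R}.
Hypothesis hT : fragment_theory F T.
Hypothesis xcl : closure
  [set y | exists (M : structure L) (a : nat -> M), models M T /\ y = seq_tp F a] x.
Hypothesis xw : witnessed x.

Local Notation term := (term L).

Definition tlift n (t : term n) : term n.+1 :=
  tsubst (fun j => tvar (lift ord0 j)) t.

Definition dist_tuple n (t : term n) : 'I_(parity (@dist_sym R L)) -> term n.+1 :=
  dist_pair (tvar ord0) (tlift t).

(* The code of the formula [d(x_k, t(x_u))]. *)
Definition dist_code n (t : term n) (u : 'I_n -> nat) (k : nat) : seq_formulas F :=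
  seq_formula (form_atom F (dist_tuple t)) (scons k u).

Definition pred_code n (P : pred_sym L) (t : 'I_(parity P) -> term n)
    (u : 'I_n -> nat) : seq_formulas F :=
  seq_formula (form_atom F t) u.

Lemma feval_dist_tuple (M : structure L) n (t : term n) (y : M) (c : 'I_n -> M) :
  feval (fatom dist_sym (dist_tuple t)) (scons y c) = mdist y (teval c t).
Proof.
rewrite -pinterp_dist /=; congr pinterp; apply/funext => i.
rewrite /dist_tuple /dist_pair; case: ifP => _ /=; first by rewrite scons0.
rewrite /tlift teval_tsubst; congr teval; apply/funext => j /=.
by rewrite scons_lift.
Qed.

Lemma seq_tp_dist_code (M : structure L) (a : nat -> M) n (t : term n) u k :
  seq_tp F a (dist_code t u k) = mdist (a k) (teval (a \o u) t).
Proof. by rewrite -feval_dist_tuple -comp_scons. Qed.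

Lemma seq_tp_pred_code (M : structure L) (a : nat -> M) n P t (u : 'I_n -> nat) :
  seq_tp F a (@pred_code n P t u) = pinterp M P (fun i => teval (a \o u) (t i)).
Proof. by []. Qed.

Definition limit_rho (i j : nat) : R :=
  x (dist_code (tvar ord0 : term 1) (fun=> j) i).

Lemma limit_rhoxx i : limit_rho i i = 0.
Proof.
apply: (closure_coord_cst xcl).
by move=> _ [M [a [_ ->]]]; rewrite seq_tp_dist_code mdistxx.
Qed.

Lemma limit_rho_sym i j : limit_rho i j = limit_rho j i.
Proof.
apply: (closure_coord xcl).
by move=> _ [M [a [_ ->]]]; rewrite !seq_tp_dist_code metric_sym.
Qed.

Lemma limit_rho_triangle j i k : limit_rho i k <= limit_rho i j + limit_rho j k.
Proof.
apply: (closure_le xcl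
  (g := fun y : {ptws _ -> R} => y (dist_code (tvar ord0 : term 1) (fun=> k) i))
  (h := fun y : {ptws _ -> R} =>
    y (dist_code (tvar ord0 : term 1) (fun=> j) i) +
    y (dist_code (tvar ord0 : term 1) (fun=> k) j))).
- exact: ptws_coord_continuous.
- by apply: continuous_add; exact: ptws_coord_continuous.
by move=> _ [M [a [_ ->]]]; rewrite !seq_tp_dist_code metric_triangle.
Qed.

Definition limit_dist : pseudodist R :=
  Pseudodist limit_rhoxx limit_rho_sym limit_rho_triangle.

Lemma dist_code_rho n (t : term n) (u : 'I_n -> nat) k j :
  `|x (dist_code t u k) - limit_rho k j| <= x (dist_code t u j).
Proof.
apply: (closure_le xcl (g := fun y : {ptws _ -> R} => `|y (dist_code t u k) -
    y (dist_code (tvar ord0 : term 1) (fun=> j) k)|)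
  (h := fun y : {ptws _ -> R} => y (dist_code t u j))).
- by apply: continuous_dist; exact: ptws_coord_continuous.
- exact: ptws_coord_continuous.
move=> _ [M [a [_ ->]]]; rewrite !seq_tp_dist_code /=.
have := metric_triangle (a k) (a j) (teval (a \o u) t).
have := metric_triangle (a k) (teval (a \o u) t) (a j).
rewrite (metric_sym (teval _ _) (a j)) ler_norml => ? ?.
by apply/andP; split; lra.
Qed.

(** The infimum over [y] of the distance from [y] to [t] is 0 in every structure, a condition on one
    coordinate that passes to [x]; the witness property then names an index. *)
Lemma dist_code_witness n (t : term n) (u : 'I_n -> nat) (e : R) : 0 < e ->
  exists j, x (dist_code t u j) < e.
Proof.
move=> e0; pose hp := frag_atom F (dist_tuple t).
have E : value x (finf (fatom dist_sym (dist_tuple t))) (frag_inf hp) u = 0.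
  apply: (closure_coord_cst xcl).
  move=> _ [M [a [_ ->]]]; rewrite /seq_tp /= /cst.
  rewrite (_ : [set _ | _ in _] =
      [set mdist y (teval (a \o u) t) | y in [set: M]]); last first.
    by apply: eq_imagel => y _; rewrite -feval_dist_tuple.
  apply/eqP; rewrite eq_le; apply/andP; split.
    apply: ge_inf; first by exists 0 => _ [y _ <-]; exact: mdist_ge0.
    by exists (teval (a \o u) t) => //; rewrite mdistxx.
  apply: lb_le_inf; last by move=> _ [y _ <-]; exact: mdist_ge0.
  by exists (mdist (a 0) (teval (a \o u) t)), (a 0).
move: e0; rewrite -E (witnessed_inf xw hp) => /inf_lt[|_ [j _ <-] je].
  by exists (value x _ hp (scons 0%N u)), 0%N.
by exists j.
Qed.

Local Notation N := (completion limit_dist).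

Lemma term_point_subproof n (t : term n) (u : 'I_n -> nat) (e : R) : 0 < e ->
  exists j, forall k, `|x (dist_code t u k) - limit_dist k j| <= e.
Proof.
move=> /(dist_code_witness t u)[j je]; exists j => k.
exact: le_trans (dist_code_rho t u k j) (ltW je).
Qed.

(** The value of [t] at the indices [u], given by its distances to the sequence. It is available
    before any function symbol is interpreted. *)
Definition term_point n (t : term n) (u : 'I_n -> nat) : N :=
  exist _ _ (term_point_subproof t u).

Lemma term_point_var n (i : 'I_n) (u : 'I_n -> nat) :
  term_point (tvar i) u = kpoint limit_dist (u i).
Proof.
apply: completion_ext => k.
apply: (closure_coord xcl).
by move=> _ [M [a [_ ->]]]; rewrite !seq_tp_dist_code.
Qed.

Lemma mdist_term_point n (t : term n) (u : 'I_n -> nat) j :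
  mdist (term_point t u) (kpoint limit_dist j) = x (dist_code t u j).
Proof. exact: mdist_kpoint. Qed.

(** Modulus bounds on types of sequences pass to [x] under the strict premise that the arguments are
    closer than [d]; then [d] decreases to their distance. *)
Lemma term_point_mod n (f : fun_sym L) (ts : 'I_(farity f) -> term n)
    (u : 'I_n -> nat) (v : 'I_(farity f) -> nat) k :
  `|x (dist_code (tapp ts) u k) - x (dist_code (tapp (f := f) tvar) v k)| <=
  fmod f (tdist (fun i => term_point (ts i) u) (kpoint limit_dist \o v)).
Proof.
apply: modulus_right_limit => [|d rd]; first exact: tdist_ge0.
have d0 : 0 < d by apply: le_lt_trans rd; exact: tdist_ge0.
apply: (closure_conditional xcl (c := fun i => dist_code (ts i) u (v i)) (d := d)).
  move=> _ [M [a [_ ->]]] H; rewrite !seq_tp_dist_code /=.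
  have ab : tdist (fun i => teval (a \o u) (ts i)) (a \o v) <= d.
    apply: tdist_le => [|i]; first exact: ltW.
    by have := H i; rewrite seq_tp_dist_code metric_sym => /ltW.
  apply: le_trans (modulus_le (fmod f) (tdist_ge0 _ _) ab).
  apply: le_trans (finterp_mod _ _).
  set y := finterp M f _; set z := finterp M f _.
  have := metric_triangle (a k) y z; have := metric_triangle (a k) z y.
  by rewrite (metric_sym z y) ler_norml => ? ?; apply/andP; split; lra.
by move=> i; rewrite -mdist_term_point; apply: le_lt_trans rd; exact: le_tdist.
Qed.

Lemma pred_code_mod n (P : pred_sym L) (ts : 'I_(parity P) -> term n)
    (u : 'I_n -> nat) (v : 'I_(parity P) -> nat) :
  `|x (pred_code ts u) - x (pred_code (P := P) tvar v)| <=
  pmod P (tdist (fun i => term_point (ts i) u) (kpoint limit_dist \o v)).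
Proof.
apply: modulus_right_limit => [|d rd]; first exact: tdist_ge0.
have d0 : 0 < d by apply: le_lt_trans rd; exact: tdist_ge0.
apply: (closure_conditional xcl (c := fun i => dist_code (ts i) u (v i)) (d := d)).
  move=> _ [M [a [_ ->]]] H; rewrite !seq_tp_pred_code /=.
  have ab : tdist (fun i => teval (a \o u) (ts i)) (a \o v) <= d.
    apply: tdist_le => [|i]; first exact: ltW.
    by have := H i; rewrite seq_tp_dist_code metric_sym => /ltW.
  apply: le_trans (modulus_le (pmod P) (tdist_ge0 _ _) ab).
  exact: pinterp_mod.
by move=> i; rewrite -mdist_term_point; apply: le_lt_trans rd; exact: le_tdist.
Qed.

Lemma term_point_vars n (u : 'I_n -> nat) :
  (fun i => term_point (tvar i) u) = kpoint limit_dist \o u.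
Proof. by apply/funext => i; rewrite term_point_var. Qed.

Section FunctionInterpretation.
Variable f : fun_sym L.

(** The distance from the value of [f] at [g] to the point [k] of the sequence: each coordinate is
    extended separately from index tuples to tuples of the completion. *)
Definition limit_fun_coord (g : 'I_(farity f) -> N) (k : nat) : R :=
  mcshane (kpoint limit_dist) (fmod f)
    (fun u => x (dist_code (tapp (f := f) tvar) u k)) g.

Lemma limit_fun_near g k u :
  `|limit_fun_coord g k - x (dist_code (tapp (f := f) tvar) u k)| <=
  fmod f (tdist g (kpoint limit_dist \o u)).
Proof.
apply: (@mcshane_near _ _ _ _ _ (fun u => x (dist_code (tapp (f := f) tvar) u k))).
by move=> v w; have := term_point_mod (f := f) tvar v w k; rewrite term_point_vars.
Qed.

Lemma limit_fun_subproof g (e : R) : 0 < e ->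
  exists j, forall k, `|limit_fun_coord g k - limit_dist k j| <= e.
Proof.
move=> e0; have e20 : 0 < e / 2 by lra.
have [d d0 Dd] := modulus_small (fmod f) e20.
have [u gu] := dense_seq_tuple g (@kpoint_dense _ limit_dist) d0.
have [j jP] := svalP (term_point (tapp (f := f) tvar) u) _ e20.
exists j => k; have := jP k; have := limit_fun_near g k u.
have := Dd _ (tdist_ge0 _ _) (ltW gu).
have := ler_distD (x (dist_code (tapp (f := f) tvar) u k))
  (limit_fun_coord g k) (limit_dist k j).
by rewrite /term_point /=; lra.
Qed.

Definition limit_fun (g : 'I_(farity f) -> N) : N :=
  exist _ _ (limit_fun_subproof g).

Lemma limit_fun_mod g g' : mdist (limit_fun g) (limit_fun g') <= fmod f (tdist g g').
Proof.
apply: cdist_le => k; apply: mcshane_mod => v w.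
by have := term_point_mod (f := f) tvar v w k; rewrite term_point_vars.
Qed.

End FunctionInterpretation.

Section PredicateInterpretation.
Variable P : pred_sym L.

Definition limit_pred (g : 'I_(parity P) -> N) : R :=
  mcshane (kpoint limit_dist) (pmod P) (fun u => x (pred_code (P := P) tvar u)) g.

Lemma pred_code_vars_mod (v w : 'I_(parity P) -> nat) :
  `|x (pred_code (P := P) tvar v) - x (pred_code (P := P) tvar w)| <=
  pmod P (tdist (kpoint limit_dist \o v) (kpoint limit_dist \o w)).
Proof. by have := pred_code_mod (P := P) tvar v w; rewrite term_point_vars. Qed.

Lemma limit_pred_mod g g' :
  `|limit_pred g - limit_pred g'| <= pmod P (tdist g g').
Proof. apply: mcshane_mod; exact: pred_code_vars_mod. Qed.

Lemma limit_pred_approx g (e : R) : 0 < e ->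
  exists2 d : R, 0 < d & forall u, tdist g (kpoint limit_dist \o u) < d ->
    `|limit_pred g - x (pred_code (P := P) tvar u)| < e.
Proof. apply: mcshane_approx; exact: pred_code_vars_mod. Qed.

Lemma limit_pred_bound g : plow P <= limit_pred g <= phigh P.
Proof.
have H u : plow P <= x (pred_code (P := P) tvar u) <= phigh P.
  apply/andP; split.
    apply: (closure_le xcl (g := fun=> plow P)
      (h := fun y : {ptws _ -> R} => y (pred_code (P := P) tvar u))).
    - by move=> ?; exact: cst_continuous.
    - exact: ptws_coord_continuous.
    by move=> _ [M [a [_ ->]]]; case/andP: (pinterp_bound (s := M) (fun i => a (u i))).
  apply: (closure_le xcl (h := fun=> phigh P)
    (g := fun y : {ptws _ -> R} => y (pred_code (P := P) tvar u))).
  - exact: ptws_coord_continuous.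
  - by move=> ?; exact: cst_continuous.
  by move=> _ [M [a [_ ->]]]; case/andP: (pinterp_bound (s := M) (fun i => a (u i))).
have He e : 0 < e -> plow P - e <= limit_pred g <= phigh P + e.
  move=> e0; have [d d0 dP] := limit_pred_approx g e0.
  have [u /dP] := dense_seq_tuple g (@kpoint_dense _ limit_dist) d0.
  have /andP[? ?] := H u; rewrite ltr_norml => /andP[? ?].
  by apply/andP; split; lra.
apply/andP; split; apply/ler_addgt0Pr => e /He/andP[]; lra.
Qed.

End PredicateInterpretation.

Lemma limit_pred_dist (g h : N) : limit_pred (dist_pair (L := L) g h) = mdist g h.
Proof.
apply/eqP; rewrite -subr_eq0 -normr_le0; apply/ler_addgt0Pr => e e0.
rewrite add0r; have e40 : 0 < e / 4 by lra.
have [d d0 dP] := limit_pred_approx (dist_pair (L := L) g h) e40.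
have de0 : 0 < Num.min d (e / 4) by rewrite lt_min d0.
have [i gi] := @kpoint_dense _ limit_dist g _ de0.
have [j hj] := @kpoint_dense _ limit_dist h _ de0.
move: gi hj; rewrite !lt_min => /andP[gid gie] /andP[hjd hje].
have E : x (pred_code (P := dist_sym) tvar (dist_pair (L := L) i j)) =
    mdist (kpoint limit_dist i) (kpoint limit_dist j).
  rewrite mdist_kpoint2.
  apply: (closure_coord xcl).
  move=> _ [M [a [_ ->]]]; rewrite seq_tp_dist_code seq_tp_pred_code -pinterp_dist.
  by congr pinterp; apply/funext => k; rewrite /= /dist_pair; case: ifP.
have /dP : tdist (dist_pair (L := L) g h)
    (kpoint limit_dist \o dist_pair (L := L) i j) < d.
  by apply/tdist_ltP => // k; rewrite /= /dist_pair; case: ifP.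
rewrite E ltr_norml => /andP[? ?].
set gi := kpoint limit_dist i in gid gie *; set hj := kpoint limit_dist j in hjd hje *.
have := metric_triangle g gi h; have := metric_triangle gi hj h.
have := metric_triangle gi g hj; have := metric_triangle g h hj.
rewrite (metric_sym gi g) (metric_sym hj h) => ? ? ? ?.
by rewrite ler_norml; apply/andP; split; lra.
Qed.

Definition limit_model : structure L :=
  {| carrier := N : metricType R ;
     carrier_neq0 := completion_neq0 limit_dist ;
     carrier_complete := @completion_complete _ limit_dist ;
     finterp := limit_fun ;
     finterp_mod := limit_fun_mod ;
     pinterp := limit_pred ;
     pinterp_mod := limit_pred_mod ;
     pinterp_bound := limit_pred_bound ;
     pinterp_dist := limit_pred_dist |}.

Definition limit_seq : nat -> limit_model := kpoint limit_dist.

Lemma limit_seq_dense : dense_seq limit_seq.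
Proof. exact: kpoint_dense. Qed.

(** Both the extended interpretation and the coded value of the compound term are compared with the
    code of [f] applied to variables, at indices [v] whose points approximate the arguments. *)
Lemma teval_limit n (t : term n) (u : 'I_n -> nat) :
  teval (limit_seq \o u) t = term_point t u.
Proof.
elim: t => [i|f ts IH] /=; first by rewrite term_point_var.
rewrite (_ : (fun i => _) = (fun i => term_point (ts i) u)); last exact/funext.
apply: completion_ext => k; apply/eqP; rewrite -subr_eq0 -normr_le0.
apply/ler_addgt0Pr => e e0; rewrite add0r; have e20 : 0 < e / 2 by lra.
have [d d0 Dd] := modulus_small (fmod f) e20.
set g := fun i => term_point (ts i) u.
have [v gv] := dense_seq_tuple g (@kpoint_dense _ limit_dist) d0.
have := Dd _ (tdist_ge0 _ _) (ltW gv).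
have := limit_fun_near g k v; have := term_point_mod ts u v k.
have := ler_distD (x (dist_code (tapp (f := f) tvar) v k))
  (limit_fun_coord g k) (x (dist_code (tapp ts) u k)).
rewrite (distrC (x (dist_code (tapp (f := f) tvar) v k))) -/g.
by rewrite /limit_fun /=; lra.
Qed.

Lemma limit_atom n (P : pred_sym L) (ts : 'I_(parity P) -> term n) u :
  feval (fatom P ts) (limit_seq \o u) = x (pred_code ts u).
Proof.
rewrite /= (_ : (fun i => _) = (fun i => term_point (ts i) u)); last first.
  by apply/funext => i; exact: teval_limit.
set g := fun i => term_point (ts i) u.
apply/eqP; rewrite -subr_eq0 -normr_le0.
apply/ler_addgt0Pr => e e0; rewrite add0r; have e20 : 0 < e / 2 by lra.
have [d d0 Dd] := modulus_small (pmod P) e20.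
have [d' d'0 dP] := limit_pred_approx g e20.
have dd0 : 0 < Num.min d d' by rewrite lt_min d0.
have [v] := dense_seq_tuple g (@kpoint_dense _ limit_dist) dd0.
rewrite lt_min => /andP[gv /dP gv'].
have := Dd _ (tdist_ge0 _ _) (ltW gv).
have := pred_code_mod ts u v.
have := ler_distD (x (pred_code (P := P) tvar v)) (limit_pred g) (x (pred_code ts u)).
by rewrite (distrC (x (pred_code (P := P) tvar v))) -/g; lra.
Qed.

Lemma limit_coherent : coherent x.
Proof.
have cc i := @ptws_coord_continuous R (seq_formulas F) i.
have ct (M : structure L) (a : nat -> M) := coherent_seq_tp F a.
split.
- move=> n h u; apply: (closure_coord_cst xcl).
  by move=> _ [M [a [_ ->]]]; exact: (coherent_one (ct M a) h u).
- move=> n p q hp hq h u.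
  apply: (closure_eq xcl (g := fun y => y (seq_formula (exist _ _ h) u))
    (cc _) (continuous_add (cc _) (cc _))).
  by move=> _ [M [a [_ ->]]]; exact: (coherent_add (ct M a) hp hq h u).
- move=> n r p hp h u.
  apply: (closure_eq xcl (g := fun y => y (seq_formula (exist _ _ h) u))
    (cc _) (continuous_scale (r := ratr r) (cc (seq_formula (exist _ p hp) u)))).
  by move=> _ [M [a [_ ->]]]; exact: (coherent_scale (ct M a) hp h u).
- move=> n p q hp hq h u.
  apply: (closure_eq xcl (g := fun y => y (seq_formula (exist _ _ h) u))
    (cc _) (continuous_maximum (cc _) (cc _))).
  by move=> _ [M [a [_ ->]]]; exact: (coherent_max (ct M a) hp hq h u).
- move=> n p q hp hq h u.
  apply: (closure_eq xcl (g := fun y => y (seq_formula (exist _ _ h) u))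
    (cc _) (continuous_minimum (cc _) (cc _))).
  by move=> _ [M [a [_ ->]]]; exact: (coherent_min (ct M a) hp hq h u).
- move=> n p h' h u.
  apply: (closure_eq xcl (g := fun y => y (seq_formula (exist _ _ h) u))
    (cc _) (continuous_opp (cc _))).
  by move=> _ [M [a [_ ->]]]; exact: (coherent_sup (ct M a) h' h u).
Qed.

Lemma limit_Mod : Mod F T x.
Proof.
have E n (phi : preformula L n) h u :
    feval phi (limit_seq \o u) = value x phi h u.
  apply: feval_value => //; first exact: limit_coherent.
    exact: limit_seq_dense.
  move=> k P t hP v; rewrite limit_atom; exact: value_irrelevance.
have -> : x = seq_tp F limit_seq.
  by apply/funext => -[n [[phi h] u]]; rewrite /seq_tp /= (E _ _ h).
apply: seq_tp_Mod limit_seq_dense => c Tc.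
rewrite (ord0_funE (@tnil limit_model) (limit_seq \o @tnil nat)) (E _ _ (hT Tc)).
apply: (closure_coord_cst xcl).
move=> _ [M [a [MT ->]]]; rewrite /seq_tp /= /cst -(MT _ Tc).
by congr (feval _ _); exact: ord0_funE.
Qed.

End LimitModel.

(** * Witnesses for infima and suprema *)

Section Witnesses.
Context (R : realType) (L : signature R) (F : fragment L).

(* The open condition that the infimum or supremum computed at the head of
   [phi] is attained up to [e]. *)
Definition witness_set n (phi : preformula L n) :
    F n phi -> ('I_n -> nat) -> R -> set {ptws seq_formulas F -> R} :=
  match phi as phi0 in preformula _ n0
    return F n0 phi0 -> ('I_n0 -> nat) -> R -> set {ptws seq_formulas F -> R} with
  | finf _ p => fun h u e => [set y | exists j,
      value y p (frag_sub (sub_inf p) h) (scons j u) < value y (finf p) h u + e]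
  | fcsup _ p => fun h u e => [set y | exists i,
      value y (fcsup p) h u < value y (p i) (frag_sub (sub_csup p i) h) u + e]
  | fcinf _ p => fun h u e => [set y | exists i,
      value y (p i) (frag_sub (sub_cinf p i) h) u < value y (fcinf p) h u + e]
  (* The quantifier [fsup] falls in this case: [coherent_sup] reduces it to an infimum, which has
     its own witnesses. *)
  | _ => fun _ _ _ => setT
  end.

Lemma ptws_open_coord2 (I : Type) (i j : I) (e : R) :
  open [set y : {ptws I -> R} | y i < y j + e].
Proof.
rewrite openE => y /= yij; have d0 : 0 < (y j + e - y i) / 2 by lra.
apply: filterS (filterI (ptws_nbhs_coord y i d0) (ptws_nbhs_coord y j d0)) => z.
by move=> [/=]; rewrite !ltr_norml => /andP[? ?] /andP[? ?]; lra.
Qed.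

Lemma open_ex_coord2 (I : Type) (f g : nat -> I) (e : R) :
  open [set y : {ptws I -> R} | exists i, y (f i) < y (g i) + e].
Proof.
rewrite (_ : [set y | _] = \bigcup_i [set y : {ptws I -> R} | y (f i) < y (g i) + e]).
  by apply: bigcup_open => i _; exact: ptws_open_coord2.
by apply/seteqP; split => [y [i yi]|y [i _ yi]]; exists i.
Qed.

Lemma witness_set_open n (phi : preformula L n) (h : F n phi) u e :
  open (witness_set h u e).
Proof.
case: phi h u => {n} [n P ts|n|n p q|n r p|n p q|n p q|n p|n p|n p|n p] h u;
  try exact: openT.
- exact: (open_ex_coord2
    (fun j => seq_formula (exist _ p (frag_sub (sub_inf p) h)) (scons j u))
    (fun=> seq_formula (exist _ _ h) u)).
- exact: (open_ex_coord2 (fun=> seq_formula (exist _ _ h) u)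
    (fun i => seq_formula (exist _ (p i) (frag_sub (sub_csup p i) h)) u)).
- exact: (open_ex_coord2
    (fun i => seq_formula (exist _ (p i) (frag_sub (sub_cinf p i) h)) u)
    (fun=> seq_formula (exist _ _ h) u)).
Qed.

Lemma witnessed_witness_set (y : {ptws seq_formulas F -> R}) : witnessed y ->
  forall n (phi : preformula L n) (h : F n phi) u e, 0 < e -> witness_set h u e y.
Proof.
move=> yw n phi; case: phi => {n} [n P ts|n|n p q|n r p|n p q|n p q|n p|n p|n p|n p]
  h u e e0 //=.
- rewrite (witnessed_inf yw (frag_sub (sub_inf p) h)).
  set A := [set _ | _ in _].
  have /inf_lt[|_ [j _ <-] je] : inf A < inf A + e by rewrite ltrDl.
  + by exists (value y p (frag_sub (sub_inf p) h) (scons 0%N u)), 0%N.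
  + by exists j.
- rewrite (witnessed_csup yw (fun i => frag_sub (sub_csup p i) h)).
  set A := [set _ | _ in _].
  have /sup_gt[|_ [i _ <-] ie] : sup A - e < sup A by rewrite ltrBlDr ltrDl.
  + by exists (value y (p 0%N) (frag_sub (sub_csup p 0%N) h) u), 0%N.
  + by exists i; rewrite -ltrBlDr.
- rewrite (witnessed_cinf yw (fun i => frag_sub (sub_cinf p i) h)).
  set A := [set _ | _ in _].
  have /inf_lt[|_ [i _ <-] ie] : inf A < inf A + e by rewrite ltrDl.
  + by exists (value y (p 0%N) (frag_sub (sub_cinf p 0%N) h) u), 0%N.
  + by exists i.
Qed.

Variables (T : theory L) (x : {ptws seq_formulas F -> R}).
Hypothesis xcl : closure
  [set y | exists (M : structure L) (a : nat -> M), models M T /\ y = seq_tp F a] x.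
Hypothesis xW : forall n (phi : preformula L n) (h : F n phi) u k,
  witness_set h u k.+1%:R^-1 x.

Lemma witness_set_all n (phi : preformula L n) (h : F n phi) u e :
  0 < e -> exists2 d, d < e & witness_set h u d x.
Proof.
by move=> /natSinv_lt[k /(_ k (leqnn k)) ke]; exists k.+1%:R^-1.
Qed.

(** That the infimum is at most each of its terms, and dually for suprema, is a closed condition and
    passes to the limit; the witness sets supply the other inequality up to each [e]. *)
Lemma witnessed_limit : witnessed x.
Proof.
have le (i j : seq_formulas F) (H : forall (M : structure L) (a : nat -> M),
    seq_tp F a i <= seq_tp F a j) : x i <= x j.
  apply: (closure_le xcl (g := fun y : {ptws seq_formulas F -> R} => y i)
    (h := fun y : {ptws seq_formulas F -> R} => y j)).
  - exact: ptws_coord_continuous.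
  - exact: ptws_coord_continuous.
  - by move=> _ [M [a [_ ->]]].
split.
- move=> n p hp h u.
  have pj j : value x (finf p) h u <= value x p hp (scons j u).
    apply: le => M a; rewrite /seq_tp /= comp_scons.
    have [B pB] := feval_bounded M (frag_formula hp).
    apply: ge_inf; last by exists (a j).
    exact: (bounded_lbound (fun y _ => pB (scons y (a \o u)))).
  apply/eqP; rewrite eq_le; apply/andP; split.
    apply: lb_le_inf => [|_ [j _ <-]//].
    by exists (value x p hp (scons 0%N u)), 0%N.
  apply/ler_addgt0Pr => e /(witness_set_all h u)[d de [j]].
  rewrite (value_irrelevance _ _ hp) => je; apply: (@le_trans _ _ (value x p hp (scons j u))).
    by apply: ge_inf; [exists (value x (finf p) h u) => _ [i _ <-]|exists j].
  by apply/ltW/(lt_le_trans je); rewrite lerD2l ltW.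
- move=> n p hp h u.
  have pj j : value x (p j) (hp j) u <= value x (fcsup p) h u.
    apply: le => M a; rewrite /seq_tp /=.
    have [_ /(equicontinuous_bounded_norm M)[B /(_ (a \o u)) pB]] := frag_formula h.
    by apply: ub_le_sup; [exact: bounded_ubound pB|exists j].
  apply/eqP; rewrite eq_le; apply/andP; split; last first.
    apply: ge_sup => [|_ [j _ <-]//].
    by exists (value x (p 0%N) (hp 0%N) u), 0%N.
  apply/ler_addgt0Pr => e /(witness_set_all h u)[d de [j]].
  rewrite (value_irrelevance _ _ (hp j)) => je.
  apply: le_trans (ltW je) _; apply: lerD (ltW de).
  by apply: ub_le_sup; [exists (value x (fcsup p) h u) => _ [i _ <-]|exists j].
- move=> n p hp h u.
  have pj j : value x (fcinf p) h u <= value x (p j) (hp j) u.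
    apply: le => M a; rewrite /seq_tp /=.
    have [_ /(equicontinuous_bounded_norm M)[B /(_ (a \o u)) pB]] := frag_formula h.
    by apply: ge_inf; [exact: bounded_lbound pB|exists j].
  apply/eqP; rewrite eq_le; apply/andP; split.
    apply: lb_le_inf => [|_ [j _ <-]//].
    by exists (value x (p 0%N) (hp 0%N) u), 0%N.
  apply/ler_addgt0Pr => e /(witness_set_all h u)[d de [j]].
  rewrite (value_irrelevance _ _ (hp j)) => je.
  apply: (@le_trans _ _ (value x (p j) (hp j) u)).
    by apply: ge_inf; [exists (value x (fcinf p) h u) => _ [i _ <-]|exists j].
  by apply/ltW/(lt_le_trans je); rewrite lerD2l ltW.
Qed.

End Witnesses.

(** * The closure of the class as a Baire space *)

Section Baire.
Context (R : realType) (L : signature R) (F : fragment L) (T : theory L).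
Hypothesis hT : fragment_theory F T.
Variable xi : Mod F T.
Local Notation C := (closure (iso_class xi)).
Local Notation Phi := (seq_formulas F).

Definition class_types : set {ptws Phi -> R} :=
  [set y | exists2 eta, iso_class xi eta & y = val eta].

(** The largest open set of the ambient product whose trace on [C] misses [A]; it moves nowhere
    dense subsets of [C] to the space in which [generic_point] works. *)
Definition avoid (A : set C) : set {ptws Phi -> R} :=
  \bigcup_(V in [set V : set {ptws Phi -> R} |
    open V /\ forall q : C, V (val (val q)) -> ~ A q]) V.

Lemma avoid_open A : open (avoid A).
Proof. by apply: bigcup_open => V []. Qed.

Lemma Mod_nbhsP (eta : Mod F T) (V : set {ptws Phi -> R}) :
  open V -> V (val eta) -> nbhs eta [set z : Mod F T | V (val z)].
Proof. by move=> oV Veta; apply/set_type_nbhsP; exists V. Qed.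

(** An open set that meets the class contains a point of [C] outside the closure of [A], hence a
    smaller open set that misses [A]; the class, being dense in [C], meets that set as well. *)
Lemma avoid_dense A (V : set {ptws Phi -> R}) : nowhere_dense A ->
  open V -> V `&` class_types !=set0 -> V `&` avoid A `&` class_types !=set0.
Proof.
move=> nA oV [y [Veta [eta xieta yE]]]; rewrite {}yE in Veta.
have Ceta : C eta by exact: subset_closure.
have [q [Vq nq]] : exists q : C, V (val (val q)) /\ ~ closure A q.
  apply: contrapT => H; have : interior (closure A) (SigSub (mem_set Ceta)).
    apply/set_type_nbhsP; exists [set z : Mod F T | V (val z)]; split => //.
      by apply/set_type_openP; exists V.
    by move=> q Vq; apply: contrapT => nq; apply: H; exists q.
  by rewrite nA.
have [B [nB AB]] : exists B : set C, nbhs q B /\ A `&` B = set0.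
  apply: contrapT => H; apply: nq => B nB; apply: contrapT => AB.
  by apply: H; exists B; split => //; apply/eqP/negPn/negP => /set0P.
have [B1 [oB1 B1q B1B]] := proj1 (set_type_nbhsP _ _) nB.
have [B2 oB2 B12] := proj1 (set_type_openP _) oB1.
have B2q : B2 (val (val q)) by apply/B12.
have [zeta [xizeta [Vzeta Bzeta]]] := set_valP q _
  (filterI (Mod_nbhsP oV Vq) (Mod_nbhsP oB2 B2q)).
exists (val zeta); split; last by exists zeta.
split=> //; exists B2 => //; split => // q' B2q' Aq'.
have : (A `&` B) q' by split => //; apply: B1B; apply/B12.
by rewrite AB.
Qed.

(** Were the class meager too, two sequences of nowhere dense sets would cover [C]. A generic point
    avoids them all; it also meets every witness set, so it is the code of a model and does belong
    to [C]. *)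
Lemma comeager_nonmeager : comeager (trace C (iso_class xi)) ->
  ~ meager (trace C (iso_class xi)).
Proof.
move=> [N1 N1n N1E] [N2 N2n N2E].
have [f fi] := seq_formulas_code F.
pose W (j : (nat + nat) + (Phi * nat)) : set {ptws Phi -> R} :=
  match j with
  | inl (inl i) => avoid (N1 i)
  | inl (inr i) => avoid (N2 i)
  | inr (z, k) => witness_set (proj2_sig (projT2 z).1) (projT2 z).2 k.+1%:R^-1
  end.
pose cj (j : (nat + nat) + (Phi * nat)) : nat :=
  match j with
  | inl i => pickle (inl i : (nat + nat) + (nat * nat))
  | inr (z, k) => pickle (inr (f z, k) : (nat + nat) + (nat * nat))
  end.
have cji : injective cj.
  by move=> [i|[z k]] [i'|[z' k']] /= /(pcan_inj pickleK) // [];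
    [move=> -> | move=> /fi -> ->].
have Wo j : open (W j).
  by case: j => [[i|i]|[z k]]; [exact: avoid_open..|exact: witness_set_open].
have yw (eta : Mod F T) : witnessed (val eta : {ptws Phi -> R}).
  rewrite (val_seq_tp eta); apply: seq_tp_witnessed; apply: dense_seq_tp_inf.
  exact: model_seq_dense.
have Wd j (V : set {ptws Phi -> R}) : open V -> V `&` class_types !=set0 ->
    V `&` W j `&` class_types !=set0.
  case: j => [[i|i]|[z k]]; [exact: avoid_dense..|].
  move=> _ [y [Veta [eta xieta yE]]]; rewrite {}yE in Veta.
  exists (val eta); split; last by exists eta.
  by split => //; apply: witnessed_witness_set => //; rewrite invr_gt0.
have S0 : class_types !=set0.
  by exists (val xi); exists xi => //; exact: iso_class_refl.
have [x Sx Wx] := generic_point fi cji Wo Wd S0.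
have xcl : closure [set y : {ptws Phi -> R} |
    exists (M : structure L) (a : nat -> M), models M T /\ y = seq_tp F a] x.
  apply: closure_subset Sx => _ [eta _ ->].
  by exists (model_of eta), (model_seq eta); split;
    [exact: model_of_models|exact: val_seq_tp].
have xw : witnessed x.
  apply: (witnessed_limit xcl) => n phi h u k.
  exact: (Wx (inr (seq_formula (exist _ phi h) u, k))).
have Mx := limit_Mod hT xcl xw.
pose eta : Mod F T := SigSub (mem_set Mx).
have Ceta : C eta.
  move=> B /set_type_nbhsP[V [oV Vx VB]].
  have [y [[zeta xizeta yE] Vzeta]] := Sx V (open_nbhs_nbhs (conj oV Vx)).
  rewrite {}yE in Vzeta.
  by exists zeta; split => //; exact: VB.
pose q : C := SigSub (mem_set Ceta).
have : (trace C (iso_class xi) `|` ~` trace C (iso_class xi)) q by rewrite setUCr.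
case; [rewrite N2E => -[i _ Nq]; have := Wx (inl (inr i))|
       rewrite N1E => -[i _ Nq]; have := Wx (inl (inl i))].
  by move=> [V [_ VN] Vx]; exact: (VN q).
by move=> [V [_ VN] Vx]; exact: (VN q).
Qed.

End Baire.

Theorem theorem1p1 (R : realType) (L : signature R) (F : fragment L)
    (T : theory L) (hT : fragment_theory F T) (xi : Mod F T) :
  [<-> Gdelta (iso_class xi);
       comeager (trace (closure (iso_class xi)) (iso_class xi));
       ~ meager (trace (closure (iso_class xi)) (iso_class xi));
       atomic F (model_of xi)].
Proof.
tfae.
- exact: Gdelta_comeager.
- exact: comeager_nonmeager.
- by move=> nm; apply/atomicP; exact: nonmeager_locally_isolated.
- by move=> /atomicP; exact: iso_class_Gdelta.
Qed.
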